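(* Let $F:\mathbb N\to\mathbb R_{\ge 1}$ be increasing with $\lim_{N\to\infty}F(N)=\infty$ and $F(N)\le N^{\eta}$ for all $N$, for some fixed $0<\eta<1/2$. Let $\alpha,\beta\in C^2_0(\mathbb T,\mathbb R)$. Let $\lambda^N_0<\lambda^N_1\le\lambda^N_2<\dots<\lambda^N_{2N-3}\le\lambda^N_{2N-2}<\lambda^N_{2N-1}$ be the eigenvalues of $Q^{\alpha,\beta}_N$ and $\lambda^\pm_0<\lambda^\pm_1\le\lambda^\pm_2<\cdots$ the periodic eigenvalues of $H_\pm$ on $[0,1]$. Then, as $N\to\infty$: (left edge) for $0\le n\le 2[F(N)]$, $$\lambda^N_n=-2+\frac1{4N^2}\lambda^-_n+O(F(N)^2N^{-3});$$ (right edge) for $0\le n\le 2[F(N)]$, $$\lambda^N_{2N-1-n}=2-\frac1{4N^2}\lambda^+_n+O(F(N)^2N^{-3});$$ (bulk) for $n\in\{2\ell,2\ell-1\}$ with $[F(N)]<\ell<N-[F(N)]$, $$\lambda^N_n=-2\cos\frac{\ell\pi}{N}+O(N^{-2}F(N)^{-1}).$$ These estimates hold uniformly in $0\le n\le 2N-1$ and uniformly on bounded subsets of functions $\alpha,\beta$ in $C^2_0(\mathbb T,\mathbb R)$.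
   Context: $\mathbb T=\mathbb R/\mathbb Z$; $C^2_0(\mathbb T,\mathbb R)$ is the space of real-valued 1-periodic $C^2$ functions with $\int_0^1 f\,dx=0$. $[x]$ is the integer part. For $N\ge 3$ and $n\in\mathbb Z$ put $b^N_n=\frac1{4N^2}\beta(\frac nN)$ and $a^N_n=1+\frac1{4N^2}\alpha(\frac nN)$ (both $N$-periodic in $n$). $Q^{\alpha,\beta}_N$ is the real symmetric $2N\times 2N$ matrix with diagonal entries $(n,n)$ equal to $b^N_n$ ($1\le n\le 2N$), entries $(n,n+1)$ and $(n+1,n)$ equal to $a^N_n$ ($1\le n\le 2N-1$), corner entries $(1,2N)$ and $(2N,1)$ equal to $a^N_{N}$, and all other entries $0$. Its eigenvalues are listed in increasing order with multiplicities. $H_\pm=-\partial_x^2+q_\pm$ with $q_\pm(x)=-2\alpha(2x)\mp\beta(2x)$ (upper/lower signs correspond). The periodic eigenvalues on $[0,1]$ (i.e. with 1-periodic boundary conditions) are listed in increasing order with multiplicities. Convention: the $O$-estimates are asymptotic as $N\to\infty$, i.e. for each bounded set of pairs $(\alpha,\beta)$ there are constants $C$, $N_1$ such that the corresponding error bounds hold with constant $C$ for all $N\ge N_1$ and all indicated $n$. *)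

(* Defs.v *)
From HB Require Import structures.
From mathcomp Require Import all_boot all_order all_algebra.
From mathcomp Require Import all_classical all_reals all_analysis.
Set Implicit Arguments.
Unset Strict Implicit.
Unset Printing Implicit Defensive.
Import Order.TTheory GRing.Theory Num.Theory.
Import numFieldNormedType.Exports.
Local Open Scope ring_scope.
Local Open Scope classical_set_scope.

(* Functions on the circle T = R/Z are represented as 1-periodic functions on
   the real line. *)
Definition C2_0 (R : realType) : set (R -> R) :=
  [set f : R -> R | [/\ periodic f 1,
               forall x : R, derivable f x 1,
               forall x : R, derivable f^`() x 1,
               continuous f^`(2) &
               \int[lebesgue_measure]_(x in `[0, 1]) f x = 0]].

(* The suprema are finite for f in [C2_0], by periodicity and continuity. *)
Definition sup_norm (R : realType) (f : R -> R) : R :=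
  sup (range (fun x => `|f x|)).

Definition C2_norm (R : realType) (f : R -> R) : R :=
  sup_norm f + sup_norm f^`() + sup_norm f^`(2).

Definition C2_0_bounded (R : realType) (S : set ((R -> R) * (R -> R))) : Prop :=
  S `<=` @C2_0 R `*` @C2_0 R /\
  exists M : R, forall p, S p -> C2_norm p.1 <= M /\ C2_norm p.2 <= M.

Definition coef_b (R : realType) (beta : R -> R) (N n : nat) : R :=
  (4 * N%:R ^+ 2)^-1 * beta (n%:R / N%:R).

Definition coef_a (R : realType) (alpha : R -> R) (N n : nat) : R :=
  1 + (4 * N%:R ^+ 2)^-1 * alpha (n%:R / N%:R).

(* Row i and column j of the ordinals carry the 1-based indices i+1, j+1.  The
   four position tests are mutually exclusive as soon as 2 <= N. *)
Definition Qmx (R : realType) (alpha beta : R -> R) (N : nat) :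
    'M[R]_(2 * N) :=
  \matrix_(i, j)
    if i == j :> nat then coef_b beta N i.+1
    else if j == i.+1 :> nat then coef_a alpha N i.+1
    else if i == j.+1 :> nat then coef_a alpha N j.+1
    else if (i == 0 :> nat) && (j == (2 * N).-1 :> nat)
         || (i == (2 * N).-1 :> nat) && (j == 0 :> nat) then coef_a alpha N N
    else 0.

Definition mx_eigenvalues (R : realType) (n : nat) (A : 'M[R]_n)
    (s : seq R) : Prop :=
  sorted <=%R s /\ char_poly A = \prod_(x <- s) ('X - x%:P).

Definition q_plus (R : realType) (alpha beta : R -> R) (x : R) : R :=
  - 2 * alpha (2 * x) - beta (2 * x).

Definition q_minus (R : realType) (alpha beta : R -> R) (x : R) : R :=
  - 2 * alpha (2 * x) + beta (2 * x).

(* Eigenfunctions of -y'' + q y on [0, 1] with periodic boundary conditions.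
   Since q is defined and continuous on the whole line, each one extends
   uniquely to a solution of the equation on the line; eigenfunctions are
   identified with these extensions. *)
Definition periodic_eigenspace (R : realType) (q : R -> R) (mu : R) :
    set (R -> R) :=
  [set y : R -> R | [/\ forall x : R, derivable y x 1,
               forall x : R, derivable y^`() x 1,
               forall x : R, - y^`(2)%classic x + q x * y x = mu * y x,
               y 1 = y 0 &
               y^`()%classic 1 = y^`()%classic 0]].

(* E has a basis of k functions: every element of E has unique coordinates. *)
Definition has_dim (R : realType) (E : set (R -> R)) (k : nat) : Prop :=
  exists e : 'I_k -> R -> R,
    (forall i, E (e i)) /\
    (forall y, E y ->
       exists! c : 'rV[R]_k, forall x, y x = \sum_(i < k) c 0 i * e i x).

(* Every real mu occurs in lam exactly as many times as the dimension of its
   eigenspace (possibly 0): geometric multiplicities, which coincide with the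
   algebraic ones because the operator is self-adjoint. *)
Definition periodic_eigenvalues (R : realType) (q : R -> R)
    (lam : nat -> R) : Prop :=
  nondecreasing_seq lam /\
  forall mu : R, exists k : nat,
    has_dim (periodic_eigenspace q mu) k /\
    ([set n | lam n = mu] #= `I_k)%card.

(* Main.v *)
Require Import Defs.
From HB Require Import structures.
From mathcomp Require Import all_boot all_order all_algebra.
From mathcomp Require Import complex.
From mathcomp Require Import all_classical all_reals all_analysis.
From mathcomp Require Import ring lra zify.
Import Order.TTheory GRing.Theory Num.Theory.
Import numFieldNormedType.Exports.
Local Open Scope ring_scope.
Local Open Scope classical_set_scope.

(** Put [m = 2 N] and let [S] be the diagonal matrix of alternating signs.  The
    matrix [m^2 (2 + S Q S)] represents, on functions on the grid with [m]
    points, the quadratic form of a discretization of [H_-], and its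
    eigenvalues are handled by the min-max principle.

    Left edge: piecewise linear interpolation to the grid with [m k] points and
    averaging over blocks of [k] points almost preserve the quadratic forms, so
    the low eigenvalues on the two grids differ by [O(F^2 / m)] uniformly in
    [k].  Along an ultrafilter of refinements the discrete eigenpairs converge
    to eigenpairs of [H_-], and conversely the samples of an eigenfunction are
    asymptotically spanned by discrete eigenvectors; comparing multiplicities
    identifies the limits with the periodic eigenvalues of [H_-].

    Bulk: the upper bound for the eigenvalue of index [2 l] uses as trial space
    the eigenvectors of index at most [2 l] of the free problem.  On the top
    pair the potential contributes its grid means, which are small since
    alpha and beta have mean zero, and, by summation by parts, oscillatory
    terms of size [O(1 / F)]; the coupling to lower modes is absorbed by the
    spectral gap.

    Reversing the spectrum turns [Q] for [(alpha, beta)] into [Q] for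
    [(alpha, - beta)], which yields the right edge and the lower bounds. *)

(** The periodic eigenvalues of [H_-] are given only through multiplicities, with no variational
    principle attached to them. Every quantitative comparison is therefore made between two finite
    grids, and the operator is reached only as a limit that inherits the uniform bound. An
    ultrafilter makes all bounded families of grid data converge at once, without extracting
    subsequences.

    Origin of the edge rate: on the span of the modes of frequency up to [F], [kin] is [O(F^2)]
    times [ip]. A change of grid alters the potential by [O((ip + kin) / m)], hence by [O(F^2 / m)]
    relative to [ip], and the loss of norm contributes [F^4 / m^2], which [F^2 <= N] (this is
    [eta < 1/2]) reduces to the same order. Division by [m^2 = 4 N^2] gives [F^2 N^-3].

    Origin of the bulk rate: consecutive free frequencies are separated by at least [4 F] after
    scaling, while the coupling through the potential is bounded by a constant; weighting the cross
    term by the gap leaves [O(1 / F)] on the top pair. *)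

Set Implicit Arguments.
Unset Strict Implicit.
Unset Printing Implicit Defensive.

(** * Orthogonal diagonalization of real symmetric matrices *)

Section SpectralTheorem.
Variable R : rcfType.

(** Evaluating [v A conj(v)^T] from either side gives [x |v|^2 = conj(x) |v|^2], and [|v|^2] is
    nonzero. *)
Lemma symmetric_complex_eigenvalue_real n (A : 'M[R]_n) (x : R[i]) :
  A^T = A -> eigenvalue (map_mx (real_complex R) A) x -> x \is Num.real.
Proof.
move=> symA /eigenvalueP[v vA v0].
set AC := map_mx _ A in vA.
pose f := @Num.conj R[i].
have fAC : map_mx f AC = AC.
  apply/matrixP => i j; rewrite !mxE; exact: conjc_real.
have symAC : AC^T = AC by apply/matrixP => i j; rewrite !mxE -[in RHS]symA mxE.
have vbA : map_mx f v *m AC = f x *: map_mx f v.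
  by rewrite -{1}fAC -map_mxM vA map_mxZ.
have E : x *: (v *m (map_mx f v)^T) = f x *: (v *m (map_mx f v)^T).
  rewrite [LHS]scalemxAl -vA [RHS]scalemxAr -linearZ /= -vbA trmx_mul.
  by rewrite mulmxA symAC.
have [i vi] := rV0Pn v v0.
have nz : (v *m (map_mx f v)^T) 0 0 != 0.
  rewrite mxE psumr_neq0; last first.
    by move=> j _; rewrite !mxE -normCK exprn_ge0.
  apply/hasP; exists i; rewrite ?mem_index_enum //=.
  by rewrite !mxE -normCK exprn_gt0 // normr_gt0.
have /eqP := congr1 (fun M : 'M[_]_1 => M 0 0) E.
rewrite mxE [X in _ == X]mxE -subr_eq0 -mulrBl mulf_eq0.
by rewrite (negbTE nz) orbF subr_eq0 eq_sym CrealE.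
Qed.

(** The polynomial splits over [R[i]] with real roots, and the factorization descends because the
    embedding of coefficients is injective. *)
Lemma symmetric_char_poly_split n (A : 'M[R]_n) : A^T = A ->
  exists s : seq R, sorted <=%R s /\ char_poly A = \prod_(x <- s) ('X - x%:P).
Proof.
move=> symA.
have [sC Es] := closed_field_poly_normal (char_poly (map_mx (real_complex R) A)).
rewrite (monicP (char_poly_monic _)) scale1r in Es.
have sR x : x \in sC -> x \is Num.real.
  move=> xs; refine (symmetric_complex_eigenvalue_real symA _).
  by rewrite eigenvalue_root_char Es root_prod_XsubC.
pose s := [seq complex.Re x | x <- sC].
exists (sort <=%R s); split; first exact: sort_le_sorted.
rewrite (perm_big s) /=; last by rewrite perm_sort.
apply: (map_poly_inj (real_complex R)).
rewrite map_char_poly Es rmorph_prod /= /s big_map.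
rewrite big_seq [RHS]big_seq; apply: eq_bigr => x xs.
by rewrite map_polyXsubC; congr ('X - _%:P); apply/esym/(RRe_real (sR x xs)).
Qed.

Definition householder n (w : 'rV[R]_n) : 'M[R]_n :=
  1%:M - (2 / (w *m w^T) 0 0) *: (w^T *m w).

Lemma householderT n (w : 'rV[R]_n) : (householder w)^T = householder w.
Proof. by rewrite /householder linearB /= trmx1 linearZ /= trmx_mul trmxK. Qed.

Lemma rV_norm_gt0 n (w : 'rV[R]_n) : w != 0 -> 0 < (w *m w^T) 0 0.
Proof.
move=> /rV0Pn[i wi]; rewrite mxE (bigD1 i) //= ltr_pwDl //.
  by rewrite mxE -expr2 exprn_even_gt0.
by apply: sumr_ge0 => j _; rewrite mxE -expr2 sqr_ge0.
Qed.

Lemma householder_orthogonal n (w : 'rV[R]_n) : w != 0 ->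
  householder w *m (householder w)^T = 1%:M.
Proof.
move=> /rV_norm_gt0; rewrite householderT /householder.
set c := (w *m w^T) 0 0 => c0.
have ww : w *m w^T = c%:M by rewrite [LHS]mx11_scalar.
have P2 : (w^T *m w) *m (w^T *m w) = c *: (w^T *m w).
  by rewrite mulmxA -(mulmxA _ w) ww mul_mx_scalar -scalemxAl.
rewrite mulmxBl mul1mx mulmxBr mulmx1 -scalemxAl -scalemxAr P2 !scalerA.
rewrite (_ : 2 / c * (2 / c) * c = 2 / c + 2 / c); last by field; rewrite gt_eqF.
by rewrite scalerDl opprB addrK subrK.
Qed.

(** The reflection along [e - v] exchanges the unit vectors [e] and [v], so its first row is [v].
    The case [v = e] is apart since the direction of reflection would vanish. *)
Lemma orthogonal_first_row n (v : 'rV[R]_n.+1) : (v *m v^T) 0 0 = 1 ->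
  exists P : 'M[R]_n.+1, P *m P^T = 1%:M /\ row 0 P = v.
Proof.
move=> v1; pose e : 'rV[R]_n.+1 := delta_mx 0 0.
have [->|ve] := eqVneq v e.
  exists 1%:M; split; first by rewrite trmx1 mulmx1.
  by rewrite row1.
have w0 : e - v != 0 by rewrite subr_eq0 eq_sym.
exists (householder (e - v)); split; first exact: householder_orthogonal.
have gt0 := rV_norm_gt0 w0.
have ev : (e *m v^T) 0 0 = v 0 0.
  by rewrite -rowE !mxE.
have ve' : (v *m e^T) 0 0 = v 0 0.
  by rewrite -ev !mxE; apply: eq_bigr => j _; rewrite !mxE mulrC.
have ee : (e *m e^T) 0 0 = 1 by rewrite -rowE !mxE !eqxx.
have mB (X Y : 'M[R]_1) : (X - Y) 0 0 = X 0 0 - Y 0 0 by rewrite !mxE.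
have N : ((e - v) *m (e - v)^T) 0 0 = 2 * (1 - v 0 0).
  rewrite linearB /= mulmxBl !mulmxBr.
  by rewrite !mB v1 ev ve' ee; ring.
rewrite rowE -/e /householder mulmxBr mulmx1 -scalemxAr mulmxA N.
have -> : e *m (e - v)^T = (1 - v 0 0)%:M.
  rewrite [LHS]mx11_scalar linearB /= mulmxBr; congr (_ %:M).
  by rewrite mB ev ee.
rewrite mul_scalar_mx scalerA (_ : 2 / _ * _ = 1).
  by rewrite scale1r opprB addrC subrK.
by rewrite N in gt0; field; apply/eqP => h; move: gt0; lra.
Qed.

Lemma char_poly_orthogonal n (P A : 'M[R]_n) :
  P *m P^T = 1%:M -> char_poly (P *m A *m P^T) = char_poly A.
Proof.
move=> PP; rewrite /char_poly.
have PP' : map_mx (@polyC R) P *m map_mx (@polyC R) P^T = 1%:M.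
  by rewrite -map_mxM PP map_mx1.
have -> : char_poly_mx (P *m A *m P^T) =
    map_mx (@polyC R) P *m char_poly_mx A *m map_mx (@polyC R) P^T.
  rewrite /char_poly_mx mulmxBr mulmxBl !map_mxM; congr (_ - _).
  by rewrite mul_mx_scalar -scalemxAl PP' scalemx1.
by rewrite !det_mulmx mulrAC -det_mulmx PP' det1 mul1r.
Qed.

(** Deflation: a normalized eigenvector for the head of [s] is made the first row of [P]. Symmetry
    then makes [P A P^T] block diagonal, and the remaining block has the tail of [s] as its
    spectrum. The rows of the final matrix are eigenvectors in the order of [s]. *)
Lemma symmetric_orthodiagonalization (s : seq R) n (A : 'M[R]_n) : A^T = A ->
  char_poly A = \prod_(x <- s) ('X - x%:P) ->
  size s = n /\ exists P : 'M[R]_n,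
    P *m P^T = 1%:M /\ P *m A = diag_mx (\row_(i < n) s`_i) *m P.
Proof.
move=> symA cA.
have szs : size s = n.
  by have := size_char_poly A; rewrite cA size_prod_XsubC => -[].
split => //.
elim: n s A symA cA szs => [|n IH] s A symA cA szs.
  by exists 1%:M; split; apply/matrixP => -[].
case: s => // x s in cA szs *.
have /eigenvalueP[v vA v0] : eigenvalue A x.
  by rewrite eigenvalue_root_char cA root_prod_XsubC mem_head.
have vv := rV_norm_gt0 v0.
pose c := Num.sqrt ((v *m v^T) 0 0).
have c0 : 0 < c by rewrite sqrtr_gt0.
have cc : c ^+ 2 = (v *m v^T) 0 0 by rewrite sqr_sqrtr // ltW.
have [P [PP P0]] : exists P : 'M[R]_n.+1, P *m P^T = 1%:M /\ row 0 P = c^-1 *: v.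
  apply: orthogonal_first_row.
  rewrite linearZ /= -scalemxAl -scalemxAr scalerA mxE -cc.
  by field; rewrite gt_eqF.
have PtP : P^T *m P = 1%:M by apply: mulmx1C.
have [B defB] : exists B : 'M[R]_(1 + n), B = P *m A *m P^T by exists (P *m A *m P^T).
have symB : B^T = B by rewrite defB !trmx_mul trmxK symA mulmxA.
have rB : row 0 B = x *: delta_mx 0 0.
  rewrite defB rowE !mulmxA -rowE P0 -scalemxAl vA -scalemxAl -scalemxAl.
  rewrite scalerA mulrC -scalerA; congr (_ *: _).
  rewrite scalemxAl -P0 rowE -mulmxA PP mulmx1 //.
have l0 : lshift n 0 = 0 :> 'I_(1 + n) by apply: val_inj.
have uB : ulsubmx B = x%:M.
  rewrite [LHS]mx11_scalar; congr (_ %:M).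
  have := congr1 (fun M : 'rV_n.+1 => M 0 0) rB; rewrite !mxE !eqxx mulr1 => <-.
  by rewrite l0.
have urB : ursubmx B = 0.
  apply/matrixP => i j; rewrite (ord1 i) !mxE l0.
  have := congr1 (fun M : 'rV_n.+1 => M 0 (rshift 1 j)) rB.
  by rewrite !mxE /= mulr0 => <-.
have dlB : dlsubmx B = 0.
  by rewrite -[LHS]trmxK trmx_dlsub symB urB trmx0.
pose B' := drsubmx B.
have EB : B = block_mx x%:M 0 0 B' by rewrite -[LHS]submxK uB urB dlB.
have simAB : char_poly A = char_poly B by rewrite defB char_poly_orthogonal.
have cB' : char_poly B' = \prod_(y <- s) ('X - y%:P).
  have : char_poly B = ('X - x%:P) * char_poly B'.
    rewrite EB /char_poly /char_poly_mx (map_block_mx (@polyC R) x%:M).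
    rewrite (scalar_mx_block 1 n 'X) opp_block_mx (add_block_mx 'X%:M).
    by rewrite !map_mx0 !oppr0 !addr0 (det_lblock ('X%:M + _)) det_mx11 !mxE.
  rewrite -simAB cA big_cons => E.
  have nz : 'X - x%:P != 0 by rewrite polyXsubC_eq0.
  by apply/esym/(mulfI nz).
have symB' : B'^T = B' by rewrite /B' trmx_drsub symB.
have szs' : size s = n by case: szs.
have [Q [QQ QB]] := IH s B' symB' cB' szs'.
pose Q1 : 'M[R]_(1 + n) := block_mx 1%:M 0 0 Q.
have EQ : Q1 *m B = diag_mx (\row_(i < n.+1) (x :: s)`_i) *m Q1.
  rewrite EB (mulmx_block 1%:M) !mulmx0 !mul0mx !addr0 !add0r mul1mx QB.
  have -> : diag_mx (\row_(i < n.+1) (x :: s)`_i) =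
      block_mx x%:M 0 0 (diag_mx (\row_(i < n) s`_i)) :> 'M[R]_(1 + n).
    apply/matrixP => i j; rewrite !mxE -(inj_eq val_inj).
    case: splitP => i' /= Ei; rewrite !mxE; case: splitP => j' /= Ej; rewrite !mxE /= Ei Ej.
    - by rewrite !ord1.
    - by rewrite ord1.
    - by rewrite ord1.
    by rewrite !add1n eqSS.
  apply/esym/(etrans (mulmx_block x%:M 0 0 _ 1%:M 0 0 Q)).
  by rewrite !mulmx0 !mul0mx !addr0 !add0r mulmx1.
have Q1T : Q1^T = block_mx 1%:M 0 0 Q^T by rewrite /Q1 tr_block_mx trmx1 !trmx0.
exists (Q1 *m P); split.
  have QQ1 : Q1 *m Q1^T = 1%:M.
    rewrite Q1T /Q1 mulmx_block !mulmx0 !mul0mx !addr0 !add0r mulmx1 QQ.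
    by rewrite -scalar_mx_block.
  by rewrite trmx_mul mulmxA -(mulmxA Q1) PP mulmx1; exact: QQ1.
rewrite -mulmxA (_ : P *m A = B *m P); last by rewrite defB -[RHS]mulmxA PtP mulmx1.
by rewrite mulmxA EQ -mulmxA.
Qed.

End SpectralTheorem.

(** * Quadratic forms of periodic grid functions and the min-max principle *)

Section GridForms.
Variable R : realType.
Implicit Types (m n : nat) (u v w a b c D : nat -> R) (g e : nat -> nat -> R).

Definition grid_periodic m u := forall i, u (i + m)%N = u i.

Definition ip m u v : R := m%:R^-1 * \sum_(i < m) u i * v i.

Definition dif u (i : nat) : R := u i.+1 - u i.

(** Discrete analogue of the integral of [u' v'] over a period of length 1 with mesh [1 / m]. *)
Definition kin m u v : R := m%:R ^+ 2 * ip m (dif u) (dif v).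

(** When [u] and [v] vary slowly this is close to the mean of [(b - 2 a) u v]; this is how the
    combination [- 2 alpha + beta] of [q_minus] arises. *)
Definition pot m a b u v : R :=
  m%:R^-1 * \sum_(i < m) (b i * u i * v i - a i * (u i * v i.+1 + u i.+1 * v i)).

Definition en m a b u v : R := kin m u v + pot m a b u v.

Definition lincomb n c g (i : nat) : R := \sum_(j < n) c j * g j i.

(* For [a = 1 + alpha / m^2] and [b = beta / m^2] the form [en m alpha beta] is
   [m^2 (2 + S Q S)] with [S] the alternating diagonal sign matrix. *)
Definition eigensystem m a b D e :=
  [/\ forall j, (j < m)%N -> grid_periodic m (e j),
      forall i j, (i < m)%N -> (j < m)%N -> ip m (e i) (e j) = (i == j)%:R,
      forall j, (j < m)%N -> forall w, grid_periodic m w ->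
        en m a b (e j) w = D j * ip m (e j) w &
      forall i j, (i <= j)%N -> (j < m)%N -> D i <= D j].

Lemma grid_periodic_modn m u i : grid_periodic m u -> u (i %% m)%N = u i.
Proof.
move=> pu; rewrite [in RHS](divn_eq i m) addnC.
by elim: (_ %/ _)%N => [|k IH]; rewrite ?addn0 // mulSnr addnA pu.
Qed.

Lemma grid_periodic_lincomb m n c g :
  (forall j, (j < n)%N -> grid_periodic m (g j)) -> grid_periodic m (lincomb n c g).
Proof. by move=> pg i; apply: eq_bigr => j _; rewrite pg. Qed.

Lemma sum_grid_shift m u : grid_periodic m u ->
  \sum_(i < m) u i.+1 = \sum_(i < m) u i.
Proof.
case: m => [|m] pu; first by rewrite !big_ord0.
by rewrite big_ord_recr big_ord_recl /= addrC -(pu 0) add0n.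
Qed.

Lemma ipC m u v : ip m u v = ip m v u.
Proof. by congr (_ * _); apply: eq_bigr => i _; rewrite mulrC. Qed.

Lemma ip_ge0 m u : 0 <= ip m u u.
Proof.
by rewrite mulr_ge0 ?invr_ge0 //; apply: sumr_ge0 => i _; rewrite -expr2 sqr_ge0.
Qed.

Lemma enC m a b u v : en m a b u v = en m a b v u.
Proof.
rewrite /en /kin ipC; congr (_ + _ * _); apply: eq_bigr => i _; ring.
Qed.

(** Both [ip] and [en] are linear in the values [u i] and [u i.+1], so one exchange of sums serves
    for both. *)
Lemma linear_form_lincomb m n (k : R) (p q : nat -> R) c g :
  k * \sum_(i < m) (p i * lincomb n c g i + q i * lincomb n c g i.+1) =
  \sum_(j < n) c j * (k * \sum_(i < m) (p i * g j i + q i * g j i.+1)).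
Proof.
transitivity (\sum_(j < n) k * \sum_(i < m) c j * (p i * g j i + q i * g j i.+1)).
  rewrite -mulr_sumr; congr (_ * _); rewrite exchange_big; apply: eq_bigr => i _.
  rewrite /lincomb !mulr_sumr -big_split; apply: eq_bigr => j _ /=; ring.
by apply: eq_bigr => j _; rewrite -mulr_sumr mulrCA.
Qed.

Lemma ip_lincombl m n c g v :
  ip m (lincomb n c g) v = \sum_(j < n) c j * ip m (g j) v.
Proof.
have H u : ip m u v = m%:R^-1 * \sum_(i < m) (v i * u i + 0 * u i.+1).
  by congr (_ * _); apply: eq_bigr => i _; ring.
rewrite H (linear_form_lincomb _ _ _ v (fun=> 0)).
by apply: eq_bigr => j _; rewrite H.
Qed.

Lemma en_lincombl m a b n c g v :
  en m a b (lincomb n c g) v = \sum_(j < n) c j * en m a b (g j) v.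
Proof.
have H u : en m a b u v = m%:R^-1 * \sum_(i < m)
    ((b i * v i - m%:R ^+ 2 * dif v i - a i * v i.+1) * u i +
     (m%:R ^+ 2 * dif v i - a i * v i) * u i.+1).
  rewrite /en /kin /ip /pot mulrCA -mulrDr mulr_sumr -big_split.
  by congr (_ * _); apply: eq_bigr => i _; rewrite /= /dif; ring.
rewrite H (linear_form_lincomb _ _ _
  (fun i => b i * v i - m%:R ^+ 2 * dif v i - a i * v i.+1)
  (fun i => m%:R ^+ 2 * dif v i - a i * v i)).
by apply: eq_bigr => j _; rewrite H.
Qed.

Lemma ip_lincombr m n c g v :
  ip m v (lincomb n c g) = \sum_(j < n) c j * ip m v (g j).
Proof. by rewrite ipC ip_lincombl; apply: eq_bigr => j _; rewrite ipC. Qed.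

Section Eigensystem.
Variables (m : nat) (a b D : nat -> R) (e : nat -> nat -> R).
Hypothesis m0 : (0 < m)%N.
Hypothesis es : eigensystem m a b D e.

(** Orthonormality says that the square matrix of values of [e] has a right inverse. It is also a
    left inverse, and this is the completeness relation [E]. *)
Lemma eigensystem_complete u : grid_periodic m u ->
  u = lincomb m (fun j => ip m u (e j)) e.
Proof.
move=> pu; have [pe oe _ _] := es.
have mr : m%:R != 0 :> R by rewrite pnatr_eq0 -lt0n.
pose P : 'M[R]_m := \matrix_(j, i) e j i.
have PP : P *m (m%:R^-1 *: P^T) = 1%:M.
  apply/matrixP => i j; rewrite -scalemxAr !mxE -(oe _ _ (ltn_ord i) (ltn_ord j)).
  by congr (_ * _); apply: eq_bigr => k _; rewrite !mxE.
have {}PP := mulmx1C PP.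
have E (i k : 'I_m) : m%:R^-1 * \sum_(j < m) e j i * e j k = (i == k)%:R.
  have := congr1 (fun M : 'M[R]_m => M i k) PP; rewrite -scalemxAl !mxE => <-.
  by congr (_ * _); apply: eq_bigr => j _; rewrite !mxE.
apply/funext => i.
rewrite -(grid_periodic_modn i pu) -(grid_periodic_modn i (grid_periodic_lincomb _ pe)).
have [k ->] : exists k : 'I_m, (i %% m)%N = k by exists (Ordinal (ltn_pmod i m0)).
rewrite /lincomb.
transitivity (\sum_(l < m) u l * (m%:R^-1 * \sum_(j < m) e j l * e j k)).
  rewrite (bigD1 k) //= [X in _ + X]big1 ?addr0; first by rewrite E eqxx mulr1.
  by move=> l /negbTE lk; rewrite E lk mulr0.
transitivity (\sum_(j < m) \sum_(l < m) u l * (m%:R^-1 * (e j l * e j k))).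
  by rewrite exchange_big; apply: eq_bigr => l _; rewrite !mulr_sumr.
apply: eq_bigr => j _; rewrite /ip mulr_sumr mulr_suml; apply: eq_bigr => l _; ring.
Qed.

Lemma ip_parseval u v : grid_periodic m u ->
  ip m u v = \sum_(j < m) ip m u (e j) * ip m (e j) v.
Proof. by move=> /eigensystem_complete {1}->; rewrite ip_lincombl. Qed.

Lemma en_parseval u : grid_periodic m u ->
  en m a b u u = \sum_(j < m) D j * ip m u (e j) ^+ 2.
Proof.
move=> pu; have [_ _ ee _] := es.
rewrite {1}(eigensystem_complete pu) en_lincombl; apply: eq_bigr => j _.
by rewrite ee // (ipC _ (e j)); ring.
Qed.

Lemma ip_eigenspan n c : (n <= m)%N ->
  ip m (lincomb n c e) (lincomb n c e) = \sum_(j < n) c j ^+ 2.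
Proof.
move=> nm; have [_ oe _ _] := es.
rewrite ip_lincombl; apply: eq_bigr => j _; rewrite ip_lincombr.
have jm : (j < m)%N by apply: leq_trans nm.
rewrite (bigD1 j) //= big1 ?addr0; first by rewrite oe // eqxx mulr1.
move=> k kj; rewrite oe //; last by apply: leq_trans nm.
by rewrite eq_sym (inj_eq val_inj) (negbTE kj) mulr0.
Qed.

Lemma en_eigenspan n c : (n < m)%N ->
  en m a b (lincomb n.+1 c e) (lincomb n.+1 c e) <=
  D n * ip m (lincomb n.+1 c e) (lincomb n.+1 c e).
Proof.
move=> nm; have [pe oe ee De] := es.
have pl : grid_periodic m (lincomb n.+1 c e).
  by apply: grid_periodic_lincomb => j jn; apply: pe; apply: leq_trans nm.
rewrite ip_eigenspan // mulr_sumr en_lincombl; apply: ler_sum => j _.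
have jm : (j < m)%N by apply: leq_trans nm.
rewrite ee // ip_lincombr (bigD1 j) //= big1 ?addr0; last first.
  move=> k kj; rewrite oe //; last by apply: leq_trans nm.
  by rewrite eq_sym (inj_eq val_inj) (negbTE kj) mulr0.
rewrite oe // eqxx mulr1 mulrCA -expr2 ler_wpM2r ?sqr_ge0 //.
by apply: De => //; rewrite -ltnS.
Qed.

(** Among combinations of [n + 1] trial functions, a nonzero coefficient vector in the kernel of [A]
    gives a function orthogonal to the first [n] eigenvectors, whose energy is at least [D n] times
    its norm. Asking [ip] to be positive for nonzero coefficients includes the independence of the
    trial functions. *)
Lemma trial_space_le n g X : (n < m)%N ->
  (forall j, (j <= n)%N -> grid_periodic m (g j)) ->
  (forall c, (exists2 j, (j <= n)%N & c j != 0) ->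
     let v := lincomb n.+1 c g in 0 < ip m v v /\ en m a b v v <= X * ip m v v) ->
  D n <= X.
Proof.
move=> nm pg H; have [pe oe ee De] := es.
pose A : 'M[R]_(n.+1, n) := \matrix_(i, j) ip m (g i) (e j).
have kA : kermx A != 0.
  by rewrite -mxrank_eq0 mxrank_ker subn_eq0 -ltnNge ltnS rank_leq_col.
have [i ki] : exists i, row i (kermx A) != 0.
  apply/existsP; rewrite -[X in is_true X]negbK negb_exists.
  apply: contra kA => /forallP k0; apply/eqP/row_matrixP => i; rewrite row0; apply/eqP.
  by have := k0 i; rewrite negbK.
pose c (j : nat) : R := kermx A i (inord j).
have ortho j : (j < n)%N -> ip m (lincomb n.+1 c g) (e j) = 0.
  move=> jn; rewrite ip_lincombl.
  have E := congr1 (fun M : 'M[R]_(n.+1, n) => M i (Ordinal jn)) (mulmx_ker A).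
  rewrite [RHS]mxE [LHS]mxE in E; rewrite -[RHS]E; apply: eq_bigr => k _.
  by rewrite /c inord_val [A _ _]mxE.
have [|v0 vX] := H c.
  have [j kj] := rV0Pn _ ki.
  exists j; first by rewrite -ltnS.
  by move: kj; rewrite mxE /c inord_val.
set v := lincomb _ _ _ in ortho v0 vX.
have pv : grid_periodic m v by apply: grid_periodic_lincomb => j; apply: pg.
rewrite -(ler_pM2r v0) (le_trans _ vX) // en_parseval // ip_parseval // mulr_sumr.
apply: ler_sum => j _; rewrite (ipC _ (e j)) -expr2.
have [jn|nj] := ltnP j n; first by rewrite ortho // expr0n /= !mulr0.
by rewrite ler_wpM2r ?sqr_ge0 // De.
Qed.

End Eigensystem.
End GridForms.

(** * Transfer of forms between a grid and its refinements *)

Section Refinement.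
Variable R : realType.
Implicit Types (m n k : nat) (u v w a b c D : nat -> R) (g e : nat -> nat -> R).

Lemma kinE m u : kin m u u = m%:R * \sum_(i < m) dif u i ^+ 2.
Proof.
case: m => [|m]; first by rewrite /kin /ip !big_ord0 !mulr0.
rewrite /kin /ip (eq_bigr (fun i : 'I_m.+1 => dif u i ^+ 2)); last first.
  by move=> i _; rewrite expr2.
by field; rewrite addrC natr1 pnatr_eq0.
Qed.

Lemma ipE m u : ip m u u = m%:R^-1 * \sum_(i < m) u i ^+ 2.
Proof. by congr (_ * _); apply: eq_bigr => i _; rewrite expr2. Qed.

Lemma kin_ge0 m u : 0 <= kin m u u.
Proof. by rewrite /kin mulr_ge0 ?sqr_ge0 ?ip_ge0. Qed.

Lemma abs_mul2_le (x y : R) : `|2 * x * y| <= x ^+ 2 + y ^+ 2.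
Proof.
have := sqr_ge0 (x - y); have := sqr_ge0 (x + y); rewrite !expr2 => h1 h2.
by rewrite ler_norml; apply/andP; split; nra.
Qed.

Lemma pot_abs_le m a b u (K : R) : grid_periodic m u ->
  (forall i, `|a i| <= K) -> (forall i, `|b i| <= K) ->
  `|pot m a b u u| <= 3 * K * ip m u u.
Proof.
move=> pu aK bK.
have K0 : 0 <= K by apply: le_trans (aK 0); rewrite normr_ge0.
rewrite /pot ipE normrM ger0_norm ?invr_ge0 // mulrCA ler_wpM2l ?invr_ge0 //.
apply: le_trans (ler_norm_sum _ _ _) _.
have -> : 3 * K * \sum_(i < m) u i ^+ 2 =
    \sum_(i < m) (2 * K * u i ^+ 2 + K * u i.+1 ^+ 2).
  rewrite big_split /= -!mulr_sumr (@sum_grid_shift _ m (fun i => u i ^+ 2)); first by ring.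
  by move=> i; rewrite /= pu.
apply: ler_sum => i _.
set x := u i; set y := u i.+1.
have h1 : `|b i * x * x| <= K * x ^+ 2.
  by rewrite -mulrA normrM -expr2 [X in _ * X]ger0_norm ?sqr_ge0 // ler_wpM2r ?sqr_ge0.
have h2 : `|a i * (x * y + y * x)| <= K * (x ^+ 2 + y ^+ 2).
  by rewrite normrM ler_pM // (_ : _ + _ = 2 * x * y) ?abs_mul2_le //; ring.
apply: le_trans (ler_normB _ _) _; lra.
Qed.

(** Replacing [u i.+1] by [u i] in the off-diagonal term costs [a i] times [2 (u i) (dif u i)],
    which is [1 / m] times a product bounded by [u^2 + (m dif u)^2]. *)
Lemma pot_local m a b u (K : R) : (0 < m)%N -> (forall i, `|a i| <= K) ->
  `|pot m a b u u - m%:R^-1 * \sum_(i < m) (b i - 2 * a i) * u i ^+ 2| <=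
  K / m%:R * (ip m u u + kin m u u).
Proof.
move=> m0 aK; have mr : 0 < m%:R :> R by rewrite ltr0n.
rewrite /pot -mulrBr -sumrB normrM ger0_norm ?invr_ge0 ?ler0n //.
rewrite ipE kinE (_ : K / m%:R * _ = m%:R^-1 *
   \sum_(i < m) (K / m%:R * (u i ^+ 2 + (m%:R * dif u i) ^+ 2))); last first.
  rewrite -mulr_sumr big_split /= !mulrDr; congr (_ + _); first by ring.
  have -> : \sum_(i < m) (m%:R * dif u i) ^+ 2 = m%:R ^+ 2 * \sum_(i < m) dif u i ^+ 2.
    by rewrite mulr_sumr; apply: eq_bigr => i _; rewrite exprMn.
  by field; rewrite gt_eqF.
rewrite ler_wpM2l ?invr_ge0 ?ler0n //; apply: le_trans (ler_norm_sum _ _ _) _.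
apply: ler_sum => i _.
rewrite (_ : _ - _ = - (a i * (2 * u i * (m%:R * dif u i)) / m%:R)); last first.
  by rewrite /dif; field; rewrite gt_eqF.
rewrite normrN normrM [X in _ * X]ger0_norm ?invr_ge0 ?ler0n //.
rewrite [leRHS]mulrAC ler_wpM2r ?invr_ge0 ?ler0n // normrM ler_pM //.
exact: abs_mul2_le.
Qed.

Lemma sum_blocks m k (f : nat -> R) :
  \sum_(j < m * k) f j = \sum_(i < m) \sum_(r < k) f (i * k + r)%N.
Proof.
elim: m => [|m IH]; first by rewrite !big_ord0.
by rewrite big_ord_recr /= -IH mulSnr big_split_ord.
Qed.

(** For [m = 2 N] the argument is [i / N]; on the grid of mesh [1 / m] this samples
    [x |-> f (2 x)]. *)
Definition gs m (f : R -> R) (i : nat) : R := f (2 * i%:R / m%:R).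

Definition bounded_lipschitz (K : R) (f : R -> R) :=
  (forall x, `|f x| <= K) /\ (forall x y, `|f x - f y| <= K * `|x - y|).

(* [T] maps functions on the grid with [m1] points to functions on the grid
   with [m2] points; [m] is the size of the coarser of the two grids. *)
Definition transfer (al be : R -> R) (K : R) m m1 m2
    (T : (nat -> R) -> nat -> R) :=
  (forall n c g, T (lincomb n c g) = lincomb n c (fun j => T (g j))) /\
  forall u, grid_periodic m1 u ->
  [/\ grid_periodic m2 (T u),
      ip m1 u u - kin m1 u u / m%:R ^+ 2 <= ip m2 (T u) (T u) <= ip m1 u u,
      kin m2 (T u) (T u) <= kin m1 u u &
      pot m2 (gs m2 al) (gs m2 be) (T u) (T u) <=
      pot m1 (gs m1 al) (gs m1 be) u u + 14 * K / m%:R * (ip m1 u u + kin m1 u u)].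

(** The images under [T] of the first [n + 1] eigenvectors are the trial functions. Since [pot] is
    at least [- 3 K ip], on their span [kin] is at most [A ip]. This controls the error of the
    potential in the numerator and the loss of norm in the denominator, and [A < m^2] keeps the
    images independent. *)
Lemma transfer_eigenvalue_le (al be : R -> R) (K : R) m m1 m2 T D1 D2 e1 e2 n :
  (forall x, `|al x| <= K) -> (forall x, `|be x| <= K) ->
  (0 < m)%N -> (n < m1)%N -> (n < m2)%N ->
  transfer al be K m m1 m2 T ->
  eigensystem m1 (gs m1 al) (gs m1 be) D1 e1 ->
  eigensystem m2 (gs m2 al) (gs m2 be) D2 e2 ->
  let A := D1 n + 3 * K in
  A < m%:R ^+ 2 ->
  D2 n + 3 * K <= (A + 14 * K * (1 + A) / m%:R) / (1 - A / m%:R ^+ 2).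
Proof.
move=> alK beK m0 nm1 nm2 [Tlin TP] es1 es2 A; have AE : A = D1 n + 3 * K by [].
clearbody A; move=> Am.
have K0 : 0 <= K by apply: le_trans (alK 0); rewrite normr_ge0.
have mr : 0 < m%:R :> R by rewrite ltr0n.
have [pe _ _ _] := es1.
rewrite -lerBrDr.
have m20 : (0 < m2)%N by apply: leq_ltn_trans nm2.
have A1 : 0 < 1 - A / m%:R ^+ 2 by rewrite subr_gt0 ltr_pdivrMr ?exprn_gt0 // mul1r.
have pe' j : (j <= n)%N -> grid_periodic m1 (e1 j).
  by move=> jn; apply: pe; apply: leq_ltn_trans nm1.
apply: (trial_space_le m20 es2 (g := fun j => T (e1 j))) => //.
  by move=> j jn; have [] := TP _ (pe' j jn).
move=> c [j0 j0n cj0]; rewrite -Tlin.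
set u := lincomb n.+1 c e1; set v := T u => /=.
have pu : grid_periodic m1 u by apply: grid_periodic_lincomb => j; apply: pe'.
have s0 : 0 < ip m1 u u.
  rewrite (ip_eigenspan es1) // (bigD1 (Ordinal (j0n : (j0 < n.+1)%N))) //=.
  rewrite ltr_pwDl ?exprn_even_gt0 //.
  by apply: sumr_ge0 => i _; rewrite sqr_ge0.
have [_ /andP[ipl ipu] kinl potl] := TP u pu.
have enu := en_eigenspan es1 c nm1; rewrite -/u in enu.
have := pot_abs_le (a := gs m1 al) (b := gs m1 be) (K := K) pu.
move=> /(_ (fun=> alK _) (fun=> beK _)); rewrite ler_norml => /andP[potu _].
have kinA : kin m1 u u <= A * ip m1 u u.
  by move: enu potu; rewrite /en AE; lra.
have ipA : ip m1 u u * (1 - A / m%:R ^+ 2) <= ip m2 v v.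
  apply: le_trans ipl; rewrite mulrBr mulr1 lerD2l lerN2.
  by rewrite mulrCA mulrA ler_wpM2r // invr_ge0 exprn_ge0 // ltW.
have ip2 : 0 < ip m2 v v by apply: lt_le_trans ipA; rewrite mulr_gt0.
split=> //.
rewrite mulrBl lerBrDr.
have A0 : 0 <= A by rewrite -(pmulr_lge0 _ s0); apply: le_trans kinA; exact: kin_ge0.
have step : en m2 (gs m2 al) (gs m2 be) v v + 3 * K * ip m2 v v <=
    (A + 14 * K * (1 + A) / m%:R) * ip m1 u u.
  have h1 : 3 * K * ip m2 v v <= 3 * K * ip m1 u u by rewrite ler_wpM2l // mulr_ge0.
  have h2 : 14 * K / m%:R * (ip m1 u u + kin m1 u u) <=
      14 * K * (1 + A) / m%:R * ip m1 u u.
    rewrite (_ : 14 * K * (1 + A) / m%:R * ip m1 u u =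
       14 * K / m%:R * (ip m1 u u + A * ip m1 u u)); last by ring.
    by rewrite ler_wpM2l ?divr_ge0 ?mulr_ge0 // ?lerD2l // ltW.
  have h3 : A * ip m1 u u = D1 n * ip m1 u u + 3 * K * ip m1 u u by rewrite AE mulrDl.
  rewrite [leRHS]mulrDl h3 /en; move: enu; rewrite /en.
by lra.
apply: le_trans step _; rewrite -[leRHS]mulrA ler_wpM2l //.
  by rewrite addr_ge0 // !mulr_ge0 // ?invr_ge0 ?ler0n // addr_ge0.
by rewrite mulrC ler_pdivlMr.
Qed.

(** The two sampling arguments differ by at most [2 / m], and the weights 1 and 2 of [be] and [al]
    add up to [3 * 2 K / m]. *)
Lemma gs_close (al be : R -> R) (K : R) m k i r :
  bounded_lipschitz K al -> bounded_lipschitz K be -> (0 < m)%N -> (r < k)%N ->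
  `|(gs (m * k) be (i * k + r) - 2 * gs (m * k) al (i * k + r)) -
    (gs m be i - 2 * gs m al i)| <= 6 * K / m%:R.
Proof.
move=> [alK alL] [beK beL] m0 rk.
have K0 : 0 <= K by apply: le_trans (alK 0); rewrite normr_ge0.
have mr : 0 < m%:R :> R by rewrite ltr0n.
have kr : 0 < k%:R :> R by rewrite ltr0n (leq_ltn_trans _ rk).
have close (f : R -> R) : (forall x y, `|f x - f y| <= K * `|x - y|) ->
    `|gs (m * k) f (i * k + r) - gs m f i| <= 2 * K / m%:R.
  move=> /(_ (2 * (i * k + r)%:R / (m * k)%:R) (2 * i%:R / m%:R)) L.
  apply: le_trans L _; rewrite natrD !natrM.
  have -> : 2 * (i%:R * k%:R + r%:R) / (m%:R * k%:R) - 2 * i%:R / m%:R =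
     2 / m%:R * (r%:R / k%:R) :> R by field; rewrite !gt_eqF.
  have rk1 : r%:R / k%:R <= 1 :> R by rewrite ler_pdivrMr // mul1r ler_nat ltnW.
  rewrite ger0_norm ?mulr_ge0 ?invr_ge0 ?ler0n //.
  rewrite (_ : 2 * K / m%:R = K * (2 / m%:R * 1)); last by ring.
  by rewrite !ler_wpM2l // mulr_ge0 ?invr_ge0 ?ler0n.
have ca := close _ alL; have cb := close _ beL.
move: ca cb; rewrite !ler_norml => /andP[a1 a2] /andP[b1 b2].
have -> : 6 * K / m%:R = 2 * K / m%:R + 2 * (2 * K / m%:R) by ring.
by apply/andP; split; lra.
Qed.

Lemma gs_abs_le (al be : R -> R) (K : R) m i :
  bounded_lipschitz K al -> bounded_lipschitz K be ->
  `|gs m be i - 2 * gs m al i| <= 3 * K.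
Proof.
move=> [alK _] [beK _].
have := alK (2 * i%:R / m%:R); have := beK (2 * i%:R / m%:R).
by rewrite -!/(gs _ _ _) !ler_norml => /andP[b1 b2] /andP[a1 a2]; apply/andP; split; lra.
Qed.

Definition interp k u (j : nat) : R :=
  u (j %/ k)%N + (j %% k)%:R / k%:R * dif u (j %/ k)%N.

(** The endpoint [r = k] is included, so that a difference across the end of a cell needs no
    separate treatment. *)
Lemma interpE k u i r : (0 < k)%N -> (r <= k)%N ->
  interp k u (i * k + r) = u i + r%:R / k%:R * dif u i.
Proof.
move=> k0; rewrite /interp leq_eqVlt => /orP[/eqP->|rk].
  rewrite -mulSnr mulnK // modnMl !mul0r addr0 divff ?mul1r.
    by rewrite /dif addrC subrK.
  by rewrite pnatr_eq0 -lt0n.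
by rewrite divnMDl // divn_small // addn0 modnMDl modn_small.
Qed.

Lemma interp_lincomb k n c g :
  interp k (lincomb n c g) = lincomb n c (fun j => interp k (g j)).
Proof.
apply/funext => i; rewrite /interp /dif /lincomb -sumrB mulr_sumr -big_split.
by apply: eq_bigr => j _ /=; ring.
Qed.

(** Constant slopes inside cells preserve [kin] exactly, and convexity controls [ip] from both
    sides. In the constant 14, [pot_local] contributes 1 on each grid and the comparison [cell] of
    the diagonal parts contributes 12. *)
Lemma interp_transfer (al be : R -> R) (K : R) m k :
  bounded_lipschitz K al -> bounded_lipschitz K be -> (0 < m)%N -> (0 < k)%N ->
  transfer al be K m m (m * k) (interp k).
Proof.
move=> alK beK m0 k0; split=> [n c g|u pu]; first exact: interp_lincomb.
have K0 : 0 <= K by apply: le_trans (alK.1 0); rewrite normr_ge0.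
have mr : 0 < m%:R :> R by rewrite ltr0n.
have kr : 0 < k%:R :> R by rewrite ltr0n.
have mk0 : (0 < m * k)%N by rewrite muln_gt0 m0.
have mkr : 0 < (m * k)%:R :> R by rewrite ltr0n.
have pT : grid_periodic (m * k) (interp k u).
  move=> j; rewrite /interp addnC divnMDl // modnMDl addnC pu /dif.
  by rewrite -addSn !pu.
have difE i r : (r < k)%N -> dif (interp k u) (i * k + r) = dif u i / k%:R.
  move=> rk; rewrite {1}/dif -addnS (interpE _ _ k0 rk) (interpE _ _ k0 (ltnW rk)).
  by rewrite -natr1; field; rewrite gt_eqF.
have kinT : kin (m * k) (interp k u) (interp k u) = kin m u u.
  rewrite !kinE (sum_blocks m k (fun j => dif (interp k u) j ^+ 2)) natrM -mulrA; congr (_ * _).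
  rewrite mulr_sumr; apply: eq_bigr => i _.
  rewrite (eq_bigr (fun=> (dif u i / k%:R) ^+ 2)); last by move=> r _; rewrite difE.
  by rewrite sumr_const card_ord -mulr_natr; field; rewrite gt_eqF.
have tE (r : 'I_k) : 0 <= (r%:R / k%:R : R) <= 1.
  by rewrite divr_ge0 //= ler_pdivrMr // mul1r ler_nat ltnW.
have ipT : ip (m * k) (interp k u) (interp k u) =
    (m%:R * k%:R)^-1 * \sum_(r < k) \sum_(i < m) (u i + r%:R / k%:R * dif u i) ^+ 2.
  rewrite ipE (sum_blocks m k (fun j => interp k u j ^+ 2)) natrM; congr (_ * _); rewrite exchange_big.
  by apply: eq_bigr => r _; apply: eq_bigr => i _; rewrite interpE // ltnW.
(* The square of a convex combination falls short of the combination of squares by exactly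
   [t (1 - t)] times the squared difference; periodicity identifies the two sums of squares. *)
have convE (t : R) : \sum_(i < m) (u i + t * dif u i) ^+ 2 =
    \sum_(i < m) u i ^+ 2 - t * (1 - t) * \sum_(i < m) dif u i ^+ 2.
  rewrite (eq_bigr (fun i : 'I_m => (1 - t) * u i ^+ 2 + t * u i.+1 ^+ 2 -
     t * (1 - t) * dif u i ^+ 2)); last by move=> i _; rewrite /dif; ring.
  rewrite sumrB big_split /= -!mulr_sumr.
  rewrite (@sum_grid_shift _ m (fun i => u i ^+ 2)); first by ring.
  by move=> i; rewrite /= pu.
have d0 : 0 <= \sum_(i < m) dif u i ^+ 2 by apply: sumr_ge0 => i _; rewrite sqr_ge0.
have ipTu : ip (m * k) (interp k u) (interp k u) <= ip m u u.
  rewrite ipT ipE (_ : m%:R^-1 * _ = (m%:R * k%:R)^-1 * \sum_(r < k) \sum_(i < m) u i ^+ 2).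
    rewrite ler_wpM2l ?invr_ge0 ?mulr_ge0 //; apply: ler_sum => r _; rewrite convE.
    have /andP[t0 t1] := tE r.
    by rewrite gerBl mulr_ge0 // mulr_ge0 // subr_ge0.
  by rewrite sumr_const card_ord -mulr_natr; field; rewrite !gt_eqF.
have ipTl : ip m u u - kin m u u / m%:R ^+ 2 <= ip (m * k) (interp k u) (interp k u).
  rewrite ipT ipE kinE (_ : _ - _ = (m%:R * k%:R)^-1 *
    \sum_(r < k) (\sum_(i < m) u i ^+ 2 - \sum_(i < m) dif u i ^+ 2)).
    rewrite ler_wpM2l ?invr_ge0 ?mulr_ge0 //; apply: ler_sum => r _; rewrite convE.
    have /andP[t0 t1] := tE r.
    by rewrite lerD2l lerN2 ler_piMl //; nra.
  by rewrite sumr_const card_ord -mulr_natr; field; rewrite !gt_eqF.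
split; rewrite ?kinT ?ipTl ?ipTu //.
have p1 := pot_local (gs m be) u m0 (fun i => alK.1 (2 * i%:R / m%:R) : `|gs m al i| <= K).
have p2 := pot_local (gs (m * k) be) (interp k u) mk0
  (fun i => alK.1 (2 * i%:R / (m * k)%:R) : `|gs (m * k) al i| <= K).
rewrite kinT in p2.
set I := ip m u u in p1 ipTu *; set Kn := kin m u u in p1 p2 *.
have I0 : 0 <= I := ip_ge0 m u.
have Kn0 : 0 <= Kn := kin_ge0 m u.
have p2' : K / (m * k)%:R * (ip (m * k) (interp k u) (interp k u) + Kn) <=
    K / m%:R * (I + Kn).
  apply: ler_pM; rewrite ?divr_ge0 ?addr_ge0 ?ip_ge0 //.
    by rewrite ler_wpM2l // lef_pV2 ?posrE // ler_nat leq_pmulr.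
  by rewrite lerD2r.
pose q (i : nat) := gs m be i - 2 * gs m al i.
pose q' (i : nat) := gs (m * k) be i - 2 * gs (m * k) al i.
(* Half of the 12 comes from moving the weight [q'] to [q], the other half from the variation of the
   squared interpolant inside a cell, where [q] is at most [3 K]. *)
have cell : (m * k)%:R^-1 * (\sum_(j < m * k) q' j * interp k u j ^+ 2) -
    m%:R^-1 * (\sum_(i < m) q i * u i ^+ 2) <= 12 * K / m%:R * (I + Kn).
  rewrite (sum_blocks m k (fun j => q' j * interp k u j ^+ 2)) (_ : m%:R^-1 * _ = (m * k)%:R^-1 *
    \sum_(i < m) \sum_(r < k) q i * u i ^+ 2); last first.
    under [in RHS]eq_bigr do rewrite sumr_const card_ord.
    by rewrite sumrMnl -[_ *+ k]mulr_natr natrM; field; rewrite !gt_eqF.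
  rewrite -mulrBr -sumrB.
  apply: (@le_trans _ _ ((m * k)%:R^-1 * \sum_(i < m) \sum_(r < k)
     (6 * K / m%:R * interp k u (i * k + r) ^+ 2 +
      6 * K / m%:R * (u i ^+ 2 + (m%:R * dif u i) ^+ 2)))).
    rewrite ler_wpM2l ?invr_ge0 ?ler0n //; apply: ler_sum => i _.
    rewrite -sumrB; apply: ler_sum => r _.
    have qc := gs_close i alK beK m0 (ltn_ord r); rewrite -/(q _) -/(q' _) in qc.
    have qb := gs_abs_le m i alK beK; rewrite -/(q _) in qb.
    rewrite interpE // ?(ltnW (ltn_ord r)) //.
    have /andP[t0 t1] := tE r; move: (_ / k%:R) t0 t1 => t t0 t1.
    set x := u i; set d := dif u i; set y := x + t * d.
    have sq : `|y ^+ 2 - x ^+ 2| <= 2 / m%:R * (x ^+ 2 + (m%:R * d) ^+ 2).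
      have m1 : 1 <= m%:R :> R by rewrite ler1n.
      have h1 := abs_mul2_le x (m%:R * d).
      rewrite (_ : y ^+ 2 - x ^+ 2 = t * (2 * x * (m%:R * d) / m%:R) + (t * d) ^+ 2).
        apply: le_trans (ler_normD _ _) _.
        rewrite (_ : 2 / _ * _ = (x ^+ 2 + (m%:R * d) ^+ 2 + (x ^+ 2 + (m%:R * d) ^+ 2)) / m%:R).
          rewrite [leRHS]mulrDl lerD //.
            rewrite normrM (ger0_norm t0); apply: le_trans (ler_piMl (normr_ge0 _) t1) _; rewrite normrM.
            by rewrite [X in _ * X]ger0_norm ?invr_ge0 ?ler0n // ler_wpM2r // invr_ge0 ler0n.
          rewrite ger0_norm ?sqr_ge0 // ler_pdivlMr //.
          apply: (@le_trans _ _ ((m%:R * d) ^+ 2)); last by rewrite lerDr sqr_ge0.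
          rewrite !exprMn mulrAC ler_wpM2r ?sqr_ge0 //.
          have t21 : t ^+ 2 <= 1 by rewrite expr_le1.
          apply: le_trans (ler_piMl (ler0n _ _) t21) _.
          by rewrite expr2 ler_peMl.
        by ring.
      by rewrite /y; field; rewrite gt_eqF.
    rewrite (_ : _ - _ = (q' (i * k + r)%N - q i) * y ^+ 2 + q i * (y ^+ 2 - x ^+ 2)); last by ring.
    apply: lerD.
      apply: le_trans (ler_norm _) _.
      by rewrite normrM [X in _ * X]ger0_norm ?sqr_ge0 // ler_wpM2r // sqr_ge0.
    apply: le_trans (ler_norm _) _; rewrite normrM.
    rewrite (_ : 6 * K / m%:R * _ = 3 * K * (2 / m%:R * (x ^+ 2 + (m%:R * d) ^+ 2))); last by ring.
    by rewrite ler_pM.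
  rewrite (_ : (m * k)%:R^-1 * _ = 6 * K / m%:R * ip (m * k) (interp k u) (interp k u) +
     6 * K / m%:R * (I + Kn)).
    rewrite (_ : 12 * K / m%:R * (I + Kn) = 6 * K / m%:R * (I + Kn) + 6 * K / m%:R * (I + Kn)); last by ring.
    by rewrite lerD2r ler_wpM2l ?divr_ge0 ?mulr_ge0 // (le_trans ipTu) // lerDl.
  under eq_bigr do rewrite big_split /= sumr_const card_ord -mulr_sumr.
  rewrite big_split /= mulrDr; congr (_ + _).
    rewrite -mulr_sumr ipE (sum_blocks m k (fun j => interp k u j ^+ 2)).
    by ring.
  rewrite sumrMnl -[_ *+ k]mulr_natr -mulr_sumr big_split /= /I /Kn ipE kinE.
  have -> : \sum_(i < m) (m%:R * dif u i) ^+ 2 = m%:R ^+ 2 * \sum_(i < m) dif u i ^+ 2.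
    by rewrite mulr_sumr; apply: eq_bigr => i _; rewrite exprMn.
  by rewrite natrM; field; rewrite !gt_eqF.
rewrite -/(q _) in p1.
move: p1 p2; rewrite !ler_norml -/I -/Kn => /andP[p1 _] /andP[_ p2].
move: cell p1 p2 p2'; rewrite /q /q'.
have -> : 14 * K / m%:R * (I + Kn) = K / m%:R * (I + Kn) + K / m%:R * (I + Kn) +
   12 * K / m%:R * (I + Kn) by ring.
lra.
Qed.

Lemma sum_sqr_deviation n (f : nat -> R) (c : R) :
  \sum_(r < n) (f r - c) ^+ 2 =
  \sum_(r < n) f r ^+ 2 - 2 * c * \sum_(r < n) f r + n%:R * c ^+ 2.
Proof.
rewrite (eq_bigr (fun r : 'I_n => f r ^+ 2 - 2 * c * f r + c ^+ 2)).
  by rewrite big_split sumrB /= sumr_const card_ord -mulr_sumr -[_ *+ n]mulr_natl.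
by move=> r _; ring.
Qed.

(** Cauchy-Schwarz, read off from the nonnegativity of the squared deviations from the mean. *)
Lemma sqr_sum_le n (f : nat -> R) :
  (\sum_(r < n) f r) ^+ 2 <= n%:R * \sum_(r < n) f r ^+ 2.
Proof.
case: n => [|n]; first by rewrite !big_ord0 expr0n /= mul0r.
have n0 : 0 < n.+1%:R :> R by rewrite ltr0n.
have := sum_sqr_deviation n.+1 f ((\sum_(r < n.+1) f r) / n.+1%:R).
set S := \sum_(r < n.+1) f r; set Q := \sum_(r < n.+1) f r ^+ 2.
have : 0 <= \sum_(r < n.+1) (f r - S / n.+1%:R) ^+ 2.
  by apply: sumr_ge0 => r _; rewrite sqr_ge0.
move=> h E; rewrite -subr_ge0; apply: le_trans (mulr_ge0 (ltW n0) h) _.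
by rewrite E le_eqVlt; apply/orP; left; apply/eqP; field; rewrite addrC natr1 gt_eqF.
Qed.

Definition blockavg k v (i : nat) : R := k%:R^-1 * \sum_(r < k) v (i * k + r)%N.

Lemma blockavg_lincomb k n c g :
  blockavg k (lincomb n c g) = lincomb n c (fun j => blockavg k (g j)).
Proof.
apply/funext => i; rewrite /blockavg /lincomb exchange_big mulr_sumr.
by apply: eq_bigr => j _ /=; rewrite -mulr_sumr mulrCA.
Qed.

Lemma telescope_dif v i n : v (i + n)%N - v i = \sum_(s < n) dif v (i + s).
Proof.
elim: n => [|n IH]; first by rewrite big_ord0 addn0 subrr.
by rewrite big_ord_recr -IH /dif addnS /= addrC addrA subrK.
Qed.

(** The mean minimizes the squared deviation, so it may be replaced by the first value of the block;
    then one telescopes and applies Cauchy-Schwarz. *)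
Lemma block_deviation_le k v i : (0 < k)%N ->
  0 <= \sum_(r < k) v (i * k + r)%N ^+ 2 - k%:R * blockavg k v i ^+ 2 <=
  k%:R ^+ 2 * \sum_(s < k) dif v (i * k + s) ^+ 2.
Proof.
move=> k0; have kr : 0 < k%:R :> R by rewrite ltr0n.
pose f (r : nat) := v (i * k + r)%N.
have E (c : R) : \sum_(r < k) (f r - c) ^+ 2 = \sum_(r < k) f r ^+ 2 -
    k%:R * blockavg k v i ^+ 2 + k%:R * (blockavg k v i - c) ^+ 2.
  rewrite sum_sqr_deviation /blockavg -/(f _); set S := \sum_(r < k) f r.
  by field; rewrite gt_eqF.
have E1 := E (blockavg k v i); rewrite subrr expr0n /= mulr0 addr0 in E1.
rewrite -[X in 0 <= X <= _]E1; apply/andP; split.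
  by apply: sumr_ge0 => r _; rewrite sqr_ge0.
apply: (@le_trans _ _ (\sum_(r < k) (f r - f 0) ^+ 2)).
  by rewrite E1 E lerDl mulr_ge0 ?sqr_ge0 // ltW.
rewrite (_ : _ * _ = \sum_(r < k) k%:R * \sum_(s < k) dif v (i * k + s) ^+ 2); last first.
  by rewrite sumr_const card_ord -[RHS]mulr_natl mulrA expr2.
apply: ler_sum => r _; rewrite /f addn0 telescope_dif.
apply: le_trans (sqr_sum_le r (fun s => dif v (i * k + s))) _.
apply: ler_pM; rewrite ?ler0n ?ler_nat ?(ltnW (ltn_ord r)) //.
  by apply: sumr_ge0 => s _; rewrite sqr_ge0.
rewrite -!(big_mkord xpredT (fun s => dif v (i * k + s) ^+ 2)).
rewrite (big_cat_nat (leq0n r) (ltnW (ltn_ord r))) /= lerDl.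
by apply: sumr_ge0 => s _; rewrite sqr_ge0.
Qed.

Lemma sum_grid_shiftn m u n : grid_periodic m u ->
  \sum_(i < m) u (i + n)%N = \sum_(i < m) u i.
Proof.
move=> pu; elim: n => [|n <-]; first by apply: eq_bigr => i _; rewrite addn0.
rewrite -(@sum_grid_shift _ m (fun i => u (i + n)%N)).
  by apply: eq_bigr => i _; rewrite addSnnS.
by move=> i; rewrite addnAC pu.
Qed.

(** Averaging lowers [ip] by the variances [dv] inside blocks, which [kin] controls. The potential
    is treated as for interpolation, with the same constant 14. *)
Lemma blockavg_transfer (al be : R -> R) (K : R) m k :
  bounded_lipschitz K al -> bounded_lipschitz K be -> (0 < m)%N -> (0 < k)%N ->
  transfer al be K m (m * k) m (blockavg k).
Proof.
move=> alK beK m0 k0; split=> [n c g|v pv]; first exact: blockavg_lincomb.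
have K0 : 0 <= K by apply: le_trans (alK.1 0); rewrite normr_ge0.
have mr : 0 < m%:R :> R by rewrite ltr0n.
have kr : 0 < k%:R :> R by rewrite ltr0n.
have mk0 : (0 < m * k)%N by rewrite muln_gt0 m0.
have mkr : 0 < (m * k)%:R :> R by rewrite ltr0n.
set w := blockavg k v.
have pw : grid_periodic m w.
  move=> i; rewrite /w /blockavg; congr (_ * _); apply: eq_bigr => r _.
  by rewrite mulnDl addnAC pv.
have pd : grid_periodic (m * k) (fun j => dif v j ^+ 2).
  by move=> j; rewrite /= /dif -addSn !pv.
pose d2 := \sum_(j < m * k) dif v j ^+ 2.
have d20 : 0 <= d2 by apply: sumr_ge0 => j _; rewrite sqr_ge0.
have kinv : kin (m * k) v v = (m * k)%:R * d2 by rewrite kinE.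
have kinw : kin m w w <= kin (m * k) v v.
  rewrite kinv natrM kinE -mulrA ler_wpM2l ?ler0n //.
  (* The difference of adjacent averages is an average of differences over [k] steps. Cauchy-Schwarz
     is used for that average and again for each telescoped difference; afterwards every shift [s]
     contributes the same [d2] by periodicity. *)
  apply: (@le_trans _ _ (\sum_(i < m) \sum_(r < k) \sum_(s < k) dif v (i * k + r + s) ^+ 2)).
    apply: ler_sum => i _.
    have -> : dif w i = k%:R^-1 * \sum_(r < k) (v (i * k + r + k)%N - v (i * k + r)%N).
      rewrite /dif /w /blockavg -mulrBr -sumrB; congr (_ * _); apply: eq_bigr => r _.
      by rewrite mulSnr addnAC.
    rewrite exprMn.
    apply: (@le_trans _ _ (k%:R^-1 ^+ 2 * (k%:R * \sum_(r < k) (v (i * k + r + k)%N - v (i * k + r)%N) ^+ 2))).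
      rewrite ler_wpM2l ?sqr_ge0 //.
      exact: (sqr_sum_le k (fun r => v (i * k + r + k)%N - v (i * k + r)%N)).
    rewrite (_ : _ * _ = k%:R^-1 * \sum_(r < k) (v (i * k + r + k)%N - v (i * k + r)%N) ^+ 2); last first.
      by field; rewrite gt_eqF.
    rewrite ler_pdivrMl // mulr_sumr; apply: ler_sum => r _.
    by rewrite telescope_dif; exact: (sqr_sum_le k (fun s => dif v (i * k + r + s))).
  rewrite -(sum_blocks m k (fun j => \sum_(s < k) dif v (j + s) ^+ 2)) exchange_big.
  rewrite (eq_bigr (fun=> d2)); last first.
    by move=> s _; exact: (sum_grid_shiftn s pd).
  by rewrite sumr_const card_ord mulr_natl.
pose dv (i : nat) := \sum_(r < k) v (i * k + r)%N ^+ 2 - k%:R * w i ^+ 2.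
pose ds (i : nat) := \sum_(s < k) dif v (i * k + s) ^+ 2.
have dvP i : 0 <= dv i <= k%:R ^+ 2 * ds i by apply: block_deviation_le.
have dsE : \sum_(i < m) ds i = d2 by rewrite -(sum_blocks m k (fun j => dif v j ^+ 2)).
have ipvE : ip (m * k) v v = (m * k)%:R^-1 * \sum_(i < m) \sum_(r < k) v (i * k + r)%N ^+ 2.
  by rewrite ipE (sum_blocks m k (fun j => v j ^+ 2)).
have ipB : ip (m * k) v v - ip m w w = (m * k)%:R^-1 * \sum_(i < m) dv i.
  rewrite ipvE ipE /dv sumrB -mulr_sumr mulrBr; congr (_ - _).
  by rewrite natrM; field; rewrite !gt_eqF.
have dv0 : 0 <= \sum_(i < m) dv i.
  by apply: sumr_ge0 => i _; have /andP[] := dvP i.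
have dv1 : (m * k)%:R^-1 * \sum_(i < m) dv i <= kin (m * k) v v / m%:R ^+ 2.
  rewrite kinv (_ : _ / _ = (m * k)%:R^-1 * (k%:R ^+ 2 * d2)).
    rewrite ler_wpM2l ?invr_ge0 ?ler0n // -dsE mulr_sumr.
    by apply: ler_sum => i _; have /andP[] := dvP i.
  by rewrite natrM; field; rewrite !gt_eqF.
have ipw : ip m w w <= ip (m * k) v v.
  by rewrite -subr_ge0 ipB mulr_ge0 // invr_ge0 ler0n.
split=> //.
  by rewrite ipw andbT lerBlDr -lerBlDl ipB.
have p1 := pot_local (gs m be) w m0 (fun i => alK.1 (2 * i%:R / m%:R) : `|gs m al i| <= K).
have p2 := pot_local (gs (m * k) be) v mk0
  (fun i => alK.1 (2 * i%:R / (m * k)%:R) : `|gs (m * k) al i| <= K).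
set I := ip (m * k) v v in p2 ipw ipB *; set Kn := kin (m * k) v v in p2 kinw dv1 *.
have I0 : 0 <= I := ip_ge0 _ v.
have Kn0 : 0 <= Kn := kin_ge0 _ v.
have p1' : K / m%:R * (ip m w w + kin m w w) <= K / m%:R * (I + Kn).
  by rewrite ler_wpM2l ?divr_ge0 // lerD.
have p2' : K / (m * k)%:R * (I + Kn) <= K / m%:R * (I + Kn).
  rewrite ler_wpM2r ?addr_ge0 //.
  by rewrite ler_wpM2l // lef_pV2 ?posrE // ler_nat leq_pmulr.
pose q (i : nat) := gs m be i - 2 * gs m al i.
pose q' (i : nat) := gs (m * k) be i - 2 * gs (m * k) al i.
(* Here [- q] acts on the variance, bounded through [dv1], and the change of weight acts on the
   squares of [v]. *)
have cell : m%:R^-1 * (\sum_(i < m) q i * w i ^+ 2) -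
    (m * k)%:R^-1 * (\sum_(j < m * k) q' j * v j ^+ 2) <= 12 * K / m%:R * (I + Kn).
  have -> : m%:R^-1 * (\sum_(i < m) q i * w i ^+ 2) -
    (m * k)%:R^-1 * (\sum_(j < m * k) q' j * v j ^+ 2) =
    (m * k)%:R^-1 * \sum_(i < m) (- q i * dv i +
       \sum_(r < k) (q i - q' (i * k + r)%N) * v (i * k + r)%N ^+ 2).
    rewrite (sum_blocks m k (fun j => q' j * v j ^+ 2)).
    have -> : m%:R^-1 * \sum_(i < m) q i * w i ^+ 2 =
        (m * k)%:R^-1 * \sum_(i < m) k%:R * (q i * w i ^+ 2).
      by rewrite -mulr_sumr natrM; field; rewrite !gt_eqF.
    rewrite -mulrBr -sumrB; congr (_ * _); apply: eq_bigr => i _.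
    rewrite (_ : \sum_(r < k) (q i - q' (i * k + r)%N) * v (i * k + r)%N ^+ 2 =
       q i * \sum_(r < k) v (i * k + r)%N ^+ 2 -
       \sum_(r < k) q' (i * k + r)%N * v (i * k + r)%N ^+ 2).
      by rewrite /dv; ring.
    by rewrite mulr_sumr -sumrB; apply: eq_bigr => r _; ring.
  apply: (@le_trans _ _ ((m * k)%:R^-1 * \sum_(i < m) (3 * K * dv i +
       6 * K / m%:R * \sum_(r < k) v (i * k + r)%N ^+ 2))).
    rewrite ler_wpM2l ?invr_ge0 ?ler0n //; apply: ler_sum => i _; apply: lerD.
      have /andP[d0 _] := dvP i; rewrite ler_wpM2r //.
      by have := gs_abs_le m i alK beK; rewrite -/(q _) ler_norml => /andP[]; lra.
    rewrite mulr_sumr; apply: ler_sum => r _; rewrite ler_wpM2r ?sqr_ge0 //.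
    have := gs_close i alK beK m0 (ltn_ord r); rewrite -/(q _) -/(q' _) ler_norml.
    by case/andP; lra.
  rewrite big_split /= mulrDr -!mulr_sumr.
  have -> : (m * k)%:R^-1 * (6 * K / m%:R * \sum_(i < m) \sum_(r < k) v (i * k + r)%N ^+ 2) =
     6 * K / m%:R * I by rewrite /I ipvE mulrCA.
  have h1 : (m * k)%:R^-1 * (3 * K * \sum_(i < m) dv i) <= 12 * K / m%:R * Kn.
    rewrite mulrCA (_ : 12 * K / m%:R * Kn = 3 * K * (4 / m%:R * Kn)); last by ring.
    rewrite ler_wpM2l ?mulr_ge0 //; apply: le_trans dv1 _.
    rewrite mulrC ler_wpM2r //.
    have m1 : 1 <= m%:R :> R by rewrite ler1n.
    rewrite expr2 invfM ler_wpM2r ?invr_ge0 ?ler0n //.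
    by apply: (@le_trans _ _ 1); [rewrite invf_le1 | lra].
  have h2 : 6 * K / m%:R * I <= 12 * K / m%:R * I.
    by rewrite ler_wpM2r // ler_wpM2r ?invr_ge0 ?ler0n // ler_wpM2r //; lra.
  by rewrite [leRHS]mulrDr addrC lerD.
move: p1 p2; rewrite !ler_norml -/I -/Kn => /andP[_ p1] /andP[p2 _].
move: cell p1 p2 p2' p1'; rewrite /q /q'.
have -> : 14 * K / m%:R * (I + Kn) = K / m%:R * (I + Kn) + K / m%:R * (I + Kn) +
   12 * K / m%:R * (I + Kn) by ring.
lra.
Qed.

End Refinement.

(** * Trigonometric sums and the eigenbasis of the free problem *)

Section Trigonometry.
Variable R : realType.
Implicit Types x y : R.

Lemma cos_le_pi x y : 0 <= x -> x <= y -> y <= pi -> cos y <= cos x.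
Proof.
move=> x0 xy ypi.
have hx : x \in `[0, pi]%R by rewrite in_itv /= x0 (le_trans xy).
have hy : y \in `[0, pi]%R by rewrite in_itv /= ypi (le_trans x0).
by rewrite leNgt ltr_cos // -leNgt.
Qed.

Lemma sin_mvt x : 0 <= x -> exists2 c : R, 0 <= c <= x & sin x = cos c * x.
Proof.
move=> x0; have [|c + E] := @MVT_segment R sin cos 0 x x0 (fun y _ => is_derive_sin y).
  exact/continuous_subspaceT/continuous_sin.
by rewrite in_itv /= => cx; exists c => //; move: E; rewrite sin0 !subr0.
Qed.

Lemma sin_le_id x : 0 <= x -> sin x <= x.
Proof. by move=> x0; have [c _ ->] := sin_mvt x0; rewrite ler_piMl // cos_le1. Qed.

(** By the double angle formula and the mean value theorem, [sin x] is at least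
    [2 cos(x/2)^2 (x/2)], and [cos(x/2)^2] is at least 1/2 on this range. *)
Lemma sin_ge_half x : 0 <= x -> x <= pi / 2 -> x / 2 <= sin x.
Proof.
move=> x0 xpi; have y0 : 0 <= x / 2 by rewrite divr_ge0.
have pi0 := pi_gt0 R.
have [c /andP[c0 cx] E] := sin_mvt y0.
have cy : cos (x / 2) <= cos c by apply: cos_le_pi => //; lra.
have cy0 : 0 <= cos (x / 2) by apply: cos_ge0_pihalf; apply/andP; split; lra.
have cx0 : 0 <= cos x by apply: cos_ge0_pihalf; apply/andP; split; lra.
have Ex : x = (x / 2) *+ 2 by rewrite mulr2n; field.
have c2 : 1 / 2 <= cos (x / 2) ^+ 2.
  by have := cos_mulr2n (x / 2); rewrite -Ex mulr2n; lra.
have -> : sin x = 2 * (cos (x / 2) * (cos c * (x / 2))).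
  by rewrite {1}Ex sin_mulr2n E mulr2n; ring.
have : cos (x / 2) ^+ 2 * (x / 2) <= cos (x / 2) * (cos c * (x / 2)).
  by rewrite [leRHS]mulrA expr2 ler_wpM2r // ler_wpM2l.
have : 1 / 2 * (x / 2) <= cos (x / 2) ^+ 2 * (x / 2) by rewrite ler_wpM2r.
lra.
Qed.

Lemma sin_ge_half_dist x d : 0 <= d -> d <= x -> x <= pi - d -> d / 2 <= sin x.
Proof.
move=> d0 dx xd; have pi0 := pi_gt0 R.
have [xp|xp] := leP x (pi / 2).
  by apply: le_trans (sin_ge_half _ xp); [rewrite ler_wpM2r | lra].
have -> : sin x = sin (pi - x) by rewrite sinB sinpi cospi; ring.
by apply: (@le_trans _ _ ((pi - x) / 2)); [rewrite ler_wpM2r //; lra | apply: sin_ge_half; lra].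
Qed.

(** The factor [2 sin x] turns each cosine into a difference of sines, and the sum telescopes. *)
Lemma sum_cos x y n : 2 * sin x * \sum_(i < n) cos (2 * x * i%:R + y) =
  sin (2 * x * n%:R + y - x) - sin (y - x).
Proof.
elim: n => [|n IH]; first by rewrite big_ord0 !mulr0 add0r subrr.
rewrite big_ord_recr mulrDr IH /=.
have -> : 2 * x * n.+1%:R + y - x = 2 * x * n%:R + y + x by rewrite -natr1; ring.
rewrite (sinB (2 * x * n%:R + y)) (sinD (2 * x * n%:R + y)); ring.
Qed.

Lemma cos_D2pi_nat x n : cos (x + 2 * pi * n%:R) = cos x.
Proof.
by rewrite -[RHS](periodicn (@cosD2pi R) n x); congr cos; rewrite -[_ *+ n]mulr_natr mulr2n; ring.
Qed.

Lemma sin_D2pi_nat x n : sin (x + 2 * pi * n%:R) = sin x.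
Proof.
by rewrite -[RHS](periodicn (@sinD2pi R) n x); congr sin; rewrite -[_ *+ n]mulr_natr mulr2n; ring.
Qed.

(** Half of the angular step [2 pi l / m] of the mode of frequency [l]; for [m = 2 N] it is half of
    [l pi / N]. *)
Definition halfangle (m l : nat) : R := l%:R * pi / m%:R.

Lemma sin_halfangle_gt0 m p : (0 < p)%N -> (p < m)%N -> 0 < sin (halfangle m p).
Proof.
move=> p0 pm; have m00 := leq_ltn_trans (leq0n _) pm.
have m0 : 0 < m%:R :> R by rewrite ltr0n.
have pi0 := pi_gt0 R.
apply: sin_gt0_pi; rewrite divr_gt0 ?mulr_gt0 ?ltr0n //=.
by rewrite ltr_pdivrMr // mulrC ltr_pM2l // ltr_nat.
Qed.

Lemma sum_cos_halfangle m p y : (0 < p)%N -> (p < m)%N ->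
  \sum_(i < m) cos (2 * halfangle m p * i%:R + y) = 0.
Proof.
move=> p0 pm; have s0 := sin_halfangle_gt0 p0 pm.
have m0 : m%:R != 0 :> R by rewrite pnatr_eq0 -lt0n (leq_ltn_trans _ pm).
have := sum_cos (halfangle m p) y m.
have -> : 2 * halfangle m p * m%:R + y - halfangle m p =
    y - halfangle m p + 2 * pi * p%:R by rewrite /halfangle; field.
rewrite sin_D2pi_nat subrr => /eqP; rewrite mulf_eq0 => /orP[|/eqP //].
by rewrite mulf_eq0 gt_eqF // (gt_eqF s0).
Qed.

(** The extreme values [p = 0] and [p = m] are included: all sines vanish there, and [p = m] does
    occur in the norm of the mode of highest frequency. *)
Lemma sum_sin_halfangle m p : (0 < m)%N -> (p <= m)%N ->
  \sum_(i < m) sin (2 * halfangle m p * i%:R) = 0.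
Proof.
move=> m0 pm; have mr : m%:R != 0 :> R by rewrite pnatr_eq0 -lt0n.
have [->|p0] := posnP p.
  by apply: big1 => i _; rewrite /halfangle !mul0r mulr0 mul0r sin0.
move: pm; rewrite leq_eqVlt => /orP[/eqP->|pm].
  apply: big1 => i _; rewrite /halfangle -[RHS](sin0 R) -(sin_D2pi_nat 0 i) add0r.
  by congr sin; field.
rewrite -[RHS](sum_cos_halfangle (- (pi / 2)) p0 pm).
by apply: eq_bigr => i _; rewrite cosBpihalf.
Qed.

(** The indices [2 l - 1] and [2 l] carry [cos - sin] and [cos + sin] of frequency [l]. In contrast
    to separate cosines and sines, these have norm 1 also for the constant and the alternating mode,
    so no normalization by cases is needed. *)
Definition hartley m (j i : nat) : R :=
  cos (2 * halfangle m (uphalf j) * i%:R) +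
  (-1) ^+ j * sin (2 * halfangle m (uphalf j) * i%:R).

Definition free_eigenvalue m (j : nat) : R :=
  4 * m%:R ^+ 2 * sin (halfangle m (uphalf j)) ^+ 2.

Lemma hartley_periodic m j : (0 < m)%N -> grid_periodic m (hartley m j).
Proof.
move=> m0 i; have mr : m%:R != 0 :> R by rewrite pnatr_eq0 -lt0n.
have E : 2 * halfangle m (uphalf j) * (i + m)%:R =
    2 * halfangle m (uphalf j) * i%:R + 2 * pi * (uphalf j)%:R.
  by rewrite natrD /halfangle; field.
by rewrite /hartley E cos_D2pi_nat sin_D2pi_nat.
Qed.

(** For indices of equal parity the product is the cosine of the difference of angles plus or minus
    the sine of their sum; for opposite parity the roles of sum and difference are exchanged. Only a
    cosine of frequency 0 survives summation. *)
Lemma hartley_orthonormal m j k : ~~ odd m -> (j < m)%N -> (k < m)%N ->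
  ip m (hartley m j) (hartley m k) = (j == k)%:R.
Proof.
move=> mE; wlog jk : j k / (j <= k)%N => [H jm km|jm km].
  have [/H|/ltnW/H] := leqP j k; first exact.
  by rewrite ipC eq_sym; apply.
have m0 : (0 < m)%N by lia.
have mr : m%:R != 0 :> R by rewrite pnatr_eq0 -lt0n.
pose C p := \sum_(i < m) cos (2 * halfangle m p * i%:R).
pose S p := \sum_(i < m) sin (2 * halfangle m p * i%:R).
have C0 p : (0 < p)%N -> (p < m)%N -> C p = 0.
  move=> p0 pm; rewrite -[RHS](sum_cos_halfangle 0 p0 pm).
  by apply: eq_bigr => i _; rewrite addr0.
have S0 p : (p <= m)%N -> S p = 0 by move=> pm; exact: sum_sin_halfangle.
set l := uphalf j; set l' := uphalf k.
have ll : (l <= l')%N by rewrite /l /l'; lia.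
have aD i : 2 * halfangle m (l' + l) * i%:R =
    2 * halfangle m l' * i%:R + 2 * halfangle m l * i%:R.
  by rewrite /halfangle natrD; field.
have aB i : 2 * halfangle m (l' - l) * i%:R =
    2 * halfangle m l' * i%:R - 2 * halfangle m l * i%:R.
  by rewrite /halfangle natrB //; field.
have [opp|opp] := eqVneq (odd j) (odd k).
  have -> : ip m (hartley m j) (hartley m k) =
      m%:R^-1 * (C (l' - l)%N + (-1) ^+ j * S (l' + l)%N).
    congr (_ * _); rewrite mulr_sumr -big_split; apply: eq_bigr => i _ /=.
    rewrite aB aD cosB sinD /hartley -/l -/l' -(signr_odd _ k) -opp signr_odd.
    rewrite -(signr_odd _ j); case: (odd j); rewrite ?expr0 ?expr1; ring.
  rewrite S0 ?mulr0 ?addr0; last by rewrite /l /l'; lia.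
  case: eqVneq => [E|jnk].
    rewrite /l /l' E subnn /C (eq_bigr (fun=> 1)).
      by rewrite sumr_const card_ord -[X in _ * X]mulr_natl mulr1 mulVf.
    by move=> i _; rewrite /halfangle !mul0r mulr0 mul0r cos0.
  by rewrite C0 ?mulr0 //; rewrite /l /l'; lia.
have -> : ip m (hartley m j) (hartley m k) =
    m%:R^-1 * (C (l' + l)%N - (-1) ^+ j * S (l' - l)%N).
  congr (_ * _); rewrite mulr_sumr -sumrB; apply: eq_bigr => i _ /=.
  have -> : (-1) ^+ j = - (-1) ^+ k :> R.
    rewrite -(signr_odd _ k) -(signr_odd _ j).
    by case: (odd j) (odd k) opp => [] [] //= _; rewrite ?expr0 ?expr1 ?opprK.
  rewrite aB aD cosD sinB /hartley -/l -/l'.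
  have -> : (-1) ^+ j = - (-1) ^+ k :> R.
    rewrite -(signr_odd _ k) -(signr_odd _ j).
    by case: (odd j) (odd k) opp => [] [] //= _; rewrite ?expr0 ?expr1 ?opprK.
  rewrite -(signr_odd _ k); case: (odd k); rewrite ?expr0 ?expr1; ring.
rewrite S0 ?C0 ?mulr0 ?subr0 ?mulr0; try by rewrite /l /l'; lia.
by case: eqVneq => // E; rewrite E eqxx in opp.
Qed.

(** After summation by parts, the second difference with angular step [2 t] multiplies the mode by
    [4 sin(t)^2]. *)
Lemma hartley_eigen m j w : (0 < m)%N -> grid_periodic m w ->
  en m (fun=> 0) (fun=> 0) (hartley m j) w = free_eigenvalue m j * ip m (hartley m j) w.
Proof.
move=> m0 pw; have ph := hartley_periodic j m0; set f := hartley m j in ph *.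
have -> : en m (fun=> 0) (fun=> 0) f w = kin m f w.
  by rewrite /en /pot big1 ?mulr0 ?addr0 // => i _; rewrite !mul0r subrr.
rewrite /kin /ip /free_eigenvalue.
have -> : \sum_(i < m) dif f i * dif w i = \sum_(i < m) (2 * f i.+1 - f i.+2 - f i) * w i.+1.
  transitivity (\sum_(i < m) (dif f i * w i.+1 - dif f i.+1 * w i.+1)); last first.
    by apply: eq_bigr => i _; rewrite /dif; ring.
  rewrite sumrB (@sum_grid_shift _ m (fun i => dif f i * w i)); last first.
    by move=> i; rewrite /dif -addSn !ph pw.
  by rewrite -sumrB; apply: eq_bigr => i _; rewrite /dif; ring.
rewrite -(@sum_grid_shift _ m (fun i => f i * w i)); last by move=> i; rewrite ph pw.
set s := sin _.
have rec i : 2 * f i.+1 - f i.+2 - f i = 4 * s ^+ 2 * f i.+1.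
  rewrite /f /hartley; set t := halfangle _ _.
  set x := 2 * t * i.+1%:R.
  have -> : 2 * t * i.+2%:R = x + t *+ 2 by rewrite /x -[in LHS]natr1 mulr2n; ring.
  have -> : 2 * t * i%:R = x - t *+ 2 by rewrite /x -[in RHS]natr1 mulr2n; ring.
  have cT : cos (t *+ 2) = 1 - 2 * s ^+ 2.
    by rewrite cos_mulr2n cos2sin2 -/s mulr2n; ring.
  move: (t *+ 2) cT => T cT; rewrite cosB sinB cosD sinD cT; ring.
rewrite (eq_bigr (fun i : 'I_m => 4 * s ^+ 2 * (f i.+1 * w i.+1))); last first.
  by move=> i _; rewrite rec mulrA.
by rewrite -mulr_sumr; ring.
Qed.

Lemma halfangle_le_pihalf m j : (0 < m)%N -> ~~ odd m -> (j < m)%N ->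
  halfangle m (uphalf j) <= pi / 2.
Proof.
move=> m0 me jm; rewrite /halfangle ler_pdivrMr ?ltr0n // mulrAC ler_pdivlMr //.
rewrite [leRHS]mulrC -mulrA [pi * 2]mulrC mulrA ler_pM2r ?pi_gt0 // -natrM ler_nat; lia.
Qed.

Lemma halfangle_ge0 m j : 0 <= halfangle m j.
Proof. by rewrite /halfangle divr_ge0 ?mulr_ge0 ?pi_ge0. Qed.

Lemma halfangle_le m i j : (i <= j)%N -> halfangle m i <= halfangle m j.
Proof.
by move=> ij; rewrite /halfangle ler_wpM2r ?invr_ge0 // ler_wpM2r ?pi_ge0 // ler_nat.
Qed.

Lemma hartley_eigensystem m : (0 < m)%N -> ~~ odd m ->
  eigensystem m (fun=> 0) (fun=> 0) (free_eigenvalue m) (hartley m).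
Proof.
move=> m0 me; have pi0 := pi_gt0 R; split.
- by move=> j _; exact: hartley_periodic.
- by move=> i j; exact: hartley_orthonormal.
- by move=> j _ w; exact: hartley_eigen.
move=> i j ij jm; rewrite /free_eigenvalue ler_wpM2l ?mulr_ge0 ?sqr_ge0 //.
have im := leq_ltn_trans ij jm.
have hi := halfangle_le_pihalf m0 me im; have hj := halfangle_le_pihalf m0 me jm.
have hi0 := halfangle_ge0 m (uphalf i); have hj0 := halfangle_ge0 m (uphalf j).
have hij : halfangle m (uphalf i) <= halfangle m (uphalf j).
  by apply: halfangle_le; lia.
rewrite !sin2cos2 lerD2l lerN2 ler_sqr ?nnegrE.
- by apply: cos_le_pi => //; lra.
- by apply: cos_ge0_pihalf; apply/andP; split; lra.
- by apply: cos_ge0_pihalf; apply/andP; split; lra.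
Qed.

(** From [sin x <= x] and [pi < 4]: the eigenvalue is at most [4 pi^2 l^2] with [l] the
    frequency. *)
Lemma free_eigenvalue_le m j : (0 < m)%N -> ~~ odd m -> (j < m)%N ->
  free_eigenvalue m j <= 64 * (uphalf j)%:R ^+ 2.
Proof.
move=> m0 me jm; have mr : 0 < m%:R :> R by rewrite ltr0n.
have pi0 := pi_gt0 R; have pi4 : pi < 4 :> R by have := pihalf_lt2 R; lra.
have h0 := halfangle_ge0 m (uphalf j); have h1 := halfangle_le_pihalf m0 me jm.
have s0 : 0 <= sin (halfangle m (uphalf j)) by apply: sin_ge0_pi; apply/andP; split; lra.
have s1 := sin_le_id h0.
apply: (@le_trans _ _ (4 * m%:R ^+ 2 * halfangle m (uphalf j) ^+ 2)).
  by rewrite /free_eigenvalue ler_wpM2l ?mulr_ge0 ?sqr_ge0 // ler_sqr ?nnegrE.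
rewrite (_ : _ * _ = 4 * (pi ^+ 2 * (uphalf j)%:R ^+ 2)); last first.
  by rewrite /halfangle; field; rewrite gt_eqF.
have : pi ^+ 2 * (uphalf j)%:R ^+ 2 <= 16 * (uphalf j)%:R ^+ 2 :> R.
  by rewrite ler_wpM2r ?sqr_ge0 // expr2; nra.
lra.
Qed.

Lemma free_eigenvalue_ge m j : (0 < m)%N -> ~~ odd m -> (j < m)%N ->
  4 * (uphalf j)%:R ^+ 2 <= free_eigenvalue m j.
Proof.
move=> m0 me jm; have mr : 0 < m%:R :> R by rewrite ltr0n.
have pi2 := pi_ge2 R.
have h0 := halfangle_ge0 m (uphalf j); have h1 := halfangle_le_pihalf m0 me jm.
have s1 := sin_ge_half h0 h1.
apply: (@le_trans _ _ (4 * m%:R ^+ 2 * (halfangle m (uphalf j) / 2) ^+ 2)); last first.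
  have h2 : 0 <= halfangle m (uphalf j) / 2 by rewrite divr_ge0.
  by rewrite /free_eigenvalue ler_wpM2l ?mulr_ge0 ?sqr_ge0 // ler_sqr ?nnegrE // (le_trans h2).
rewrite (_ : _ * _ ^+ 2 = pi ^+ 2 * (uphalf j)%:R ^+ 2); last first.
  by rewrite /halfangle; field; rewrite gt_eqF.
by rewrite ler_wpM2r ?sqr_ge0 // expr2; nra.
Qed.

(** With [x], [y] the half angles of frequencies [l] and [l - 1], the difference of squared sines
    factors as [sin(x + y) sin(x - y)]. Here [x - y = pi / m], and the two bounds on [d] keep
    [x + y] at distance [d pi / m] from 0 and from [pi]. *)
Lemma free_eigenvalue_gap m l (d : R) : ~~ odd m -> (0 < l)%N -> (l.*2 < m)%N ->
  0 <= d -> d <= (l.*2 - 1)%:R -> d <= (m - l.*2)%:R ->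
  4 * d <= free_eigenvalue m l.*2 - free_eigenvalue m (l.*2 - 2).
Proof.
move=> me l0 lm d0 dl dm; have m0 : (0 < m)%N by lia.
have mr : 0 < m%:R :> R by rewrite ltr0n.
have pi2 := pi_ge2 R.
rewrite /free_eigenvalue -mulrBr.
have -> : uphalf l.*2 = l by lia.
have -> : uphalf (l.*2 - 2) = (l - 1)%N by lia.
set x := halfangle m l; set y := halfangle m (l - 1).
have -> : sin x ^+ 2 - sin y ^+ 2 = sin (x + y) * sin (x - y).
  rewrite sinD sinB; have := cos2Dsin2 x; have := cos2Dsin2 y.
  set cx := cos x; set sx := sin x; set cy := cos y; set sy := sin y => hy hx.
  rewrite (_ : (sx * cy + cx * sy) * (sx * cy - cx * sy) =
     sx ^+ 2 * cy ^+ 2 - cx ^+ 2 * sy ^+ 2); last by ring.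
  have -> : cy ^+ 2 = 1 - sy ^+ 2 by lra.
  have -> : cx ^+ 2 = 1 - sx ^+ 2 by lra.
  ring.
have Exy : x - y = pi / m%:R.
  by rewrite /x /y /halfangle natrB //; field; rewrite gt_eqF.
have h2 : 1 / m%:R <= sin (x - y).
  have Em : 1 / m%:R <= pi / m%:R / 2 :> R.
    rewrite (_ : pi / m%:R / 2 = pi / 2 / m%:R); last by ring.
    by rewrite ler_wpM2r ?invr_ge0 ?ler0n //; lra.
  apply: le_trans Em _; rewrite Exy; apply: sin_ge_half; first by rewrite divr_ge0 ?ler0n ?pi_ge0.
  by rewrite ler_wpM2l //; [lra | rewrite lef_pV2 ?posrE // ler_nat; lia].
have l1 : (l.*2 - 1)%:R = 2 * l%:R - 1 :> R by rewrite natrB ?double_gt0 // -mul2n natrM.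
have l2 : (m - l.*2)%:R = m%:R - 2 * l%:R :> R by rewrite natrB ?(ltnW lm) // -mul2n natrM.
have Ex : x + y = (l.*2 - 1)%:R * pi / m%:R.
  by rewrite l1 /x /y /halfangle natrB //; field; rewrite gt_eqF.
have h1 : d / m%:R <= sin (x + y).
  apply: (@le_trans _ _ (d * pi / m%:R / 2)).
    rewrite (_ : d * pi / m%:R / 2 = d * (pi / 2) / m%:R); last by ring.
    by rewrite ler_wpM2r ?invr_ge0 ?ler0n // ler_peMr //; lra.
  rewrite Ex; apply: sin_ge_half_dist.
  - by rewrite divr_ge0 ?ler0n // mulr_ge0 //; lra.
  - by rewrite ler_wpM2r ?invr_ge0 ?ler0n // ler_wpM2r //; lra.
  rewrite lerBrDr -mulrDl -mulrDl ler_pdivrMr // mulrC ler_wpM2l //; first by lra.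
  by move: dm; rewrite l1 l2; lra.
apply: (@le_trans _ _ (4 * m%:R ^+ 2 * (d / m%:R * (1 / m%:R)))).
  by rewrite le_eqVlt; apply/orP; left; apply/eqP; field; rewrite gt_eqF.
rewrite ler_wpM2l ?mulr_ge0 ?sqr_ge0 // ler_pM // divr_ge0 // ler0n.
Qed.

End Trigonometry.

(** * Explicit comparison of low eigenvalues on two grids *)

Section Comparison.
Variable R : realType.
Implicit Types (m n k : nat) (a b D : nat -> R) (e : nat -> nat -> R).

Lemma eigenvalue_le_of_forms m a b a' b' D D' e e' (c : R) n :
  (n < m)%N -> eigensystem m a b D e -> eigensystem m a' b' D' e' ->
  (forall u, grid_periodic m u -> en m a' b' u u <= en m a b u u + c * ip m u u) ->
  D' n <= D n + c.
Proof.
move=> nm es es' H; have m0 : (0 < m)%N by apply: leq_ltn_trans nm.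
have [pe _ _ _] := es.
have pe' j : (j <= n)%N -> grid_periodic m (e j).
  by move=> jn; apply: pe; apply: leq_ltn_trans nm.
apply: (trial_space_le m0 es' (g := e)) => // co [j jn cj] /=.
set u := lincomb _ _ _.
have pu : grid_periodic m u by apply: grid_periodic_lincomb => i; apply: pe'.
split.
  rewrite (ip_eigenspan es) // (bigD1 (Ordinal (jn : (j < n.+1)%N))) //=.
  rewrite ltr_pwDl ?exprn_even_gt0 //.
  by apply: sumr_ge0 => i _; rewrite sqr_ge0.
by apply: le_trans (H _ pu) _; rewrite mulrDl lerD2r en_eigenspan.
Qed.

(** The free problem is the case of zero coefficients, and [pot] lies between [- 3 K ip] and
    [3 K ip]. *)
Lemma weyl_free m a b D e (K : R) n : ~~ odd m -> (n < m)%N ->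
  (forall i, `|a i| <= K) -> (forall i, `|b i| <= K) ->
  eigensystem m a b D e -> `|D n - free_eigenvalue R m n| <= 3 * K.
Proof.
move=> me nm aK bK es; have m0 : (0 < m)%N by apply: leq_ltn_trans nm.
have es0 := hartley_eigensystem R m0 me.
have en0 u : en m (fun=> 0) (fun=> 0) u u = kin m u u.
  by rewrite /en /pot big1 ?mulr0 ?addr0 // => i _; rewrite !mul0r subrr.
have h1 : D n <= free_eigenvalue R m n + 3 * K.
  apply: (eigenvalue_le_of_forms nm es0 es) => u pu; rewrite en0 /en lerD2l.
  by apply: le_trans (ler_norm _) _; exact: pot_abs_le.
have h2 : free_eigenvalue R m n <= D n + 3 * K.
  apply: (eigenvalue_le_of_forms nm es es0) => u pu; rewrite en0 /en -addrA lerDl.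
  have := pot_abs_le pu aK bK; rewrite ler_norml => /andP[h _]; lra.
by rewrite ler_norml; apply/andP; split; lra.
Qed.

(** With [c = 64 + 6 K] this is [28 K (1 + c) + 2 c^2]: twice the relative error of the potential,
    plus the effect [2 c^2] of the loss of norm. *)
Definition refinement_const (K : R) : R :=
  28 * K * (65 + 6 * K) + 2 * (64 + 6 * K) ^+ 2.

(** The free bound and [weyl_free] give [D1 n + 3 K <= c F^2], so both error terms of
    [transfer_eigenvalue_le] become multiples of [F^2 / m]. *)
Lemma transfer_error (al be : R -> R) (K F : R) m m1 m2 T D1 D2 e1 e2 n :
  (forall x, `|al x| <= K) -> (forall x, `|be x| <= K) ->
  (0 < m)%N -> ~~ odd m1 -> (n < m1)%N -> (n < m2)%N ->
  1 <= F -> F ^+ 2 <= m%:R -> (uphalf n)%:R <= F -> 2 * (64 + 6 * K) <= m%:R ->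
  transfer al be K m m1 m2 T ->
  eigensystem m1 (gs m1 al) (gs m1 be) D1 e1 ->
  eigensystem m2 (gs m2 al) (gs m2 be) D2 e2 ->
  D2 n <= D1 n + refinement_const K * (F ^+ 2 / m%:R).
Proof.
move=> alK beK m0 me1 nm1 nm2 F1 Fm nF mK tr es1 es2.
have K0 : 0 <= K by apply: le_trans (alK 0); rewrite normr_ge0.
have mr : 0 < m%:R :> R by rewrite ltr0n.
have w := weyl_free me1 nm1 (fun=> alK _) (fun=> beK _) es1.
have m10 : (0 < m1)%N by apply: leq_ltn_trans nm1.
have fu := free_eigenvalue_le R m10 me1 nm1.
have fl := free_eigenvalue_ge R m10 me1 nm1.
have fl0 : 0 <= 4 * (uphalf n)%:R ^+ 2 :> R by rewrite mulr_ge0 ?sqr_ge0.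
have nF2 : (uphalf n)%:R ^+ 2 <= F ^+ 2 :> R by rewrite ler_sqr ?nnegrE //; lra.
have F2 : 1 <= F ^+ 2 by rewrite expr_ge1 //; lra.
set c := 64 + 6 * K in mK.
have c64 : 64 <= c by rewrite /c; lra.
have A0 : 0 <= D1 n + 3 * K by move: w; rewrite ler_norml => /andP[]; lra.
have Ac : D1 n + 3 * K <= c * F ^+ 2.
  have : 6 * K <= 6 * K * F ^+ 2 by rewrite ler_peMr //; lra.
  by move: w; rewrite ler_norml /c mulrDl => /andP[]; lra.
set x := (D1 n + 3 * K) / m%:R ^+ 2.
have Em : F ^+ 2 / m%:R <= 1 by rewrite ler_pdivrMr // mul1r.
have xle : x <= c / m%:R * (F ^+ 2 / m%:R).
  rewrite (_ : _ * (_ / _) = c * F ^+ 2 / m%:R ^+ 2); last by field; rewrite gt_eqF.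
  by rewrite ler_wpM2r // invr_ge0 sqr_ge0.
have cm : c / m%:R <= 1 / 2 by rewrite ler_pdivrMr //; lra.
have E0 : 0 <= F ^+ 2 / m%:R by rewrite divr_ge0 ?sqr_ge0 ?ler0n.
have x2 : x <= 1 / 2.
  apply: le_trans xle _; apply: le_trans (_ : c / m%:R <= _) => //.
  by rewrite ler_piMr // divr_ge0 ?ler0n //; lra.
have x0 : 0 <= x by rewrite divr_ge0 // sqr_ge0.
have Am : D1 n + 3 * K < m%:R ^+ 2.
  have : x < 1 by lra.
  by rewrite /x ltr_pdivrMr ?exprn_gt0 // mul1r.
have := transfer_eigenvalue_le alK beK m0 nm1 nm2 tr es1 es2 Am.
rewrite -/x; set A := D1 n + 3 * K in A0 Ac *.
set E := F ^+ 2 / m%:R in Em E0 xle *.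
set er := 14 * K * (1 + A) / m%:R.
have er0 : 0 <= er by rewrite /er divr_ge0 ?ler0n // mulr_ge0 //; [lra|lra].
have erle : er <= 14 * K * (1 + c) * E.
  rewrite /er /E (_ : 14 * K * (1 + c) * _ = 14 * K * ((1 + c) * F ^+ 2) / m%:R); last by ring.
  rewrite ler_wpM2r ?invr_ge0 ?ler0n // ler_wpM2l //; first by lra.
  by rewrite mulrDl mul1r lerD.
(* Here [1 / (1 - x) <= 1 + 2 x], since [x] lies between 0 and 1/2. *)
have inv : (A + er) / (1 - x) <= (A + er) * (1 + 2 * x).
  rewrite ler_wpM2l //; first by lra.
  by rewrite -[leLHS]mul1r ler_pdivrMr; nra.
have Ax : A * (2 * x) <= 2 * c ^+ 2 * E.
  apply: (@le_trans _ _ (c * F ^+ 2 * (2 * (c / m%:R * E)))).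
    by rewrite ler_pM // ?mulr_ge0 //; lra.
  rewrite (_ : _ * _ = 2 * c ^+ 2 * E * E); last by rewrite /E; field; rewrite gt_eqF.
  by rewrite ler_piMr // mulr_ge0 // mulr_ge0 // sqr_ge0.
have erx : er * (2 * x) <= er by rewrite ler_piMr //; lra.
rewrite /refinement_const -/c (_ : 65 + 6 * K = 1 + c); last by rewrite /c; lra.
move: inv; rewrite mulrDr mulr1 mulrDl => inv.
have -> : (28 * K * (1 + c) + 2 * c ^+ 2) * E = 2 * (14 * K * (1 + c) * E) + 2 * c ^+ 2 * E by ring.
by move=> h; rewrite /A in h inv Ax *; lra.
Qed.

(** Interpolation bounds the fine eigenvalue by the coarse one, block averages do the converse. Both
    errors depend on the coarse size [m] only, whence uniformity in [k]. *)
Lemma grid_refinement (al be : R -> R) (K F : R) m k D1 D2 e1 e2 n :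
  bounded_lipschitz K al -> bounded_lipschitz K be ->
  (0 < k)%N -> ~~ odd m -> (n < m)%N ->
  1 <= F -> F ^+ 2 <= m%:R -> (uphalf n)%:R <= F -> 2 * (64 + 6 * K) <= m%:R ->
  eigensystem m (gs m al) (gs m be) D1 e1 ->
  eigensystem (m * k) (gs (m * k) al) (gs (m * k) be) D2 e2 ->
  `|D2 n - D1 n| <= refinement_const K * (F ^+ 2 / m%:R).
Proof.
move=> alK beK k0 me nm F1 Fm nF mK es1 es2.
have m0 : (0 < m)%N by apply: leq_ltn_trans nm.
have nmk : (n < m * k)%N by apply: leq_trans nm _; rewrite leq_pmulr.
have mke : ~~ odd (m * k) by rewrite oddM (negbTE me).
have h1 := transfer_error alK.1 beK.1 m0 me nm nmk F1 Fm nF mK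
  (interp_transfer alK beK m0 k0) es1 es2.
have h2 := transfer_error alK.1 beK.1 m0 mke nmk nm F1 Fm nF mK
  (blockavg_transfer alK beK m0 k0) es2 es1.
by rewrite ler_norml; apply/andP; split; lra.
Qed.

End Comparison.

(** * From [Qmx] to an eigensystem of the grid form *)

Section MatrixToEigensystem.
Variable R : realType.

(** The operator of the form [en] evaluated at node [i + 1]; the shift avoids a predecessor of the
    index 0. *)
Definition grid_op (m : nat) (a b u : nat -> R) (i : nat) : R :=
  m%:R ^+ 2 * (2 * u i.+1 - u i.+2 - u i) +
  b i.+1 * u i.+1 - a i.+1 * u i.+2 - a i * u i.

Lemma en_grid_op m a b u w :
  grid_periodic m a -> grid_periodic m b -> grid_periodic m u -> grid_periodic m w ->
  en m a b u w = m%:R^-1 * \sum_(i < m) grid_op m a b u i * w i.+1.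
Proof.
move=> pa pb pu pw; rewrite /en /kin /ip /pot mulrCA -mulrDr; congr (_ * _).
have -> : \sum_(i < m) dif u i * dif w i = \sum_(i < m) (2 * u i.+1 - u i.+2 - u i) * w i.+1.
  transitivity (\sum_(i < m) (dif u i * w i.+1 - dif u i.+1 * w i.+1)); last first.
    by apply: eq_bigr => i _; rewrite /dif; ring.
  rewrite sumrB (@sum_grid_shift _ m (fun i => dif u i * w i)); last first.
    by move=> i; rewrite /dif -addSn !pu pw.
  by rewrite -sumrB; apply: eq_bigr => i _; rewrite /dif; ring.
have -> : \sum_(i < m) (b i * u i * w i - a i * (u i * w i.+1 + u i.+1 * w i)) =
    \sum_(i < m) (b i.+1 * u i.+1 - a i.+1 * u i.+2 - a i * u i) * w i.+1.
  transitivity (\sum_(i < m) ((b i * u i - a i * u i.+1) * w i - a i * u i * w i.+1)).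
    by apply: eq_bigr => i _; ring.
  rewrite sumrB -(@sum_grid_shift _ m (fun i => (b i * u i - a i * u i.+1) * w i)).
    by rewrite -sumrB; apply: eq_bigr => i _; ring.
  by move=> i; rewrite -addSn !pu pw pa pb.
by rewrite mulr_sumr -big_split; apply: eq_bigr => i _; rewrite /= /grid_op; ring.
Qed.

Lemma gs_periodic m (f : R -> R) : ~~ odd m -> (0 < m)%N ->
  (forall x, f (x + 1) = f x) -> grid_periodic m (gs m f).
Proof.
move=> me m0 pf i; rewrite /gs natrD.
have mr : m%:R != 0 :> R by rewrite pnatr_eq0 -lt0n.
have -> : 2 * (i%:R + m%:R) / m%:R = 2 * i%:R / m%:R + 1 + 1 :> R by field.
by rewrite !pf.
Qed.

Lemma sum_delta m (f : 'I_m -> R) (c : 'I_m) y :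
  \sum_(k < m) f k * ((k == c :> nat)%:R * y) = f c * y.
Proof.
rewrite (bigD1 c) //= eqxx mul1r big1 ?addr0 // => k; rewrite -(inj_eq val_inj) => /negbTE /= ->.
by rewrite mul0r mulr0.
Qed.

(** Cyclic description: column [c] is supported on the rows [c], [c + 1] and [c - 1] modulo [2 N],
    the last one written with [(2 * N).-1] added. The corners fit because the coefficients of index
    0, [N] and [2 N] coincide by periodicity. *)
Lemma Qmx_entry (al be : R -> R) N (k c : 'I_(2 * N)) : (2 <= N)%N ->
  (forall x, al (x + 1) = al x) ->
  Qmx al be N k c =
    (k == c :> nat)%:R * coef_b be N c.+1 +
    (k == c.+1 %% (2 * N) :> nat)%N%:R * coef_a al N c.+1 +
    (k == (c + (2 * N).-1) %% (2 * N) :> nat)%N%:R * coef_a al N c.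
Proof.
move=> N2 pal; rewrite mxE.
have Nr : N%:R != 0 :> R by rewrite pnatr_eq0; lia.
have aN : coef_a al N N = coef_a al N 0.
  by rewrite /coef_a divff // mulr0n mul0r -[al 0]pal add0r.
have a2N : coef_a al N (2 * N) = coef_a al N 0.
  rewrite /coef_a natrM mulfK // mulr0n mul0r -[al 0]pal -[al (0 + 1)]pal add0r.
  by rewrite (_ : 2%:R = 1 + 1).
have kl := ltn_ord k; have cl := ltn_ord c.
have E1 : (c.+1 %% (2 * N))%N = if c == (2 * N).-1 :> nat then 0%N else c.+1.
  case: eqP => [->|nc]; first by rewrite prednK ?modnn //; lia.
  by rewrite modn_small //; lia.
have E2 : ((c + (2 * N).-1) %% (2 * N))%N = if c == 0 :> nat then (2 * N).-1 else c.-1.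
  case: eqP => [->|nc]; first by rewrite add0n modn_small //; lia.
  have -> : (c + (2 * N).-1 = c.-1 + 2 * N)%N by lia.
  by rewrite modnDr modn_small //; lia.
have -> : (k == c.+1 %% (2 * N) :> nat)%N =
    (k == c.+1 :> nat) || (k == 0 :> nat) && (c == (2 * N).-1 :> nat).
  by rewrite E1; case: (eqVneq (c : nat) (2 * N).-1) => h; lia.
have -> : (k == (c + (2 * N).-1) %% (2 * N) :> nat)%N =
    (c == k.+1 :> nat) || (k == (2 * N).-1 :> nat) && (c == 0 :> nat).
  by rewrite E2; case: (eqVneq (c : nat) 0%N) => h; lia.
rewrite aN.
case: (eqVneq (k : nat) c) => [kc|kc].
  rewrite kc (_ : (c == c.+1 :> nat) || _ = false); last by lia.
  rewrite (_ : (c == c.+1 :> nat) || _ = false); last by lia.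
  by rewrite mul1r !mul0r !addr0.
case: (eqVneq (c : nat) k.+1) => [ck|ck].
  rewrite (_ : (k == c.+1 :> nat) || _ = false); last by lia.
  by rewrite ck mul1r !mul0r !add0r.
case: (eqVneq (k : nat) c.+1) => [kc1|kc1].
  rewrite (_ : false || _ = false); last by lia.
  by rewrite mul1r !mul0r add0r addr0.
rewrite !orFb.
case: (eqVneq (k : nat) 0%N) => [k0|k0].
  rewrite (_ : (k == (2 * N).-1 :> nat) = false) ?andFb ?orbF; last by lia.
  case: eqVneq => [cm|cm] /=; last by rewrite !mul0r !addr0.
  by rewrite mul1r !mul0r add0r addr0 cm prednK ?a2N //; lia.
rewrite !andFb !orFb !mul0r !add0r.
case: eqVneq => [km|km] /=; last by rewrite mul0r.
by case: eqVneq => [->|c0] /=; rewrite ?mul1r ?mul0r.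
Qed.

Lemma Qmx_sym (al be : R -> R) N : (2 <= N)%N -> (Qmx al be N)^T = Qmx al be N.
Proof.
move=> N2; apply/matrixP => i j; rewrite !mxE.
have il := ltn_ord i; have jl := ltn_ord j.
rewrite (eq_sym (i : nat) (j : nat)).
case: (eqVneq (j : nat) i) => [->|ji] //.
case: (eqVneq (i : nat) j.+1) => [E|ij].
  by rewrite (_ : (j == i.+1 :> nat) = false) //; lia.
case: (eqVneq (j : nat) i.+1) => [E|ij'] //.
by rewrite orbC andbC [X in _ || X]andbC.
Qed.

Lemma Qmx_eigenvalues_exist (al be : R -> R) N : (2 <= N)%N ->
  exists s, mx_eigenvalues (Qmx al be N) s.
Proof. by move=> N2; exact: symmetric_char_poly_split (Qmx_sym al be N2). Qed.

(** The eigenvectors are the rows of the diagonalizing matrix, extended periodically and multiplied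
    by alternating signs; these turn the spectrum near [- 2] into low energies. *)
Lemma Qmx_eigensystem (al be : R -> R) N s : (2 <= N)%N ->
  (forall x, al (x + 1) = al x) -> (forall x, be (x + 1) = be x) ->
  mx_eigenvalues (Qmx al be N) s ->
  size s = (2 * N)%N /\ exists e, eigensystem (2 * N) (gs (2 * N) al) (gs (2 * N) be)
    (fun n => (2 * N)%:R ^+ 2 * (s`_n + 2)) e.
Proof.
move=> N2 pal pbe [ss cs].
have [szs [P [PP PA]]] := symmetric_orthodiagonalization (Qmx_sym al be N2) cs.
split=> //; set m := (2 * N)%N in P PP PA szs *.
have m0 : (0 < m)%N by lia.
have me : ~~ odd m by rewrite /m oddM.
have mr : 0 < m%:R :> R by rewrite ltr0n.
pose ix (i : nat) : 'I_m := Ordinal (ltn_pmod i m0).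
pose p (j : nat) : 'I_m := Ordinal (ltn_pmod j m0).
pose q (j i : nat) : R := P (p j) (ix i).
have pq j : grid_periodic m (q j).
  by move=> i; rewrite /q; congr (P _ _); apply: val_inj; rewrite /= modnDr.
have ixE (i : 'I_m) : ix i = i by apply: val_inj; rewrite /= modn_small.
(* The square root normalizes for the averaged product [ip]. The offset [m.-1] matches grid node
   [i + 1] with the 0-based row [i], that is, with the 1-based row [i + 1]. *)
pose e (j i : nat) : R := Num.sqrt m%:R * (-1) ^+ i * q j (i + m.-1)%N.
have pe j : grid_periodic m (e j).
  move=> i; rewrite /e addnAC pq exprD -(signr_odd _ m) (negbTE me) expr0.
  by rewrite mulr1.
have sm : Num.sqrt m%:R ^+ 2 = m%:R :> R by rewrite sqr_sqrtr // ltW.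
have eS j i : e j i.+1 = - Num.sqrt m%:R * (-1) ^+ i * q j i.
  by rewrite /e addSnnS prednK // pq exprS; ring.
have pa := gs_periodic me m0 pal; have pb := gs_periodic me m0 pbe.
have coefE (f : R -> R) i : (4 * N%:R ^+ 2)^-1 * f (i%:R / N%:R) =
    (m%:R ^+ 2)^-1 * gs m f i.
  have Nr : N%:R != 0 :> R by rewrite pnatr_eq0; lia.
  rewrite /gs /m natrM; congr (_ * f _); by field.
(* The eigenvalue equation of [Qmx] along the cyclic grid, valid for every [i] and not only inside
   one period. *)
have rel (j i : nat) : (j < m)%N ->
    q j i * coef_b be N i.+1 + q j i.+1 * coef_a al N i.+1 +
    q j (i + m.-1)%N * coef_a al N i = s`_j * q j i.
  move=> jm.
  have E := congr1 (fun M : 'M[R]_m => M (p j) (ix i)) PA.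
  rewrite mul_diag_mx [RHS]mxE [LHS]mxE [X in _ = X * _]mxE in E.
  have pj : p j = j :> nat by rewrite /= modn_small.
  rewrite pj -/(q j i) in E; rewrite -[RHS]E.
  have gm (f : R -> R) k l : grid_periodic m (gs m f) -> k = l %[mod m] ->
      gs m f k = gs m f l.
    by move=> pf kl; rewrite -(grid_periodic_modn k pf) kl grid_periodic_modn.
  have i1 : ((i %% m).+1 %% m = i.+1 %% m)%N by rewrite -addn1 modnDml addn1.
  rewrite (eq_bigr (fun k : 'I_m =>
    P (p j) k * ((k == ix i :> nat)%:R * coef_b be N i.+1) +
    P (p j) k * ((k == ix i.+1 :> nat)%:R * coef_a al N i.+1) +
    P (p j) k * ((k == ix (i + m.-1)%N :> nat)%:R * coef_a al N i))).
    by rewrite 2!big_split !sum_delta.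
  move=> k _; rewrite Qmx_entry //= i1 modnDml -!mulrDr.
  rewrite /coef_b /coef_a !coefE (gm be (i %% m).+1 i.+1) // (gm al (i %% m).+1 i.+1) //.
  by rewrite (grid_periodic_modn i pa).
exists e; split.
- by move=> j _; exact: pe.
- move=> i j im jm; rewrite /ip.
  rewrite -(@sum_grid_shift _ m (fun k => e i k * e j k)); last by move=> k; rewrite !pe.
  rewrite (eq_bigr (fun k : 'I_m => m%:R * (P (p i) k * P (p j) k))).
    rewrite -mulr_sumr mulKf; last by rewrite gt_eqF.
    have E := congr1 (fun M : 'M[R]_m => M (p i) (p j)) PP.
    rewrite [LHS]mxE [RHS]mxE -(inj_eq val_inj) /= in E.
    rewrite (modn_small im) (modn_small jm) in E. rewrite -E.
    by apply: eq_bigr => k _; rewrite mxE.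
  move=> k _; rewrite !eS /q !ixE -[in RHS]sm.
  have : (-1) ^+ k * (-1) ^+ k = 1 :> R by rewrite -expr2 sqrr_sign.
  set g := (-1) ^+ k => g2; rewrite expr2.
  by rewrite -[RHS]mul1r -g2; ring.
- move=> j jm w pw.
  rewrite en_grid_op // /ip -(@sum_grid_shift _ m (fun i => e j i * w i)); last first.
    by move=> i; rewrite pe pw.
  rewrite mulrCA; congr (_ * _); rewrite mulr_sumr; apply: eq_bigr => i _.
  rewrite [RHS]mulrA; congr (_ * _).
  have := rel j i jm; rewrite /coef_b /coef_a !coefE.
  set A1 := gs m al i.+1; set A0 := gs m al i; set B1 := gs m be i.+1 => E.
  rewrite /grid_op -/A1 -/A0 -/B1 !eS /e [(-1) ^+ i.+1]exprS.
  rewrite [LHS](_ : _ = - Num.sqrt m%:R * (-1) ^+ i * (m%:R ^+ 2) * (2 * q j i +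
    (q j i * ((m%:R ^+ 2)^-1 * B1) + q j i.+1 * (1 + (m%:R ^+ 2)^-1 * A1) +
    q j (i + m.-1)%N * (1 + (m%:R ^+ 2)^-1 * A0)))).
    by rewrite E; ring.
  by field; rewrite gt_eqF.
move=> i j ij jm; rewrite ler_wpM2l ?sqr_ge0 // lerD2r.
by apply: (sorted_leq_nth le_trans le_refl 0 ss); rewrite ?inE ?szs // (leq_ltn_trans ij).
Qed.

End MatrixToEigensystem.

(** * Upper bound for the bulk eigenvalues *)

Section Bulk.
Variable R : realType.
Implicit Types (m n l : nat) (a b u z c D : nat -> R) (e : nat -> nat -> R).

Lemma en_eigenspan_sum m a b D e n c : eigensystem m a b D e -> (n <= m)%N ->
  en m a b (lincomb n c e) (lincomb n c e) = \sum_(j < n) D j * c j ^+ 2.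
Proof.
move=> [pe oe ee _] nm; rewrite en_lincombl; apply: eq_bigr => j _.
have jm : (j < m)%N by apply: leq_trans nm.
rewrite ee //; last by apply: grid_periodic_lincomb => k kn; apply: pe; apply: leq_trans nm.
rewrite ip_lincombr (bigD1 j) //= big1 ?addr0; last first.
  move=> k kj; rewrite oe //; last by apply: leq_trans nm.
  by rewrite eq_sym (inj_eq val_inj) (negbTE kj) mulr0.
by rewrite oe // eqxx mulr1; ring.
Qed.

Lemma pot_comb m a b u z (s t : R) :
  let v := fun i => s * u i + t * z i in
  pot m a b v v = s ^+ 2 * pot m a b u u + 2 * s * t * pot m a b u z + t ^+ 2 * pot m a b z z.
Proof.
rewrite /pot /= !(mulrCA _ m%:R^-1) -!mulrDr; congr (_ * _).
by rewrite !mulr_sumr -!big_split; apply: eq_bigr => i _ /=; ring.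
Qed.

Lemma ip_comb m u z (s t : R) :
  let v := fun i => s * u i + t * z i in
  ip m v v = s ^+ 2 * ip m u u + 2 * s * t * ip m u z + t ^+ 2 * ip m z z.
Proof.
rewrite /ip /= !(mulrCA _ m%:R^-1) -!mulrDr; congr (_ * _).
by rewrite !mulr_sumr -!big_split; apply: eq_bigr => i _ /=; ring.
Qed.

(** Polarization: the two-sided bound on [pot] is applied to [s u + z / s] and to [s u - z / s]. The
    weight [s] stays free so that it can be tuned to the spectral gap. *)
Lemma pot_cross_le m a b u z (K s : R) : 0 < s ->
  grid_periodic m u -> grid_periodic m z ->
  (forall i, `|a i| <= K) -> (forall i, `|b i| <= K) ->
  2 * pot m a b u z <= 3 * K * (s ^+ 2 * ip m u u + s ^- 2 * ip m z z).
Proof.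
move=> s0 pu pz aK bK.
have pv t : grid_periodic m (fun i => s * u i + t * z i).
  by move=> i /=; rewrite pu pz.
have := pot_abs_le (pv s^-1) aK bK; have := pot_abs_le (pv (- s^-1)) aK bK.
rewrite !ler_norml => /andP[h1 _] /andP[_ h2]; move: h1 h2.
rewrite !pot_comb !ip_comb sqrrN (_ : 2 * s * - s^-1 = - 2); last by field; rewrite gt_eqF.
rewrite (_ : 2 * s * s^-1 = 2); last by field; rewrite gt_eqF.
by rewrite -exprVn; lra.
Qed.

(** Multiplied by [2 sin t], the cosine is the difference of the periodic function [T], so summation
    by parts moves the difference onto [g] without boundary terms. The hypotheses on [F] keep
    [t = 2 l pi / m] at distance [F pi / m] from 0 and [pi], so [sin t >= F / m]. *)
Lemma oscillatory_sum_le m l (g : nat -> R) (K F y : R) : (0 < m)%N ->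
  grid_periodic m g -> (forall i, `|dif g i| <= 2 * K / m%:R) ->
  0 < F -> F <= l.*2%:R -> F <= m%:R - l.*2%:R ->
  `|m%:R^-1 * \sum_(i < m) g i * cos (4 * halfangle R m l * i%:R + y)| <= K / F.
Proof.
move=> m0 pg dg F0 Fl Fm; have mr : 0 < m%:R :> R by rewrite ltr0n.
have pi2 := pi_ge2 R.
set t := 2 * halfangle R m l.
have Et : t = l.*2%:R * pi / m%:R by rewrite /t /halfangle -mul2n natrM; ring.
have st : F / m%:R <= sin t.
  apply: (@le_trans _ _ (F * pi / m%:R / 2)).
    rewrite (_ : F * pi / m%:R / 2 = F * (pi / 2) / m%:R); last by ring.
    by rewrite ler_wpM2r ?invr_ge0 ?ler0n // ler_peMr //; lra.
  apply: sin_ge_half_dist.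
  - by rewrite divr_ge0 ?ler0n // mulr_ge0 //; lra.
  - by rewrite Et ler_wpM2r ?invr_ge0 ?ler0n // ler_wpM2r //; lra.
  rewrite Et lerBrDr -mulrDl -mulrDl ler_pdivrMr // mulrC ler_wpM2l //; lra.
have st0 : 0 < sin t by apply: lt_le_trans st; rewrite divr_gt0.
pose T (i : nat) : R := sin (2 * t * i%:R + y - t).
have pT : grid_periodic m T.
  move=> i; rewrite /T; have -> : 2 * t * (i + m)%:R + y - t =
      2 * t * i%:R + y - t + 2 * pi * l.*2%:R.
    by rewrite Et natrD; field; rewrite gt_eqF.
  by rewrite sin_D2pi_nat.
have E : 2 * sin t * \sum_(i < m) g i * cos (4 * halfangle R m l * i%:R + y) =
    - \sum_(i < m) dif g i * T i.+1.
  rewrite mulr_sumr -sumrN.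
  transitivity (\sum_(i < m) (g i * T i.+1 - g i * T i)).
    apply: eq_bigr => i _; rewrite /T -[i.+1%:R]natr1.
    have -> : 2 * t * (i%:R + 1) + y - t = (2 * t * i%:R + y) + t by ring.
    have -> : 4 * halfangle R m l * i%:R = 2 * t * i%:R by rewrite /t; ring.
    by rewrite sinB sinD; ring.
  rewrite sumrB -(@sum_grid_shift _ m (fun i => g i * T i)); last by move=> i; rewrite pg pT.
  by rewrite -sumrB; apply: eq_bigr => i _; rewrite /dif; ring.
have bE : `|\sum_(i < m) dif g i * T i.+1| <= 2 * K.
  apply: le_trans (ler_norm_sum _ _ _) _.
  apply: (@le_trans _ _ (\sum_(i < m) 2 * K / m%:R)).
    apply: ler_sum => i _; rewrite normrM.
    by apply: le_trans (dg i); rewrite ler_piMr // sin_max.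
  by rewrite sumr_const card_ord -[leLHS]mulr_natr divfK // gt_eqF.
have bE2 : `|2 * sin t * \sum_(i < m) g i * cos (4 * halfangle R m l * i%:R + y)| <= 2 * K.
  by rewrite E normrN.
rewrite normrM (ger0_norm (_ : 0 <= 2 * sin t)) in bE2; last by rewrite mulr_ge0 // ltW.
rewrite normrM ger0_norm ?invr_ge0 ?ler0n //.
set S := `|\sum_(i < m) _| in bE2 *.
have S0 : 0 <= S by rewrite normr_ge0.
have : F / m%:R * S <= K.
  by apply: (@le_trans _ _ (sin t * S)); [rewrite ler_wpM2r | lra].
rewrite ler_pdivlMr // => h; apply: le_trans h.
by rewrite le_eqVlt; apply/orP; left; apply/eqP; ring.
Qed.

(** Products of two modes of frequency [l] split into a constant part and parts of frequency [2 l].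
    This gives three averages with weight 1 for [be] and three with weight 2 for [al], each at most
    [K / F]; hence the 9. *)
Lemma pot_top_pair_le (al be : R -> R) (K F : R) m l (c1 c2 : R) :
  bounded_lipschitz K al -> bounded_lipschitz K be ->
  (forall x, al (x + 1) = al x) -> (forall x, be (x + 1) = be x) ->
  ~~ odd m -> (0 < m)%N -> (0 < l)%N ->
  0 < F -> F <= l.*2%:R -> F <= m%:R - l.*2%:R ->
  `|m%:R^-1 * \sum_(i < m) gs m al i| <= K / F ->
  `|m%:R^-1 * \sum_(i < m) gs m be i| <= K / F ->
  let z := fun i => c1 * hartley R m l.*2.-1 i + c2 * hartley R m l.*2 i in
  pot m (gs m al) (gs m be) z z <= 9 * K / F * (c1 ^+ 2 + c2 ^+ 2).
Proof.
move=> alK beK pal pbe me m0 l0 F0 Fl Fm ma mb; lazy zeta.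
set z := (X in pot _ _ _ X _).
have mr : 0 < m%:R :> R by rewrite ltr0n.
have pa := gs_periodic me m0 pal; have pb := gs_periodic me m0 pbe.
have dgs (f : R -> R) : bounded_lipschitz K f -> forall i, `|dif (gs m f) i| <= 2 * K / m%:R.
  move=> fK i; apply: le_trans (fK.2 _ _) _; rewrite -[i.+1%:R]natr1.
  rewrite (_ : _ - _ = 2 / m%:R); last by field; rewrite gt_eqF.
  by rewrite ger0_norm ?divr_ge0 ?ler0n // mulrA (mulrC K).
set t := halfangle R m l.
have oa y := oscillatory_sum_le (l := l) y m0 pa (dgs _ alK) F0 Fl Fm.
have ob y := oscillatory_sum_le (l := l) y m0 pb (dgs _ beK) F0 Fl Fm.
rewrite -/t in oa ob.
pose p := c1 + c2; pose r := c2 - c1.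
pose Z := c1 ^+ 2 + c2 ^+ 2; pose A := 2 * c1 * c2; pose B := c2 ^+ 2 - c1 ^+ 2.
have zE i : z i = p * cos (2 * t * i%:R) + r * sin (2 * t * i%:R).
  rewrite /z /hartley; have -> : uphalf l.*2 = l by lia.
  have -> : uphalf l.*2.-1 = l by lia.
  rewrite -(signr_odd _ l.*2) odd_double expr0 -(signr_odd _ l.*2.-1).
  have -> : odd l.*2.-1 by lia.
  by rewrite expr1 /p /r -/t; ring.
have cosE i y : cos (4 * t * i%:R + y) =
    (cos (2 * t * i%:R) ^+ 2 - sin (2 * t * i%:R) ^+ 2) * cos y -
    2 * sin (2 * t * i%:R) * cos (2 * t * i%:R) * sin y.
  have -> : 4 * t * i%:R + y = (2 * t * i%:R) *+ 2 + y by rewrite mulr2n; ring.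
  rewrite cosD cos_mulr2n sin_mulr2n !mulr2n.
  rewrite (_ : _ - 1 = cos (2 * t * i%:R) ^+ 2 - sin (2 * t * i%:R) ^+ 2); first by ring.
  by have := cos2Dsin2 (2 * t * i%:R); lra.
(* For [z = p cos + r sin], the square of [z] is [Z + A cos + B sin] at the double angle; the sine
   is written as a cosine delayed by [pi / 2], and the neighbour product shifts the phase by
   [2 t]. *)
have potE : pot m (gs m al) (gs m be) z z =
    Z * (m%:R^-1 * \sum_(i < m) gs m be i) +
    A * (m%:R^-1 * \sum_(i < m) gs m be i * cos (4 * t * i%:R + 0)) +
    B * (m%:R^-1 * \sum_(i < m) gs m be i * cos (4 * t * i%:R + - (pi / 2))) -
    2 * (Z * cos (2 * t) * (m%:R^-1 * \sum_(i < m) gs m al i) +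
    A * (m%:R^-1 * \sum_(i < m) gs m al i * cos (4 * t * i%:R + 2 * t)) +
    B * (m%:R^-1 * \sum_(i < m) gs m al i * cos (4 * t * i%:R + (2 * t - pi / 2)))).
  transitivity (m%:R^-1 * \sum_(i < m) (Z * gs m be i +
      A * (gs m be i * cos (4 * t * i%:R + 0)) +
      B * (gs m be i * cos (4 * t * i%:R + - (pi / 2))) -
      2 * (Z * cos (2 * t) * gs m al i +
        A * (gs m al i * cos (4 * t * i%:R + 2 * t)) +
        B * (gs m al i * cos (4 * t * i%:R + (2 * t - pi / 2)))))); last first.
    rewrite sumrB -mulr_sumr !big_split /= -!mulr_sumr; ring.
  rewrite /pot; congr (_ * _); apply: eq_bigr => i _.
  rewrite !zE !cosE cosBpihalf sinBpihalf cosN sinN cos_pihalf sin_pihalf cos0 sin0.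
  have -> : 2 * t * i.+1%:R = 2 * t * i%:R + 2 * t by rewrite -[i.+1%:R]natr1; ring.
  rewrite cosD sinD; set x := 2 * t * i%:R.
  have := cos2Dsin2 x; set cx := cos x; set sx := sin x => cs.
  set ct := cos (2 * t); set st := sin (2 * t).
  have -> : Z * gs m be i = Z * gs m be i * (cx ^+ 2 + sx ^+ 2) by rewrite cs mulr1.
  have -> : Z * ct * gs m al i = Z * ct * gs m al i * (cx ^+ 2 + sx ^+ 2) by rewrite cs mulr1.
  rewrite /p /r /Z /A /B; ring.
have Z0 : 0 <= Z by rewrite addr_ge0 ?sqr_ge0.
have AZ : `|A| <= Z by apply: abs_mul2_le.
have BZ : `|B| <= Z.
  by rewrite ler_norml /B /Z; have := sqr_ge0 c1; have := sqr_ge0 c2; move=> ? ?; apply/andP; split; lra.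
set E := K / F in ma mb oa ob.
have E0 : 0 <= E by apply: le_trans ma.
have bound (X Y : R) : `|X| <= Z -> `|Y| <= E -> - (Z * E) <= X * Y <= Z * E.
  by move=> hX hY; rewrite -ler_norml normrM ler_pM.
have cZ : `|Z * cos (2 * t)| <= Z.
  by rewrite normrM (ger0_norm Z0) ler_piMr // cos_max.
have Zn : `|Z| <= Z by rewrite ger0_norm.
rewrite potE -/Z (_ : 9 * K / F * Z = 9 * (Z * E)); last by rewrite /E; ring.
have /andP[_ h1] := bound _ _ Zn mb.
have /andP[_ h2] := bound _ _ AZ (ob 0).
have /andP[_ h3] := bound _ _ BZ (ob (- (pi / 2))).
have /andP[h4 _] := bound _ _ cZ ma.
have /andP[h5 _] := bound _ _ AZ (oa (2 * t)).
have /andP[h6 _] := bound _ _ BZ (oa (2 * t - pi / 2)).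
lra.
Qed.

(** A trial function is split into the top pair [z] and lower modes [u], with squared norms [Z] and
    [U]. The gap gains [4 F U], which covers the potential on [u], at most [3 K U <= F U], and the
    share [3/2 F U] of the cross term. *)
Lemma bulk_eigenvalue_le (al be : R -> R) (K F : R) m l D e :
  bounded_lipschitz K al -> bounded_lipschitz K be ->
  (forall x, al (x + 1) = al x) -> (forall x, be (x + 1) = be x) ->
  1 <= K -> 3 * K <= F ->
  ~~ odd m -> (0 < l)%N -> (l.*2 < m)%N ->
  F <= (l.*2 - 1)%:R -> F <= (m - l.*2)%:R ->
  `|m%:R^-1 * \sum_(i < m) gs m al i| <= K / F ->
  `|m%:R^-1 * \sum_(i < m) gs m be i| <= K / F ->
  eigensystem m (gs m al) (gs m be) D e ->
  D l.*2 <= free_eigenvalue R m l.*2 + (9 * K + 6 * K ^+ 2) / F.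
Proof.
move=> alK beK pal pbe K1 KF me l0 lm Fl Fm ma mb es.
have m0 : (0 < m)%N by lia.
have F0 : 0 < F by lra.
have es0 := hartley_eigensystem R m0 me.
have [ph oh _ _] := es0.
(* Writing [2 l] as a successor lets the last two coefficients be peeled off the sum. *)
have [n En] : exists n, l.*2 = n.+1 by exists l.*2.-1; lia.
have nm : (n < m)%N by clear -lm En; lia.
have n1m : (n.+1 < m)%N by clear -lm En; lia.
have un : uphalf n = uphalf l.*2 by clear -En; lia.
have n1 : l.*2.-1 = n by rewrite En.
have nn1 : (n == n.+1) = false by clear; lia.
have jn2 j : (j < n)%N -> (j <= l.*2 - 2)%N by clear -En; lia.
have n2m : (l.*2 - 2 < m)%N by clear -lm; lia.
have gap := free_eigenvalue_gap me l0 lm (ltW F0) Fl Fm.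
apply: (trial_space_le m0 es (g := hartley R m)) => //.
  by move=> j jl; apply: ph; apply: leq_ltn_trans lm.
move=> c [j0 j0l cj0]; set v := lincomb _ _ _ => /=.
have vv : ip m v v = \sum_(j < l.*2.+1) c j ^+ 2 by rewrite (ip_eigenspan es0).
have kv : kin m v v = \sum_(j < l.*2.+1) free_eigenvalue R m j * c j ^+ 2.
  rewrite -(en_eigenspan_sum c es0 (lm : (l.*2.+1 <= m)%N)).
  by rewrite /en /pot big1 ?mulr0 ?addr0 // => i _; rewrite !mul0r subrr.
split.
  rewrite vv (bigD1 (Ordinal (j0l : (j0 < l.*2.+1)%N))) //=.
  by rewrite ltr_pwDl ?exprn_even_gt0 //; apply: sumr_ge0 => i _; rewrite sqr_ge0.
pose u := lincomb n c (hartley R m).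
pose z i := c n * hartley R m l.*2.-1 i + c n.+1 * hartley R m l.*2 i.
have pu : grid_periodic m u by apply: grid_periodic_lincomb => j jn; apply: ph; apply: ltn_trans nm.
have pz : grid_periodic m z by move=> i; rewrite /z !ph // n1.
have vE : v = fun i => 1 * u i + 1 * z i.
  apply/funext => i; rewrite /v /u /z /lincomb En !big_ord_recr /=; ring.
set U := \sum_(j < n) c j ^+ 2; set Z := c n ^+ 2 + c n.+1 ^+ 2.
have uU : ip m u u = U by rewrite (ip_eigenspan es0) // ltnW.
have zZ : ip m z z = Z.
  rewrite (ip_comb _ (hartley R m l.*2.-1) (hartley R m l.*2)).
  by rewrite En /= !oh // !eqxx nn1 !mulr1 mulr0 addr0.
have vUZ : ip m v v = U + Z by rewrite vv En !big_ord_recr /= addrA.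
have kinv : kin m v v <= (free_eigenvalue R m l.*2 - 4 * F) * U + free_eigenvalue R m l.*2 * Z.
  rewrite kv En !big_ord_recr /= -En (_ : free_eigenvalue R m n = free_eigenvalue R m l.*2); last first.
    by rewrite /free_eigenvalue un.
  have ZE : Z = c n ^+ 2 + c l.*2 ^+ 2 by rewrite /Z En.
  rewrite -addrA -mulrDr -ZE lerD2r mulr_sumr; apply: ler_sum => j _.
  rewrite ler_wpM2r ?sqr_ge0 //; apply: le_trans (_ : free_eigenvalue R m (l.*2 - 2) <= _); last by lra.
  by have [_ _ _ mono] := es0; apply: mono => //; apply: jn2.
have Fl' : F <= l.*2%:R by apply: le_trans Fl _; rewrite ler_nat leq_subr.
have Fm' : F <= m%:R - l.*2%:R by rewrite -natrB // ltnW.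
have := pot_top_pair_le (c n) (c n.+1) alK beK pal pbe me m0 l0 F0 Fl' Fm' ma mb.
rewrite /= -/z -/Z => potz.
have U0 : 0 <= U by apply: sumr_ge0 => j _; rewrite sqr_ge0.
have Z0 : 0 <= Z by rewrite addr_ge0 ?sqr_ge0.
(* This weight makes the cross term [3/2 F U + 6 K^2 / F Z]. *)
pose s := Num.sqrt (F / (2 * K)).
have s0 : 0 < s by rewrite sqrtr_gt0 divr_gt0 //; lra.
have s2 : s ^+ 2 = F / (2 * K) by rewrite sqr_sqrtr // divr_ge0 //; lra.
have cross := pot_cross_le s0 pu pz (fun i => alK.1 (2 * i%:R / m%:R) : `|gs m al i| <= K)
  (fun i => beK.1 (2 * i%:R / m%:R) : `|gs m be i| <= K).
have potu := pot_abs_le pu (fun i => alK.1 (2 * i%:R / m%:R) : `|gs m al i| <= K)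
  (fun i => beK.1 (2 * i%:R / m%:R) : `|gs m be i| <= K).
have potv : pot m (gs m al) (gs m be) v v = pot m (gs m al) (gs m be) u u +
    2 * pot m (gs m al) (gs m be) u z + pot m (gs m al) (gs m be) z z.
  by rewrite vE pot_comb; ring.
have {}potu := le_trans (ler_norm _) potu.
rewrite uU in potu; rewrite uU zZ s2 in cross.
have E1 : 3 * K * (F / (2 * K) * U + (F / (2 * K))^-1 * Z) = 3 / 2 * (F * U) + 6 * K ^+ 2 / F * Z.
  by field; rewrite !gt_eqF //; lra.
rewrite E1 in cross.
have KU : 3 * K * U <= F * U by rewrite ler_wpM2r.
have FU : 0 <= F * U by rewrite mulr_ge0 // ltW.
have CU : 0 <= (9 * K + 6 * K ^+ 2) / F * U.
  by rewrite mulr_ge0 // divr_ge0 ?(ltW F0) // addr_ge0 ?mulr_ge0 ?sqr_ge0 //; lra.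
have kin2 : kin m v v <= free_eigenvalue R m l.*2 * (U + Z) - 4 * (F * U).
  by apply: le_trans kinv _; rewrite le_eqVlt; apply/orP; left; apply/eqP; ring.
rewrite /en vUZ potv.
have -> : (free_eigenvalue R m l.*2 + (9 * K + 6 * K ^+ 2) / F) * (U + Z) =
    free_eigenvalue R m l.*2 * (U + Z) + (9 * K + 6 * K ^+ 2) / F * U +
    (9 * K / F * Z + 6 * K ^+ 2 / F * Z) by ring.
lra.
Qed.

End Bulk.

(** * Pointwise bounds for discrete eigenvectors and their differences *)

Section GridEstimates.
Variable R : realType.
Implicit Types (m n i : nat) (a b u v w D : nat -> R) (e : nat -> nat -> R).

Lemma ler_sum_ord n m (f : nat -> R) : (n <= m)%N -> (forall s, 0 <= f s) ->
  \sum_(s < n) f s <= \sum_(s < m) f s.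
Proof.
move=> nm f0; rewrite -(big_mkord xpredT f) -(big_mkord xpredT f).
by rewrite (big_cat_nat (leq0n n) nm) /= lerDl; apply: sumr_ge0.
Qed.

(** From any node [j], node [i] is reached in fewer than [m] forward steps, so [v i] exceeds [v j]
    by at most the total variation; averaging over [j] gives the bound. *)
Lemma grid_periodic_diff_le m v i : (0 < m)%N -> grid_periodic m v ->
  v i <= m%:R^-1 * \sum_(j < m) v j + \sum_(j < m) `|dif v j|.
Proof.
move=> m0 pv; have mr : 0 < m%:R :> R by rewrite ltr0n.
set V := \sum_(j < m) `|dif v j|.
have pd : grid_periodic m (fun j => `|dif v j|).
  by move=> j; rewrite /dif -addSn !pv.
have H (j : 'I_m) : v i <= v j + V.
  pose n := ((i + (m - j)) %% m)%N.
  have -> : v i = v (j + n)%N.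
    rewrite -(grid_periodic_modn i pv) -(grid_periodic_modn (j + n) pv) /n modnDmr.
    by rewrite addnCA subnKC ?modnDr // ltnW.
  rewrite -lerBlDl telescope_dif.
  apply: le_trans (ler_norm _) _; apply: le_trans (ler_norm_sum _ _ _) _.
  rewrite /V -(sum_grid_shiftn j pd).
  rewrite (eq_bigr (fun s : 'I_n => `|dif v (s + j)|)); last by move=> s _; rewrite addnC.
  apply: (@ler_sum_ord n m (fun s => `|dif v (s + j)|)) => //.
  by rewrite ltnW // ltn_pmod.
have : \sum_(j < m) v i <= \sum_(j < m) (v j + V) by apply: ler_sum => j _.
rewrite big_split /= !sumr_const card_ord -[v i *+ m]mulr_natl -[V *+ m]mulr_natl => h.
rewrite -(ler_pM2l mr) mulrDr mulrA divff ?mul1r //.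
by rewrite gt_eqF.
Qed.

(** Discrete Agmon inequality: the previous bound for [w^2], whose differences factor as [dif w]
    times a sum of neighbours and are split with weight [s]. *)
Lemma agmon m w i (s : R) : (0 < m)%N -> grid_periodic m w -> 0 < s ->
  w i ^+ 2 <= ip m w w + s / 2 * kin m w w + 2 / s * ip m w w.
Proof.
move=> m0 pw s0; have mr : 0 < m%:R :> R by rewrite ltr0n.
have pv : grid_periodic m (fun j => w j ^+ 2) by move=> j; rewrite pw.
apply: le_trans (grid_periodic_diff_le i m0 pv) _.
rewrite -ipE -addrA lerD2l kinE [in leRHS]ipE.
have -> : s / 2 * (m%:R * \sum_(j < m) dif w j ^+ 2) +
    2 / s * (m%:R^-1 * \sum_(j < m) w j ^+ 2) =
    \sum_(j < m) (s / 2 * m%:R * dif w j ^+ 2 +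
      (s * m%:R)^-1 * (w j ^+ 2 + w j.+1 ^+ 2)).
  rewrite big_split /= -!mulr_sumr big_split /= (@sum_grid_shift _ m (fun j => w j ^+ 2)) //.
  by field; rewrite !gt_eqF.
apply: ler_sum => j _.
have -> : dif (fun j => w j ^+ 2) j = dif w j * (w j + w j.+1) by rewrite /dif; ring.
set d := dif w j; set x := w j; set y := w j.+1.
have h := abs_mul2_le (s * m%:R * d) (x + y).
have t0 : 0 < s * m%:R by rewrite mulr_gt0.
have h2 : (x + y) ^+ 2 <= 2 * (x ^+ 2 + y ^+ 2).
  by have := sqr_ge0 (x - y); rewrite !expr2; nra.
rewrite -(ler_pM2l (mulr_gt0 (ltr0n R 2) t0)).
have -> : 2 * (s * m%:R) * `|d * (x + y)| = `|2 * (s * m%:R * d) * (x + y)|.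
  by rewrite -[2 * (s * m%:R) in LHS]ger0_norm ?mulr_ge0 // ?(ltW s0) // -normrM; congr `|_|; ring.
apply: le_trans h _.
rewrite [leRHS](_ : _ = (s * m%:R * d) ^+ 2 + 2 * (x ^+ 2 + y ^+ 2)).
  by rewrite lerD2l.
by field; rewrite !gt_eqF.
Qed.

Lemma grid_op_periodic m a b u : grid_periodic m a -> grid_periodic m b ->
  grid_periodic m u -> grid_periodic m (grid_op m a b u).
Proof. by move=> pa pb pu i; rewrite /grid_op -!addSn !pu !pa !pb. Qed.

(** The weak equation is tested with the periodic indicator of node [i + 1]. *)
Lemma eigensystem_pointwise m a b D e n i : (0 < m)%N ->
  grid_periodic m a -> grid_periodic m b -> eigensystem m a b D e -> (n < m)%N ->
  grid_op m a b (e n) i = D n * e n i.+1.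
Proof.
move=> m0 pa pb [pe _ ee _] nm; have pu := pe n nm.
have mr : m%:R != 0 :> R by rewrite pnatr_eq0 -lt0n.
pose w (j : nat) : R := ((j %% m)%N == (i.+1 %% m)%N)%:R.
have pw : grid_periodic m w by move=> j; rewrite /w modnDr.
have := ee n nm w pw; rewrite en_grid_op // /ip.
rewrite -(@sum_grid_shift _ m (fun j => e n j * w j)); last by move=> j; rewrite pu pw.
rewrite mulrCA => /(mulfI (invr_neq0 mr)).
have pick (f : nat -> R) : grid_periodic m f -> \sum_(j < m) f j * w j.+1 = f i.
  move=> pf; rewrite (bigD1 (Ordinal (ltn_pmod i m0))) //= big1 ?addr0.
    by rewrite /w -addn1 modnDml addn1 eqxx mulr1 (grid_periodic_modn i pf).
  move=> j; rewrite -(inj_eq val_inj) /= => ji.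
  by rewrite /w -addn1 -[i.+1]addn1 eqn_modDr (modn_small (ltn_ord j)) (negbTE ji) mulr0.
rewrite (pick _ (grid_op_periodic pa pb pu)) => ->; congr (_ * _).
by rewrite (pick (fun j => e n j.+1)) // => j; rewrite -addSn pu.
Qed.

(** The energy identity bounds [kin] by [L + 3 K], and [agmon] with [s = 2] bounds the square of
    each value. *)
Lemma eigenvector_sqr_le m a b D e n i (K L : R) : (0 < m)%N ->
  (forall j, `|a j| <= K) -> (forall j, `|b j| <= K) ->
  eigensystem m a b D e -> (n < m)%N -> `|D n| <= L ->
  e n i ^+ 2 <= 3 + L + 3 * K.
Proof.
move=> m0 aK bK es nm DL; have [pe oe ee _] := es; have pu := pe n nm.
have ip1 : ip m (e n) (e n) = 1 by rewrite oe // eqxx.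
have := ee n nm _ pu; rewrite ip1 mulr1 => enE.
have := pot_abs_le pu aK bK; rewrite ip1 mulr1 ler_norml => /andP[p1 _].
have k0 := kin_ge0 m (e n).
have kl : kin m (e n) (e n) <= L + 3 * K.
  by move: enE DL; rewrite /en ler_norml => E /andP[_ h]; lra.
apply: le_trans (agmon i m0 pu (ltr0n R 2 : 0 < 2)) _.
rewrite ip1; lra.
Qed.

Definition eigenvector_bound (K L : R) := (L + 3 * K) * (3 + L + 3 * K).

Lemma eigenvector_dif2_le m a b D e n i (K L : R) : (0 < m)%N ->
  grid_periodic m a -> grid_periodic m b ->
  (forall j, `|a j| <= K) -> (forall j, `|b j| <= K) ->
  eigensystem m a b D e -> (n < m)%N -> `|D n| <= L ->
  m%:R ^+ 2 * `|dif (e n) i.+1 - dif (e n) i| <= eigenvector_bound K L.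
Proof.
move=> m0 pa pb aK bK es nm DL.
have K0 : 0 <= K by apply: le_trans (aK 0%N).
have L0 : 0 <= L by apply: le_trans DL.
(* A number is either at most 1 or at most its own square. *)
have B j : `|e n j| <= 3 + L + 3 * K.
  have := eigenvector_sqr_le j m0 aK bK es nm DL; rewrite -real_normK ?num_real // => h.
  have [|h1] := leP `|e n j| 1; first by lra.
  by apply: le_trans h; rewrite expr2 ler_peMl // ltW.
have E := eigensystem_pointwise i m0 pa pb es nm.
rewrite -[m%:R ^+ 2]ger0_norm ?sqr_ge0 // -normrM.
rewrite (_ : _ * _ = (b i.+1 - D n) * e n i.+1 - a i.+1 * e n i.+2 - a i * e n i); last first.
  by rewrite mulrBl -E /grid_op /dif; ring.
rewrite /eigenvector_bound.
have H x y z : `|x| <= z -> `|y| <= 3 + L + 3 * K -> `|x * y| <= z * (3 + L + 3 * K).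
  by move=> hx hy; rewrite normrM ler_pM.
have h1 : `|b i.+1 - D n| <= K + L by apply: le_trans (ler_normB _ _) _; apply: lerD.
have := H _ _ _ h1 (B i.+1); have := H _ _ _ (aK i.+1) (B i.+2); have := H _ _ _ (aK i) (B i).
rewrite !ler_norml => /andP[? ?] /andP[? ?] /andP[? ?].
have -> : (L + 3 * K) * (3 + L + 3 * K) = (K + L) * (3 + L + 3 * K) +
   K * (3 + L + 3 * K) + K * (3 + L + 3 * K) by ring.
by apply/andP; split; lra.
Qed.

(** The differences of a periodic function have mean zero, so each is bounded by their own total
    variation. *)
Lemma dif_le_of_dif2 m u i (B : R) : (0 < m)%N -> grid_periodic m u -> 0 <= B ->
  (forall j, m%:R ^+ 2 * `|dif u j.+1 - dif u j| <= B) -> m%:R * `|dif u i| <= B.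
Proof.
move=> m0 pu B0 H; have mr : 0 < m%:R :> R by rewrite ltr0n.
have pd : grid_periodic m (dif u) by move=> j; rewrite /dif -addSn !pu.
have sd : \sum_(j < m) dif u j = 0.
  by rewrite /dif sumrB (@sum_grid_shift _ m u) // subrr.
have H2 j : `|dif (dif u) j| <= B / m%:R ^+ 2.
  by rewrite ler_pdivlMr ?exprn_gt0 // mulrC; exact: H.
have sB : \sum_(j < m) `|dif (dif u) j| <= B / m%:R.
  apply: (@le_trans _ _ (\sum_(j < m) B / m%:R ^+ 2)); first by apply: ler_sum => j _.
  rewrite sumr_const card_ord -[leLHS]mulr_natr le_eqVlt; apply/orP; left; apply/eqP.
  by field; rewrite gt_eqF.
have h1 := grid_periodic_diff_le i m0 pd.
have pdN : grid_periodic m (fun j => - dif u j) by move=> j; rewrite pd.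
have h2 := grid_periodic_diff_le i m0 pdN.
rewrite sd mulr0 add0r in h1; rewrite sumrN sd oppr0 mulr0 add0r in h2.
have E : \sum_(j < m) `|dif (fun j => - dif u j) j| = \sum_(j < m) `|dif (dif u) j|.
  by apply: eq_bigr => j _; rewrite -normrN; congr `|_|; rewrite /dif; ring.
rewrite E in h2.
rewrite mulrC -ler_pdivlMr // ler_norml; apply/andP; split; lra.
Qed.

End GridEstimates.

(** * Ultrafilter limits and the passage from grid indices to real points *)

Section ContinuumLimit.
Variable R : realType.
Implicit Types (m n i : nat) (u : nat -> R).

(** Compactness gives a cluster point, and an ultrafilter decides every preimage, so it converges to
    that point. *)
Lemma ultra_bounded_cvg (T : Type) (U : set_system T) (f : T -> R) (B : R) :
  UltraFilter U -> U [set t | `|f t| <= B] -> exists l : R, f @ U --> l.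
Proof.
move=> UU fB; have PU : ProperFilter U by apply: ultra_proper.
have fU : ProperFilter (f @ U) by apply: fmap_proper_filter.
have inI : (f @ U) `[- B, B]%classic.
  apply: (@filterS _ U _ [set t | `|f t| <= B]) => // t.
  by rewrite /= ler_norml in_itv.
have [p [_ clp]] := @segment_compact R (- B) B _ fU inI.
exists p => V Vp.
case: (in_ultra_setVsetC (f @^-1` V) UU) => // nV.
by have [y [ny yV]] := clp _ _ (nV : (f @ U) (~` V)) Vp.
Qed.

(** The hypotheses expand only to the right of the base point, as the discrete Taylor formulas do. A
    negative increment is handled by expanding from [x + h] and moving [g] back with its Lipschitz
    bound, whence the factor 2. *)
Lemma is_derive_of_quadratic (f g : R -> R) (C : R) :
  (forall x x', x <= x' -> x' <= x + 1 ->
     `|f x' - f x - (x' - x) * g x| <= C * (x' - x) ^+ 2) ->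
  (forall x x', x <= x' -> x' <= x + 1 -> `|g x' - g x| <= C * (x' - x)) ->
  forall x : R, is_derive x 1 f (g x).
Proof.
move=> Hf Hg x.
have C0 : 0 <= C by have := Hg 0 1 ler01; rewrite add0r subr0 mulr1 => h; apply: le_trans (h _).
have two h : `|h| <= 1 -> `|f (x + h) - f x - h * g x| <= 2 * C * h ^+ 2.
  move=> h1; have h2 : 0 <= C * h ^+ 2 by rewrite mulr_ge0 ?sqr_ge0.
  have [h0|h0] := leP 0 h.
    have := Hf x (x + h); rewrite (_ : x + h - x = h); last by ring.
    move=> H.
    by apply: le_trans (H _ _) _; rewrite ?lerDl ?lerD2l //; [move: h1; rewrite ger0_norm | lra].
  rewrite ltr0_norm // in h1.
  have e1 : x + h <= x by lra.
  have e2 : x <= x + h + 1 by lra.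
  have := Hf _ _ e1 e2; have := Hg _ _ e1 e2.
  have -> : x - (x + h) = - h by ring.
  rewrite sqrrN => a1 a2.
  have a3 : `|h * (g (x + h) - g x)| <= C * h ^+ 2.
    rewrite normrM distrC ltr0_norm //.
    by apply: le_trans (ler_wpM2l _ a1) _; [lra | rewrite expr2; lra].
  move: a2 a3; rewrite !ler_norml => /andP[? ?] /andP[? ?]; apply/andP; split; lra.
have cv : h^-1 *: ((f \o shift x) (h *: 1) - f x) @[h --> 0^'] --> g x.
  apply/cvgrPdist_le => eps eps0; near=> h.
  have h0 : h != 0 by near: h; exact: nbhs_dnbhs_neq.
  have hle : `|h| <= Num.min 1 (eps / (2 * C + 1)).
    near: h; apply: dnbhs0_le; rewrite lt_min ltr01 divr_gt0 //; lra.
  move: hle; rewrite le_min => /andP[h1 h2].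
  rewrite /= /shift /= [h *: 1]mulr1 (addrC h).
  have -> : h^-1 *: (f (x + h) - f x) = h^-1 * (f (x + h) - f x) by [].
  rewrite (_ : g x - _ = - (h^-1 * (f (x + h) - f x - h * g x))); last by field.
  rewrite normrN normrM normfV ler_pdivrMl ?normr_gt0 //.
  apply: le_trans (two _ h1) _; rewrite -real_normK ?num_real //.
  have hn : 0 <= `|h| by [].
  move: h2; rewrite ler_pdivlMr; last by lra.
  by move=> h2; rewrite expr2 mulrA mulrC ler_wpM2l //; nra.
by split; [apply/cvg_ex; exists (g x) | exact/cvg_lim].
Unshelve. all: by end_near. Qed.

(** The node at or just to the left of the fractional part of [x]. *)
Definition gridindex m (x : R) : nat :=
  Num.truncn (m%:R * (x - (Num.floor x)%:~R)).

(** Forward steps between the nodes of [x] and [x'], whole periods included. *)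
Definition gridsteps m (x x' : R) : nat :=
  (gridindex m x' + m * `|Num.floor x' - Num.floor x|%N - gridindex m x)%N.

Lemma frac_ge0 (x : R) : 0 <= x - (Num.floor x)%:~R.
Proof. by rewrite subr_ge0 floor_le. Qed.

Lemma gridindex_itv m (x : R) :
  (gridindex m x)%:R <= m%:R * (x - (Num.floor x)%:~R) < (gridindex m x).+1%:R.
Proof. by apply: truncn_itv; rewrite mulr_ge0 ?frac_ge0. Qed.

Lemma gridstepsP m (x x' : R) : x <= x' ->
  (forall u, grid_periodic m u -> u (gridindex m x + gridsteps m x x')%N = u (gridindex m x')) /\
  `|(gridsteps m x x')%:R - m%:R * (x' - x)| <= 1.
Proof.
move=> xx.
have fl : (Num.floor x <= Num.floor x')%R by apply: le_floor.
have /andP[a1 a2] := gridindex_itv m x; have /andP[b1 b2] := gridindex_itv m x'.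
have cE : `|Num.floor x' - Num.floor x|%N%:R = (Num.floor x')%:~R - (Num.floor x)%:~R :> R.
  by rewrite natr_absz ger0_norm ?subr_ge0 // intrB.
set c := `|_|%N in cE *.
(* Hence the truncated subtraction in [gridsteps] is a genuine difference. *)
have le : (gridindex m x <= gridindex m x' + m * c)%N.
  rewrite -ltnS -(ltr_nat R); apply: le_lt_trans a1 _.
  rewrite -addSn natrD natrM cE.
  have : m%:R * (x - (Num.floor x)%:~R) <= m%:R * (x' - (Num.floor x)%:~R) :> R.
    by rewrite ler_wpM2l // lerD2r.
  by move: b2; rewrite !mulrBr; lra.
rewrite /gridsteps -/c; split.
  move=> u pu; rewrite subnKC //.
  by rewrite -(grid_periodic_modn _ pu) addnC mulnC modnMDl grid_periodic_modn.
rewrite natrB // natrD natrM cE ler_norml.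
move: a1 a2 b1 b2; rewrite -!natr1 !mulrBr => *; apply/andP; split; lra.
Qed.

Lemma periodic_int (f : R -> R) (x : R) (z : int) :
  (forall x, f (x + 1) = f x) -> f (x + z%:~R) = f x.
Proof.
move=> pf; have pn n y : f (y + n%:R) = f y.
  by elim: n => [|n IH]; rewrite ?addr0 // -natr1 addrA pf.
case: z => n; first exact: pn.
by rewrite NegzE -[LHS](pn n.+1); congr f; rewrite mulrNz -pmulrn; ring.
Qed.

Lemma gridindex_close m (f : R -> R) (L x : R) : (0 < m)%N ->
  (forall x, f (x + 1) = f x) -> (forall x y, `|f x - f y| <= L * `|x - y|) ->
  `|f ((gridindex m x)%:R / m%:R) - f x| <= L / m%:R.
Proof.
move=> m0 pf Lf; have mr : 0 < m%:R :> R by rewrite ltr0n.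
have L0 : 0 <= L by have := Lf 1 0; rewrite subr0 normr1 mulr1; apply: le_trans.
have /andP[a1 a2] := gridindex_itv m x.
have -> : f x = f (x - (Num.floor x)%:~R) by rewrite -[RHS](periodic_int _ (Num.floor x)) ?subrK.
apply: le_trans (Lf _ _) _; rewrite ler_wpM2l //.
rewrite distrC ger0_norm.
  rewrite -(ler_pM2l mr) mulfV ?gt_eqF // mulrBr.
  rewrite [X in _ - X]mulrC divfK ?gt_eqF //.
  by move: a2; rewrite -natr1; lra.
by rewrite subr_ge0 ler_pdivrMr // mulrC.
Qed.

End ContinuumLimit.

(** * Taylor expansions along the grid *)

Section DiscreteTaylor.
Variable R : realType.
Implicit Types (m n i s : nat) (u v a b : nat -> R).

Lemma grid_lipschitz m v (B : R) i s : (0 < m)%N ->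
  (forall j, m%:R * `|dif v j| <= B) -> `|v (i + s)%N - v i| <= B * (s%:R / m%:R).
Proof.
move=> m0 H; have mr : 0 < m%:R :> R by rewrite ltr0n.
rewrite telescope_dif; apply: le_trans (ler_norm_sum _ _ _) _.
apply: (@le_trans _ _ (\sum_(j < s) B / m%:R)).
  by apply: ler_sum => j _; rewrite ler_pdivlMr // mulrC.
by rewrite sumr_const card_ord -[leLHS]mulr_natr le_eqVlt; apply/orP; left; apply/eqP; ring.
Qed.

Lemma discrete_taylor1 m u (B : R) i s : (0 < m)%N -> 0 <= B ->
  (forall j, m%:R ^+ 2 * `|dif u j.+1 - dif u j| <= B) ->
  `|u (i + s)%N - u i - s%:R / m%:R * (m%:R * dif u i)| <= B * (s%:R / m%:R) ^+ 2.
Proof.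
move=> m0 B0 H; have mr : 0 < m%:R :> R by rewrite ltr0n.
have Hp j : m%:R * `|dif (fun k => m%:R * dif u k) j| <= B.
  apply: le_trans (H j); rewrite [dif _ j]/dif -mulrBr normrM ger0_norm ?ler0n //.
  by rewrite mulrA expr2.
rewrite telescope_dif.
have -> : s%:R / m%:R * (m%:R * dif u i) = \sum_(j < s) dif u i.
  by rewrite sumr_const card_ord -[RHS]mulr_natl; field; rewrite gt_eqF.
rewrite -sumrB; apply: le_trans (ler_norm_sum _ _ _) _.
apply: (@le_trans _ _ (\sum_(j < s) B * (s%:R / m%:R ^+ 2))).
  apply: ler_sum => j _.
  have := grid_lipschitz i j m0 Hp; rewrite -mulrBr normrM ger0_norm ?ler0n // => h.
  rewrite -(ler_pM2l mr); apply: le_trans h _.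
  rewrite [leRHS]mulrCA ler_wpM2l // (_ : m%:R * _ = s%:R / m%:R); last by field; rewrite gt_eqF.
  by rewrite ler_wpM2r ?invr_ge0 ?ler0n // ler_nat ltnW.
rewrite sumr_const card_ord -[leLHS]mulr_natr le_eqVlt; apply/orP; left; apply/eqP.
by field; rewrite gt_eqF.
Qed.

(** The equation expresses each second difference by values at nearby nodes, all of them replaced by
    values at node [i]. The three products contribute [3 K + L], [3 K] and [3 K]; [s.+2] covers the
    reach of the equation two nodes ahead. *)
Lemma discrete_taylor2 m u a b (D K L B : R) i s : (0 < m)%N ->
  (forall j, grid_op m a b u j = D * u j.+1) ->
  (forall j, `|u j| <= B) -> (forall j, m%:R * `|dif u j| <= B) ->
  (forall j, `|a j| <= K) -> (forall j, `|b j| <= K) -> `|D| <= L ->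
  (forall j, m%:R * `|dif a j| <= 2 * K) -> (forall j, m%:R * `|dif b j| <= 2 * K) ->
  `|m%:R * dif u (i + s)%N - m%:R * dif u i - s%:R / m%:R * ((b i - 2 * a i - D) * u i)| <=
  (9 * K + L) * B * (s%:R / m%:R) * ((s.+2)%:R / m%:R).
Proof.
move=> m0 opE uB duB aK bK DL daK dbK; have mr : 0 < m%:R :> R by rewrite ltr0n.
have K0 : 0 <= K by apply: le_trans (aK 0%N).
have L0 : 0 <= L by apply: le_trans DL.
have B0 : 0 <= B by apply: le_trans (uB 0%N).
rewrite (telescope_dif (fun k => m%:R * dif u k)).
have -> : s%:R / m%:R * ((b i - 2 * a i - D) * u i) =
   \sum_(j < s) m%:R^-1 * ((b i - 2 * a i - D) * u i).
  by rewrite sumr_const card_ord -[RHS]mulr_natl mulrA.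
rewrite -sumrB; apply: le_trans (ler_norm_sum _ _ _) _.
apply: (@le_trans _ _ (\sum_(j < s) (9 * K + L) * B * (s.+2%:R / m%:R ^+ 2))); last first.
  rewrite sumr_const card_ord -[leLHS]mulr_natr le_eqVlt; apply/orP; left; apply/eqP.
  by field; rewrite gt_eqF.
apply: ler_sum => j _; set l := (i + j)%N.
have -> : dif (fun k => m%:R * dif u k) l =
    m%:R^-1 * ((b l.+1 - D) * u l.+1 - a l.+1 * u l.+2 - a l * u l).
  have := opE l; rewrite /grid_op /dif => E.
  have -> : (b l.+1 - D) * u l.+1 = b l.+1 * u l.+1 - D * u l.+1 by ring.
  by rewrite -E; field; rewrite gt_eqF.
rewrite -mulrBr normrM ger0_norm ?invr_ge0 ?ler0n //.
rewrite (_ : _ * (_ / _) = m%:R^-1 * ((9 * K + L) * B * (s.+2%:R / m%:R))); last first.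
  by field; rewrite gt_eqF.
rewrite ler_wpM2l ?invr_ge0 ?ler0n //.
set h := s.+2%:R / m%:R.
have hle (t : nat) : (t <= s.+2)%N -> t%:R / m%:R <= h.
  by move=> ts; rewrite /h ler_wpM2r ?invr_ge0 ?ler0n // ler_nat.
have h0 : 0 <= h by rewrite divr_ge0 ?ler0n.
have js := ltn_ord j.
have lip v (c : R) (t : nat) : 0 <= c -> (forall k, m%:R * `|dif v k| <= c) -> (t <= s.+2)%N ->
    `|v (i + t)%N - v i| <= c * h.
  by move=> c0 H ts; apply: le_trans (grid_lipschitz i t m0 H) _; rewrite ler_wpM2l // hle.
have l1 : l.+1 = (i + j.+1)%N by rewrite addnS.
have l2 : l.+2 = (i + j.+2)%N by rewrite !addnS.
have K2 : 0 <= 2 * K by rewrite mulr_ge0.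
have b1 := lip b (2 * K) j.+1 K2 dbK (leqW (leqW js) : (j.+1 <= s.+2)%N).
have u1 := lip u B j.+1 B0 duB (leqW (leqW js) : (j.+1 <= s.+2)%N).
have a1 := lip a (2 * K) j.+1 K2 daK (leqW (leqW js) : (j.+1 <= s.+2)%N).
have u2 := lip u B j.+2 B0 duB (leqW js : (j.+2 <= s.+2)%N).
have a0 := lip a (2 * K) j K2 daK (leqW (leqW (ltnW js)) : (j <= s.+2)%N).
have u0 := lip u B j B0 duB (leqW (leqW (ltnW js)) : (j <= s.+2)%N).
rewrite -l1 in b1 u1 a1; rewrite -l2 in u2; rewrite -/l in a0 u0.
have prod (x x0 y y0 c c' : R) : `|x - x0| <= c * h -> `|y| <= B -> `|x0| <= c' ->
    `|y - y0| <= B * h -> `|x * y - x0 * y0| <= (c + c') * B * h.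
  move=> h1 h2 h3 h4; have -> : x * y - x0 * y0 = (x - x0) * y + x0 * (y - y0) by ring.
  apply: le_trans (ler_normD _ _) _; rewrite !normrM.
  have -> : (c + c') * B * h = c * h * B + c' * (B * h) by ring.
  by rewrite lerD // ler_pM.
have bD : `|b i - D| <= K + L by apply: le_trans (ler_normB _ _) _; apply: lerD.
have b1' : `|(b l.+1 - D) - (b i - D)| <= 2 * K * h.
  by rewrite (_ : _ - _ - _ = b l.+1 - b i) //; ring.
have p1 := prod _ _ _ _ _ _ b1' (uB l.+1) bD u1.
have p2 := prod _ _ _ _ _ _ a1 (uB l.+2) (aK i) u2.
have p3 := prod _ _ _ _ _ _ a0 (uB l) (aK i) u0.
move: p1 p2 p3; rewrite !ler_norml => /andP[? ?] /andP[? ?] /andP[? ?].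
have -> : (9 * K + L) * B * h = (2 * K + (K + L)) * B * h + (2 * K + K) * B * h +
   (2 * K + K) * B * h by ring.
have -> : (b i - 2 * a i - D) * u i = (b i - D) * u i - a i * u i - a i * u i by ring.
by apply/andP; split; lra.
Qed.

Lemma gs_dif_le m (f : R -> R) (K : R) i : (0 < m)%N -> bounded_lipschitz K f ->
  m%:R * `|dif (gs m f) i| <= 2 * K.
Proof.
move=> m0 fK; have mr : 0 < m%:R :> R by rewrite ltr0n.
rewrite mulrC -ler_pdivlMr //; apply: le_trans (fK.2 _ _) _; rewrite -[i.+1%:R]natr1.
rewrite (_ : _ - _ = 2 / m%:R); last by field; rewrite gt_eqF.
by rewrite ger0_norm ?divr_ge0 ?ler0n // mulrA (mulrC K).
Qed.

Lemma gs_gridindex_close m (f : R -> R) (K x : R) : (0 < m)%N -> bounded_lipschitz K f ->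
  (forall x, f (x + 1) = f x) ->
  `|gs m f (gridindex m x) - f (2 * x)| <= 2 * K / m%:R.
Proof.
move=> m0 [fK fL] pf.
have := @gridindex_close R m (fun x => f (2 * x)) (2 * K) x m0.
rewrite /gs mulrA; apply.
- by move=> z /=; rewrite mulrDr mulr1 (_ : 2 * z + 2 = 2 * z + 1 + 1) ?pf //; ring.
- move=> z w; apply: le_trans (fL _ _) _; rewrite -mulrBr normrM ger0_norm //.
  by rewrite mulrA (mulrC K).
Qed.

End DiscreteTaylor.

(** * Calculus on the line and periodicity of eigenfunctions *)

Section RealFunctions.
Variable R : realType.
Implicit Types (f g df dg : R -> R) (x y : R).

Lemma is_derive_ext f x (d d' : R) : is_derive x 1 f d -> d = d' -> is_derive x 1 f d'.
Proof. by move=> h <-. Qed.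

Lemma is_derive_add f g x (a b : R) : is_derive x 1 f a -> is_derive x 1 g b ->
  is_derive x 1 (fun t => f t + g t) (a + b).
Proof. by move=> fa gb; exact: is_deriveD. Qed.

Lemma is_derive_sub f g x (a b : R) : is_derive x 1 f a -> is_derive x 1 g b ->
  is_derive x 1 (fun t => f t - g t) (a - b).
Proof. by move=> fa gb; exact: is_deriveB. Qed.

Lemma is_derive_mul f g x (a b : R) : is_derive x 1 f a -> is_derive x 1 g b ->
  is_derive x 1 (fun t => f t * g t) (a * g x + f x * b).
Proof.
move=> fa gb; apply: is_derive_ext (is_deriveM fa gb) _.
by rewrite addrC; congr (_ + _); rewrite [LHS]mulrC.
Qed.

Lemma is_derive_const x (c : R) : is_derive x 1 (fun=> c) (0 : R).
Proof. exact: is_derive_cst. Qed.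

Lemma is_derive_ident x : is_derive x 1 (fun t : R => t) (1 : R).
Proof. exact: is_derive_id. Qed.

Lemma is_derive_shift f x (c a : R) : is_derive (x + c) 1 f a ->
  is_derive x 1 (fun t => f (t + c)) a.
Proof.
move=> fa; have gd := is_derive_add (is_derive_ident x) (is_derive_const x c).
apply: is_derive_ext (is_derive1_comp (g := fun t => t + c) fa gd) _.
by rewrite addr0 mulr1.
Qed.

Lemma is_derive_expM x (c : R) : is_derive x 1 (fun t => expR (c * t)) (c * expR (c * x)).
Proof.
have gd := is_derive_mul (is_derive_const x c) (is_derive_ident x).
apply: is_derive_ext (is_derive1_comp (g := fun t => c * t) (is_derive_expR (c * x)) gd) _.
by rewrite mul0r add0r mulr1 mulrC.
Qed.

Lemma is_derive_continuous f df : (forall x : R, is_derive x 1 f (df x)) -> continuous f.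
Proof.
move=> fd x; apply/differentiable_continuous/derivable1_diffP.
by have h := fd x; exact: ex_derive.
Qed.

Lemma mvt_between f df x y : (forall t : R, is_derive t 1 f (df t)) ->
  exists c, [/\ `|c - x| <= `|y - x|, Num.min x y <= c, c <= Num.max x y &
    f y - f x = df c * (y - x)].
Proof.
move=> fd; have cf := is_derive_continuous fd.
have [xy|yx] := leP x y.
  have [|c] := @MVT_segment R f df x y xy (fun t _ => fd t).
    exact: continuous_subspaceT.
  rewrite in_itv /= => /andP[xc cy] E; exists c; split => //.
  by rewrite !ger0_norm ?subr_ge0 // lerD2r.
have [|c] := @MVT_segment R f df y x (ltW yx) (fun t _ => fd t).
  exact: continuous_subspaceT.
rewrite in_itv /= => /andP[yc cx] E; exists c; split => //.
  rewrite distrC (distrC y) !ger0_norm ?subr_ge0 // ?(ltW yx) //.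
  by rewrite lerD2l lerN2.
by apply: oppr_inj; rewrite opprB E; ring.
Qed.

Lemma lipschitz_of_derive f df (B : R) x y : (forall t : R, is_derive t 1 f (df t)) ->
  (forall t, `|df t| <= B) -> `|f x - f y| <= B * `|x - y|.
Proof.
move=> fd dB; have [c [_ _ _ ->]] := mvt_between y x fd.
by rewrite normrM ler_wpM2r.
Qed.

(** [phi] is the function minus the first and second order Taylor terms; two applications of the
    mean value theorem bound its increment by [L |k|^3], for [k = h] and [k = - h]. *)
Lemma second_difference_le f df (ddf : R -> R) (L x h : R) :
  (forall t : R, is_derive t 1 f (df t)) -> (forall t : R, is_derive t 1 df (ddf t)) ->
  (forall s t, `|ddf s - ddf t| <= L * `|s - t|) ->
  `|f (x + h) + f (x - h) - 2 * f x - h ^+ 2 * ddf x| <= 2 * L * `|h| ^+ 3.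
Proof.
move=> fd dfd ddfL.
have L0 : 0 <= L by have := ddfL 1 0; rewrite subr0 normr1 mulr1; apply: le_trans.
pose phi t := f t - df x * (t - x) - ddf x / 2 * ((t - x) * (t - x)).
have phid (t : R) : is_derive t 1 phi (df t - df x - (t - x) * ddf x).
  have tx := is_derive_sub (is_derive_ident t) (is_derive_const t x).
  have := is_derive_sub (is_derive_sub (fd t)
    (is_derive_mul (is_derive_const t (df x)) tx))
    (is_derive_mul (is_derive_const t (ddf x / 2)) (is_derive_mul tx tx)).
  by move=> H; apply: is_derive_ext H _; field.
have one (k : R) : `|f (x + k) - f x - df x * k - ddf x / 2 * k ^+ 2| <= L * `|k| ^+ 3.
  have [c [cx _ _ E]] := mvt_between x (x + k) phid.
  have [d [dx _ _ E2]] := mvt_between x c dfd.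
  have -> : f (x + k) - f x - df x * k - ddf x / 2 * k ^+ 2 = phi (x + k) - phi x.
    by rewrite /phi; ring.
  rewrite E E2 (_ : _ - (c - x) * _ = (ddf d - ddf x) * (c - x)); last by ring.
  have kk : x + k - x = k by ring.
  rewrite kk in cx *; rewrite !normrM.
  apply: (@le_trans _ _ (L * `|k| * `|k| * `|k|)); last by rewrite !exprS expr0; lra.
  rewrite ler_wpM2r // ler_pM //.
  apply: le_trans (ddfL _ _) _; rewrite ler_wpM2l //.
  exact: le_trans dx cx.
have h1 := one h; have h2 := one (- h).
rewrite normrN in h2.
move: h1 h2; rewrite !ler_norml sqrrN => /andP[? ?] /andP[? ?]; apply/andP; split; lra.
Qed.

Lemma periodic_continuous_bounded f : continuous f -> (forall x, f (x + 1) = f x) ->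
  exists B, forall x, `|f x| <= B.
Proof.
move=> cf pf; have cs := continuous_subspaceT (A := `[0, 1 : R]) cf.
have [a _ Ha] := EVT_max ler01 cs; have [b _ Hb] := EVT_min ler01 cs.
exists (`|f a| + `|f b|) => x.
have -> : f x = f (x - (Num.floor x)%:~R) by rewrite -[RHS](periodic_int _ (Num.floor x)) ?subrK.
have xi : x - (Num.floor x)%:~R \in `[0, 1]%R.
  by rewrite in_itv /= frac_ge0 lerBlDl ltW //; have := floorD1_gt x; rewrite intrD mulr1z.
have := Ha _ xi; have := Hb _ xi; have := ler_norm (f a); have := lerNnormlW (lexx `|f b|).
have := normr_ge0 (f a); have := normr_ge0 (f b).
by move=> ? ? ? ? ? ?; rewrite ler_norml; apply/andP; split; lra.
Qed.

(* Gronwall: [f^2 + g^2] times [exp (- (1 + C) |x|)] is monotone on both sides of 0. *)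
Lemma linear_ode_unique f g (q : R -> R) (C : R) :
  (forall x : R, is_derive x 1 f (g x)) -> (forall x : R, is_derive x 1 g (q x * f x)) ->
  (forall x, `|q x| <= C) -> f 0 = 0 -> g 0 = 0 -> forall x, f x = 0 /\ g x = 0.
Proof.
move=> fd gd qC f0 g0.
pose E x := f x * f x + g x * g x.
have Ed (x : R) : is_derive x 1 E (2 * (1 + q x) * (f x * g x)).
  have h := is_derive_add (is_derive_mul (fd x) (fd x)) (is_derive_mul (gd x) (gd x)).
  by apply: is_derive_ext h _; ring.
have E00 : E 0 = 0 by rewrite /E f0 g0 !mul0r addr0.
have dE x : `|2 * (1 + q x) * (f x * g x)| <= (1 + C) * E x.
  rewrite (_ : _ * _ = (1 + q x) * (2 * f x * g x)); last by ring.
  rewrite normrM ler_pM //; last by rewrite /E -!expr2; exact: abs_mul2_le.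
  by apply: le_trans (ler_normD _ _) _; rewrite normr1 lerD2l.
have E0 x : E x <= 0.
  have [x0|x0] := leP 0 x.
    pose h x := E x * expR (- (1 + C) * x).
    have hd (t : R) : is_derive t 1 h ((2 * (1 + q t) * (f t * g t) - (1 + C) * E t) * expR (- (1 + C) * t)).
      apply: is_derive_ext (is_derive_mul (Ed t) (is_derive_expM t (- (1 + C)))) _; ring.
    have [c [_ _ _ Ec]] := mvt_between 0 x hd.
    have h0 : h 0 = 0 by rewrite /h E00 mul0r.
    have : h x <= 0.
      rewrite h0 subr0 in Ec; rewrite Ec subr0.
      rewrite mulr_le0_ge0 // mulr_le0_ge0 ?expR_ge0 // subr_le0.
      by apply: le_trans (dE c); exact: ler_norm.
    by rewrite /h pmulr_lle0 // expR_gt0.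
  pose h x := E x * expR ((1 + C) * x).
  have hd (t : R) : is_derive t 1 h ((2 * (1 + q t) * (f t * g t) + (1 + C) * E t) * expR ((1 + C) * t)).
    apply: is_derive_ext (is_derive_mul (Ed t) (is_derive_expM t (1 + C))) _; ring.
  have [c [_ _ _ Ec]] := mvt_between 0 x hd.
  have h0 : h 0 = 0 by rewrite /h E00 mul0r.
  have : h x <= 0.
    rewrite h0 subr0 in Ec; rewrite Ec subr0.
    rewrite mulr_ge0_le0 ?(ltW x0) // mulr_ge0 ?expR_ge0 //.
    by have := dE c; rewrite ler_norml => /andP[]; lra.
  by rewrite /h pmulr_lle0 // expR_gt0.
move=> x; have := E0 x; have f2 := sqr_ge0 (f x); have g2 := sqr_ge0 (g x).
rewrite /E -!expr2 => Ex; split; apply/eqP; rewrite -sqrf_eq0; apply/eqP; lra.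
Qed.

Lemma eigenspace_derive (q y : R -> R) mu : periodic_eigenspace q mu y ->
  (forall x : R, is_derive x 1 y (derive1 y x)) /\
  (forall x : R, is_derive x 1 y^`() ((q x - mu) * y x)).
Proof.
case=> dy ddy ode _ _; split => x.
  by rewrite derive1E; apply: derivableP.
have -> : (q x - mu) * y x = (y^`())^`() x.
  by have := ode x; rewrite /= => h; rewrite mulrBl -h; ring.
by rewrite derive1E; apply: derivableP.
Qed.

(** The boundary conditions relate only the points 0 and 1. The difference of the translate by 1 and
    the function itself solves the same linear equation with zero initial data, so it vanishes. *)
Lemma eigenfunction_periodic (q y : R -> R) (mu C : R) :
  (forall x, `|q x| <= C) -> (forall x, q (x + 1) = q x) ->
  periodic_eigenspace q mu y ->
  forall x, y (x + 1) = y x /\ derive1 y (x + 1) = derive1 y x.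
Proof.
move=> qC pq Ey; have [d1 d2] := eigenspace_derive Ey; case: Ey => _ _ _ y1 p1.
pose f x := y (x + 1) - y x; pose g x := derive1 y (x + 1) - derive1 y x.
have fd (x : R) : is_derive x 1 f (g x) by apply: is_derive_sub => //; exact: is_derive_shift.
have gd (x : R) : is_derive x 1 g ((q x - mu) * f x).
  apply: is_derive_ext (is_derive_sub (is_derive_shift (d2 (x + 1))) (d2 x)) _.
  by rewrite pq /f; ring.
have qC' x : `|q x - mu| <= C + `|mu| by apply: le_trans (ler_normB _ _) _; rewrite lerD2r.
have f0 : f 0 = 0 by rewrite /f add0r y1 subrr.
have g0 : g 0 = 0 by rewrite /g add0r p1 subrr.
move=> x; have [h1 h2] := linear_ode_unique fd gd qC' f0 g0 x.
by split; apply/eqP; rewrite -subr_eq0; apply/eqP.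
Qed.

End RealFunctions.

(** * Dimension counts and recovery of a monotone sequence from multiplicities *)

Section Multiplicities.
Variable R : realType.

(** If [b < a], the coefficient matrix has a nonzero left kernel, which is a linear relation among
    the [f i]. *)
Lemma family_dim_le a b (f : 'I_a -> R -> R) (g : 'I_b -> R -> R) :
  (forall i, exists c : 'rV[R]_b, forall x, f i x = \sum_(j < b) c 0 j * g j x) ->
  (forall d : 'rV[R]_a, (forall x, \sum_(i < a) d 0 i * f i x = 0) -> d = 0) ->
  (a <= b)%N.
Proof.
move=> /choice[C fC] free; rewrite leqNgt; apply/negP => ba.
pose A : 'M[R]_(a, b) := \matrix_(i, j) C i 0 j.
have kA : kermx A != 0.
  rewrite -mxrank_eq0 mxrank_ker subn_eq0 -ltnNge.
  exact: leq_ltn_trans (rank_leq_col A) ba.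
have [i ki] : exists i, row i (kermx A) != 0.
  apply/existsP; rewrite -[X in is_true X]negbK negb_exists.
  apply: contra kA => /forallP k0; apply/eqP/row_matrixP => i.
  by rewrite row0; apply/eqP; have := k0 i; rewrite negbK.
have [v v0 vA] : exists2 v : 'rV[R]_a, v != 0 & v *m A = 0.
  by exists (row i (kermx A)) => //; rewrite -row_mul mulmx_ker row0.
move/eqP: v0; apply; apply: free => x.
transitivity (\sum_(j < b) (v *m A) 0 j * g j x); last first.
  by apply: big1 => j _; rewrite vA mxE mul0r.
rewrite (eq_bigr (fun l => \sum_(j < b) v 0 l * (C l 0 j * g j x))); last first.
  by move=> l _; rewrite fC mulr_sumr.
rewrite exchange_big; apply: eq_bigr => j _; rewrite mxE mulr_suml.
by apply: eq_bigr => l _; rewrite mxE mulrA.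
Qed.

(** The functions [y n] with [P n] and [n < J] are free and span [E]; the count is compared in both
    directions with the basis supplied by [has_dim]. *)
Lemma eigenspace_count (E : set (R -> R)) k (y : nat -> R -> R) (P : pred nat) J :
  has_dim E k -> E (fun=> 0) ->
  (forall n, P n -> E (y n)) ->
  (forall c : nat -> R, (forall x, \sum_(j < J) c j * y j x = 0) ->
    forall j, (j < J)%N -> c j = 0) ->
  (forall f, E f -> exists c : nat -> R, (forall j, ~~ P j -> c j = 0) /\
    forall x, f x = \sum_(j < J) c j * y j x) ->
  count P (iota 0 J) = k.
Proof.
move=> [b [Eb bE]] E0 Py free span.
pose s := [seq n <- iota 0 J | P n].
have us : uniq s by rewrite filter_uniq ?iota_uniq.
have sP i : (i < size s)%N -> P (nth 0%N s i) /\ (nth 0%N s i < J)%N.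
  by move=> /(mem_nth 0%N); rewrite mem_filter mem_iota add0n => /andP[].
rewrite -size_filter -/s.
have sumE (F : nat -> R) : \sum_(j < J | P j) F j = \sum_(i < size s) F (nth 0%N s i).
  rewrite -(big_mkord P F) -(big_mkord xpredT (fun i => F (nth 0%N s i))).
  by rewrite -(big_nth 0%N xpredT F) /s big_filter /index_iota subn0.
have sumP (c : nat -> R) x : (forall j, ~~ P j -> c j = 0) ->
    \sum_(j < J) c j * y j x = \sum_(i < size s) c (nth 0%N s i) * y (nth 0%N s i) x.
  move=> c0; rewrite -(sumE (fun j => c j * y j x)) [RHS]big_mkcond.
  by apply: eq_bigr => j _; case: ifPn => // /c0 ->; rewrite mul0r.
apply/eqP; rewrite eqn_leq; apply/andP; split.
  apply: (family_dim_le (f := fun i : 'I_(size s) => y (nth 0%N s i)) (g := b)).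
    move=> i; have [Pi _] := sP i (ltn_ord i).
    by have [c [cE _]] := bE _ (Py _ Pi); exists c.
  move=> d d0; apply/rowP => i; rewrite mxE.
  (* The coefficients [d], indexed by positions in [s], are spread over the natural numbers with
     value 0 off [s]. *)
  pose c j := if P j then
    (if insub (index j s) is Some l then d 0 l else 0) else 0.
  have cE (l : 'I_(size s)) : c (nth 0%N s l) = d 0 l.
    by rewrite /c (sP l (ltn_ord l)).1 index_uniq // valK.
  rewrite -cE; apply: (free c); last by have [] := sP i (ltn_ord i).
  move=> x; rewrite sumP; last by move=> j /negbTE nP; rewrite /c nP.
  by rewrite -[RHS](d0 x); apply: eq_bigr => l _; rewrite cE.
apply: (family_dim_le (f := b) (g := fun i : 'I_(size s) => y (nth 0%N s i))).
  move=> i; have [c [c0 cE]] := span _ (Eb i).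
  exists (\row_l c (nth 0%N s l)) => x; rewrite cE sumP //.
  by apply: eq_bigr => l _; rewrite mxE.
(* Independence of the basis is the uniqueness of the coordinates of the zero function. *)
move=> d d0; have [c [_ uc]] := bE _ E0.
rewrite -(uc d) // -(uc 0) // => x; apply/esym/big1 => i _.
by rewrite mxE mul0r.
Qed.

(** A finite set of indices is bounded, so counting over initial segments stabilizes. *)
Lemma card_eq_count (p : pred nat) k : ([set n | p n] #= `I_k)%card ->
  exists J0, forall J, (J0 <= J)%N -> count p (iota 0 J) = k.
Proof.
move=> ck; have fk : finite_set [set n | p n] by apply/finite_setP; exists k.
have [s sE] := (finite_seqP [set n | p n]).1 fk.
exists (\max_(n <- s) n).+1 => J bJ.
have pJ n : p n -> (n < J)%N.
  move=> pn; have ns : n \in s by have : [set n | p n] n by []; rewrite sE.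
  by apply: leq_trans bJ; rewrite ltnS; apply: (leq_bigmax_seq (F := id)).
rewrite -(card_fset_set ck) -size_filter; apply/perm_size/uniq_perm.
- by rewrite filter_uniq // iota_uniq.
- exact: finmap.fset_uniq.
move=> n; rewrite mem_filter mem_iota add0n /=.
apply: etrans (esym (in_fset_set fk n)).
apply/idP/idP => [/andP[pn _]|]; first by rewrite inE.
by rewrite inE /= => pn; rewrite pn pJ.
Qed.

(** At the first disagreement the smaller of the two values is taken once more by its own sequence,
    while the other one, being monotone, has passed it for good; so the counts differ. *)
Lemma monotone_eq_of_count (u v : nat -> R) :
  nondecreasing_seq u -> nondecreasing_seq v ->
  (forall x : R, exists J0, forall J, (J0 <= J)%N ->
     count (fun n => u n == x) (iota 0 J) = count (fun n => v n == x) (iota 0 J)) ->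
  forall n, u n = v n.
Proof.
move=> mu mv H n; have [m] := ubnP n; elim: m n => // m IH n nm.
have half (u1 v1 : nat -> R) : nondecreasing_seq v1 ->
    (forall i, (i < n)%N -> u1 i = v1 i) ->
    (forall x : R, exists J0, forall J, (J0 <= J)%N ->
      count (fun n => u1 n == x) (iota 0 J) = count (fun n => v1 n == x) (iota 0 J)) ->
    v1 n <= u1 n.
  move=> mv1 eq1 cnt; rewrite leNgt; apply/negP => uv.
  have [J0 HJ] := cnt (u1 n); have := HJ (n.+1 + J0)%N (leq_addl _ _).
  rewrite iotaD !count_cat -[n.+1]addn1 iotaD !count_cat /= eqxx.
  rewrite (_ : count (fun i => v1 i == u1 n) (iota 0 n) = count (fun i => u1 i == u1 n) (iota 0 n)).
    rewrite (_ : (v1 n == u1 n) = false); last by rewrite gt_eqF.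
    rewrite (_ : count (fun i => v1 i == u1 n) (iota _ J0) = 0%N); first by lia.
    apply/eqP; rewrite -leqn0 leqNgt -has_count; apply/hasPn => i.
    rewrite mem_iota => /andP[ni _]; rewrite gt_eqF //.
    by apply: lt_le_trans uv _; apply: mv1; lia.
  apply: eq_in_count => i; rewrite mem_iota add0n => /andP[_ /eq1 ->] //.
have eqn i : (i < n)%N -> u i = v i by move=> hi; apply: IH; apply: leq_trans hi _.
apply/eqP; rewrite eq_le; apply/andP; split.
  by apply: half => // [i /eqn->//|x]; have [J0 HJ] := H x; exists J0 => J /HJ ->.
exact: half.
Qed.

End Multiplicities.

(** * Limits of discrete eigenpairs are exactly the eigenpairs of the Hill operator *)

Section HillLimit.
Variables (R : realType) (al be : R -> R) (K : R).
Variables (U : set_system nat) (M : nat -> nat).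
Variables (D : nat -> nat -> R) (e : nat -> nat -> nat -> R).
Hypotheses (alK : bounded_lipschitz K al) (beK : bounded_lipschitz K be).
Hypotheses (pal : forall x, al (x + 1) = al x) (pbe : forall x, be (x + 1) = be x).
Hypotheses (UU : UltraFilter U) (ML : forall n, U [set k | (n < M k)%N]).
Hypothesis Meven : forall k, ~~ odd (M k).
Hypothesis es : forall k, eigensystem (M k) (gs (M k) al) (gs (M k) be) (D k) (e k).

Let UP : ProperFilter U. Proof. exact: ultra_proper. Qed.

Let K0 : 0 <= K. Proof. by apply: le_trans (alK.1 0). Qed.

Let aK k i : `|gs (M k) al i| <= K. Proof. exact: alK.1. Qed.
Let bK k i : `|gs (M k) be i| <= K. Proof. exact: beK.1. Qed.

Definition eigenvalue_bound n : R := 64 * (uphalf n)%:R ^+ 2 + 3 * K.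

(** A single constant, independent of the grid, that dominates the values of the eigenvector and its
    scaled first and second differences. *)
Definition limit_bound n : R :=
  3 + eigenvalue_bound n + 3 * K + eigenvector_bound K (eigenvalue_bound n).

Lemma eigenvalue_bound_ge0 n : 0 <= eigenvalue_bound n.
Proof. by rewrite addr_ge0 // mulr_ge0 ?sqr_ge0. Qed.

Lemma eigenvector_bound_ge0 n : 0 <= eigenvector_bound K (eigenvalue_bound n).
Proof.
have h := eigenvalue_bound_ge0 n.
by rewrite /eigenvector_bound mulr_ge0 // !addr_ge0 // mulr_ge0.
Qed.

Lemma limit_bound_ge0 n : 0 <= limit_bound n.
Proof.
have h := eigenvalue_bound_ge0 n; have h2 := eigenvector_bound_ge0 n.
by rewrite /limit_bound !addr_ge0 // mulr_ge0.
Qed.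

Lemma M_gt0 k n : (n < M k)%N -> (0 < M k)%N.
Proof. by apply: leq_ltn_trans. Qed.

Lemma discrete_eigenvalue_le k n : (n < M k)%N -> `|D k n| <= eigenvalue_bound n.
Proof.
move=> nM; have m0 := M_gt0 nM.
have := weyl_free (Meven k) nM (aK k) (bK k) (es k).
have := free_eigenvalue_le R m0 (Meven k) nM; have := free_eigenvalue_ge R m0 (Meven k) nM.
have : 0 <= 4 * (uphalf n)%:R ^+ 2 :> R by rewrite mulr_ge0 ?sqr_ge0.
rewrite /eigenvalue_bound !ler_norml => h1 h2 h3 /andP[? ?]; apply/andP; split; lra.
Qed.

Lemma discrete_eigenvector_le k n i : (n < M k)%N -> `|e k n i| <= limit_bound n.
Proof.
move=> nM; have m0 := M_gt0 nM.
have := eigenvector_sqr_le i m0 (aK k) (bK k) (es k) nM (discrete_eigenvalue_le nM).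
have := eigenvalue_bound_ge0 n; have := eigenvector_bound_ge0 n; have := K0.
rewrite /limit_bound -[e k n i ^+ 2]real_normK ?num_real // => ? ? ? h.
have [|h1] := leP `|e k n i| 1; first by lra.
apply: (@le_trans _ _ (`|e k n i| ^+ 2)); last by lra.
by rewrite expr2 ler_peMl // ltW.
Qed.

Lemma discrete_dif2_le k n i : (n < M k)%N ->
  (M k)%:R ^+ 2 * `|dif (e k n) i.+1 - dif (e k n) i| <= limit_bound n.
Proof.
move=> nM; have m0 := M_gt0 nM.
have pa := gs_periodic (Meven k) m0 pal; have pb := gs_periodic (Meven k) m0 pbe.
have := eigenvector_dif2_le i m0 pa pb (aK k) (bK k) (es k) nM (discrete_eigenvalue_le nM).
have := eigenvalue_bound_ge0 n; have := K0; rewrite /limit_bound; lra.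
Qed.

Lemma discrete_dif_le k n i : (n < M k)%N ->
  (M k)%:R * `|dif (e k n) i| <= limit_bound n.
Proof.
move=> nM; have [pe _ _ _] := es k.
exact: dif_le_of_dif2 (M_gt0 nM) (pe n nM) (limit_bound_ge0 n) (fun j => discrete_dif2_le j nM).
Qed.

Lemma invM_cvg0 : (fun k => (M k)%:R^-1 : R) @ U --> (0 : R).
Proof.
apply/cvgrPdist_le => eps eps0.
have := ML (Num.truncn eps^-1); apply: filterS => k /= h.
have m0 := M_gt0 h.
rewrite sub0r normrN ger0_norm ?invr_ge0 // invf_ple ?posrE ?ltr0n //.
apply: ltW; apply: lt_le_trans (_ : (Num.truncn eps^-1).+1%:R <= _); last by rewrite ler_nat.
by have /andP[] := truncn_itv (ltW (etrans (invr_gt0 _) eps0) : 0 <= eps^-1).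
Qed.

Lemma limitD (f g : nat -> R) (l l' : R) : f @ U --> l -> g @ U --> l' ->
  (fun k => f k + g k) @ U --> l + l'.
Proof. by move=> fl gl; exact: cvgD. Qed.

Lemma limitB (f g : nat -> R) (l l' : R) : f @ U --> l -> g @ U --> l' ->
  (fun k => f k - g k) @ U --> l - l'.
Proof. by move=> fl gl; exact: cvgB. Qed.

Lemma limitM (f g : nat -> R) (l l' : R) : f @ U --> l -> g @ U --> l' ->
  (fun k => f k * g k) @ U --> l * l'.
Proof. by move=> fl gl; exact: cvgM. Qed.

Lemma cst_cvg (c : R) : (fun=> c) @ U --> c.
Proof. exact: cvg_cst. Qed.
Arguments cst_cvg : clear implicits.

Lemma le_limit (f g : nat -> R) (l l' : R) : f @ U --> l -> g @ U --> l' ->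
  U [set k | f k <= g k] -> l <= l'.
Proof. by move=> fl gl H; apply: (ler_cvg_to fl gl). Qed.

Lemma norm_le_limit (f g : nat -> R) (l l' : R) : f @ U --> l -> g @ U --> l' ->
  U [set k | `|f k| <= g k] -> `|l| <= l'.
Proof. by move=> fl gl H; apply: (le_limit (cvg_norm fl) gl). Qed.

Lemma limit_eq0 (f g : nat -> R) (l : R) : f @ U --> l -> g @ U --> (0 : R) ->
  U [set k | `|f k| <= g k] -> l = 0.
Proof. by move=> fl gl H; apply/eqP; rewrite -normr_le0 (norm_le_limit fl gl). Qed.

Definition limit_eigenvalue n : R := lim ((fun k => D k n) @ U).

Definition limit_eigenfunction n (x : R) : R :=
  lim ((fun k => e k n (gridindex (M k) x)) @ U).

Definition limit_derivative n (x : R) : R :=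
  lim ((fun k => (M k)%:R * dif (e k n) (gridindex (M k) x)) @ U).

Lemma bounded_cvg_lim (f : nat -> R) (B : R) : U [set k | `|f k| <= B] ->
  f @ U --> lim (f @ U).
Proof. by move=> fB; have [l fl] := ultra_bounded_cvg UU fB; exact: (cvgP l fl). Qed.

Lemma limit_eigenvalueP n : (fun k => D k n) @ U --> limit_eigenvalue n.
Proof.
apply: (bounded_cvg_lim (B := eigenvalue_bound n)).
by apply: filterS (ML n) => k /= h; exact: discrete_eigenvalue_le.
Qed.
Arguments limit_eigenvalueP : clear implicits.

Lemma limit_eigenfunctionP n x :
  (fun k => e k n (gridindex (M k) x)) @ U --> limit_eigenfunction n x.
Proof.
apply: (bounded_cvg_lim (B := limit_bound n)).
by apply: filterS (ML n) => k /= h; exact: discrete_eigenvector_le.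
Qed.
Arguments limit_eigenfunctionP : clear implicits.

Lemma limit_derivativeP n x :
  (fun k => (M k)%:R * dif (e k n) (gridindex (M k) x)) @ U --> limit_derivative n x.
Proof.
apply: (bounded_cvg_lim (B := limit_bound n)).
apply: filterS (ML n) => k /= h; rewrite normrM ger0_norm //; exact: discrete_dif_le.
Qed.
Arguments limit_derivativeP : clear implicits.

Lemma gridsteps_cvg (x x' : R) : x <= x' ->
  (fun k => (gridsteps (M k) x x')%:R / (M k)%:R) @ U --> x' - x.
Proof.
move=> xx; apply/cvgrPdist_le => eps eps0.
apply: filterS2 (ML 0) (cvgr_le _ invM_cvg0 _ eps0) => k /= m0.
apply: le_trans; have [_ H] := gridstepsP (M k) xx.
have mr : 0 < (M k)%:R :> R by rewrite ltr0n.
rewrite distrC (_ : _ / _ - _ = ((gridsteps (M k) x x')%:R - (M k)%:R * (x' - x)) / (M k)%:R); last first.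
  by field; rewrite gt_eqF.
by rewrite normrM [X in _ * X]ger0_norm ?invr_ge0 // ler_piMl ?invr_ge0.
Qed.

Lemma limit_eigenfunction_bound n x : `|limit_eigenfunction n x| <= limit_bound n.
Proof.
apply: (norm_le_limit (limit_eigenfunctionP n x) (cst_cvg _)).
by apply: filterS (ML n) => k /= h; exact: discrete_eigenvector_le.
Qed.

Lemma limit_eigenvalue_bound n : `|limit_eigenvalue n| <= eigenvalue_bound n.
Proof.
apply: (norm_le_limit (limit_eigenvalueP n) (cst_cvg _)).
by apply: filterS (ML n) => k /= h; exact: discrete_eigenvalue_le.
Qed.

Lemma limit_eigenfunction_lipschitz n x x' : x <= x' ->
  `|limit_eigenfunction n x' - limit_eigenfunction n x| <= limit_bound n * (x' - x).
Proof.
move=> xx.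
apply: (norm_le_limit (limitB (limit_eigenfunctionP n x') (limit_eigenfunctionP n x))
  (limitM (cst_cvg (limit_bound n)) (gridsteps_cvg xx))).
apply: filterS (ML n) => k /= nM; have [pe _ _ _] := es k.
have [H _] := gridstepsP (M k) xx; rewrite -(H _ (pe n nM)).
by apply: grid_lipschitz (M_gt0 nM) _ => j; exact: discrete_dif_le.
Qed.

Lemma limit_derivative_lipschitz n x x' : x <= x' ->
  `|limit_derivative n x' - limit_derivative n x| <= limit_bound n * (x' - x).
Proof.
move=> xx.
apply: (norm_le_limit (limitB (limit_derivativeP n x') (limit_derivativeP n x))
  (limitM (cst_cvg (limit_bound n)) (gridsteps_cvg xx))).
apply: filterS (ML n) => k /= nM; have [pe _ _ _] := es k.
have [H _] := gridstepsP (M k) xx.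
rewrite -(H (dif (e k n))); last by move=> j; rewrite /dif -addSn !pe.
apply: (grid_lipschitz (v := fun j => (M k)%:R * dif (e k n) j)) => [|j].
  exact: M_gt0 nM.
rewrite {1}/dif -mulrBr normrM ger0_norm // mulrA -expr2; exact: discrete_dif2_le.
Qed.

Lemma limit_taylor1 n x x' : x <= x' ->
  `|limit_eigenfunction n x' - limit_eigenfunction n x - (x' - x) * limit_derivative n x|
  <= limit_bound n * (x' - x) ^+ 2.
Proof.
move=> xx; have st := gridsteps_cvg xx.
have c1 := limitB (limitB (limit_eigenfunctionP n x') (limit_eigenfunctionP n x))
  (limitM st (limit_derivativeP n x)).
have c2 := limitM (cst_cvg (limit_bound n)) (limitM st st).
rewrite expr2; apply: (norm_le_limit c1 c2).
apply: filterS (ML n) => k /= nM; have [pe _ _ _] := es k.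
have [H _] := gridstepsP (M k) xx; rewrite -(H _ (pe n nM)).
rewrite -expr2; apply: discrete_taylor1 (M_gt0 nM) (limit_bound_ge0 n) _ => j.
exact: discrete_dif2_le.
Qed.

(** Limit of [discrete_taylor2]; the two extra steps in [s.+2] contribute [2 / M k] and
    disappear. *)
Lemma limit_taylor2 n x x' : x <= x' ->
  `|limit_derivative n x' - limit_derivative n x -
    (x' - x) * ((q_minus al be x - limit_eigenvalue n) * limit_eigenfunction n x)|
  <= (9 * K + eigenvalue_bound n) * limit_bound n * (x' - x) ^+ 2.
Proof.
move=> xx; have st := gridsteps_cvg xx.
have qc (f : R -> R) : bounded_lipschitz K f -> (forall x, f (x + 1) = f x) ->
    (fun k => gs (M k) f (gridindex (M k) x)) @ U --> f (2 * x).
  move=> fK pf; apply/cvgrPdist_le => eps eps0.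
  have c0 : (fun k => 2 * K / (M k)%:R) @ U --> (0 : R).
    by rewrite -[X in _ --> X](mulr0 (2 * K)); exact: limitM (cst_cvg _) invM_cvg0.
  apply: filterS2 (ML 0) (cvgr_le _ c0 _ eps0) => k /= m0.
  by apply: le_trans; rewrite distrC; exact: gs_gridindex_close.
have c1 := limitB (limitB (limit_derivativeP n x') (limit_derivativeP n x))
  (limitM st (limitM (limitB (limitB (qc _ beK pbe) (limitM (cst_cvg 2) (qc _ alK pal)))
     (limit_eigenvalueP n)) (limit_eigenfunctionP n x))).
have c2 := limitM (limitM (cst_cvg ((9 * K + eigenvalue_bound n) * limit_bound n)) st)
  (limitD st (limitM (cst_cvg 2) invM_cvg0)).
rewrite mulr0 addr0 -mulrA -expr2 in c2.
have -> : q_minus al be x = be (2 * x) - 2 * al (2 * x) by rewrite /q_minus; ring.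
apply: (norm_le_limit c1 c2).
apply: filterS (ML n) => k /= nM; have [pe _ _ _] := es k; have m0 := M_gt0 nM.
have [H _] := gridstepsP (M k) xx.
rewrite -(H (dif (e k n))); last by move=> j; rewrite /dif -addSn !pe.
have pa := gs_periodic (Meven k) m0 pal; have pb := gs_periodic (Meven k) m0 pbe.
have := discrete_taylor2 (gridindex (M k) x) (gridsteps (M k) x x') m0
  (fun j => eigensystem_pointwise j m0 pa pb (es k) nM)
  (fun j => discrete_eigenvector_le j nM) (fun j => discrete_dif_le j nM)
  (aK k) (bK k) (discrete_eigenvalue_le nM)
  (fun j => gs_dif_le j m0 alK) (fun j => gs_dif_le j m0 beK).
move=> h; apply: le_trans h _; rewrite le_eqVlt; apply/orP; left; apply/eqP.
by rewrite -addn2 natrD; ring.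
Qed.


Lemma limit_eigenfunction_derive n (x : R) :
  is_derive x 1 (limit_eigenfunction n) (limit_derivative n x).
Proof.
apply: (is_derive_of_quadratic (C := limit_bound n)) => z z' zz' _.
  exact: limit_taylor1.
exact: limit_derivative_lipschitz.
Qed.

Lemma q_minus_lipschitz x y : `|q_minus al be x - q_minus al be y| <= 6 * K * `|x - y|.
Proof.
rewrite (_ : _ - _ = (be (2 * x) - be (2 * y)) - 2 * (al (2 * x) - al (2 * y))); last first.
  by rewrite /q_minus; ring.
have h : `|2 * x - 2 * y| = 2 * `|x - y| by rewrite -mulrBr normrM ger0_norm.
have := alK.2 (2 * x) (2 * y); have := beK.2 (2 * x) (2 * y); rewrite h => h1 h2.
apply: le_trans (ler_normB _ _) _; rewrite normrM (ger0_norm (ler0n R 2)); lra.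
Qed.

Lemma q_minus_bound x : `|q_minus al be x| <= 3 * K.
Proof.
have := alK.1 (2 * x); have := beK.1 (2 * x); rewrite /q_minus !ler_norml.
by move=> /andP[? ?] /andP[? ?]; apply/andP; split; lra.
Qed.

Lemma limit_derivative_derive n (x : R) : is_derive x 1 (limit_derivative n)
  ((q_minus al be x - limit_eigenvalue n) * limit_eigenfunction n x).
Proof.
apply: (is_derive_of_quadratic (C := (9 * K + eigenvalue_bound n) * limit_bound n)
  (g := fun x => (q_minus al be x - limit_eigenvalue n) * limit_eigenfunction n x)) => z z' zz' _.
  exact: limit_taylor2.
have ql := q_minus_lipschitz z' z; rewrite (ger0_norm (_ : 0 <= z' - z)) in ql; last by rewrite subr_ge0.
have qb := q_minus_bound z; have mb := limit_eigenvalue_bound n.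
have yb := limit_eigenfunction_bound n z'; have yl := limit_eigenfunction_lipschitz n zz'.
set B := limit_bound n in yb yl *; set L := eigenvalue_bound n in mb *.
set q := q_minus al be in ql qb *; set y := limit_eigenfunction n in yb yl *.
set mu := limit_eigenvalue n in mb *.
rewrite (_ : _ - _ = (q z' - q z) * y z' + (q z - mu) * (y z' - y z)); last by ring.
apply: le_trans (ler_normD _ _) _; rewrite !normrM.
have -> : (9 * K + L) * B * (z' - z) = 6 * K * (z' - z) * B + (3 * K + L) * (B * (z' - z)) by ring.
by rewrite lerD // ler_pM //; apply: le_trans (ler_normB _ _) _; apply: lerD.
Qed.

Lemma derive1_limit_eigenfunction n : (limit_eigenfunction n)^`() = limit_derivative n.
Proof.
apply/funext => x; rewrite derive1E.
by have h := limit_eigenfunction_derive n x; rewrite derive_val.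
Qed.

(** The equation comes from the two limit Taylor formulas. The boundary conditions hold because 0
    and 1 have the same grid index. *)
Lemma limit_eigenfunction_in n :
  periodic_eigenspace (q_minus al be) (limit_eigenvalue n) (limit_eigenfunction n).
Proof.
have y1 m : gridindex m (1 : R) = gridindex m (0 : R).
  by rewrite /gridindex floor1 floor0 mulr1z mulr0z !subrr.
split.
- by move=> x; have h := limit_eigenfunction_derive n x; exact: ex_derive.
- move=> x; rewrite derive1_limit_eigenfunction.
  by have h := limit_derivative_derive n x; exact: ex_derive.
- move=> x; have -> : (limit_eigenfunction n)^`(2)%classic = ((limit_eigenfunction n)^`())^`()%classic by [].
  rewrite derive1_limit_eigenfunction derive1E.
  have h := limit_derivative_derive n x; rewrite derive_val; ring.
- by rewrite /limit_eigenfunction; under eq_fun do rewrite y1.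
- by rewrite derive1_limit_eigenfunction /limit_derivative; under eq_fun do rewrite y1.
Qed.

(** By [agmon], a small weight [s] makes the bounded [kin] contribute at most half of [eps^2]; with
    [s] fixed, the vanishing [ip] supplies the other half. *)
Lemma ip_cvg0_limit0 (w : nat -> nat -> R) (L x : R) : 0 <= L ->
  U [set k | grid_periodic (M k) (w k) /\ kin (M k) (w k) (w k) <= L] ->
  (fun k => ip (M k) (w k) (w k)) @ U --> (0 : R) ->
  (fun k => w k (gridindex (M k) x)) @ U --> (0 : R).
Proof.
move=> L0 Hw ip0; apply/cvgrPdist_le => eps eps0.
pose s := eps ^+ 2 / (L + 1).
have s0 : 0 < s by rewrite divr_gt0 ?exprn_gt0 //; lra.
pose d := eps ^+ 2 / (2 * (1 + 2 / s)).
have s1 : 0 < 1 + 2 / s by rewrite ltr_pwDl // divr_ge0 // ltW.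
have d0 : 0 < d by rewrite divr_gt0 ?exprn_gt0 // mulr_gt0.
apply: filterS3 (ML 0) Hw (cvgr_le _ ip0 _ d0) => k /= m0 [pw kw] ipd.
rewrite sub0r normrN -ler_sqr ?nnegrE ?(ltW eps0) // real_normK ?num_real //.
apply: le_trans (agmon (gridindex (M k) x) m0 pw s0) _.
have h1 : s / 2 * kin (M k) (w k) (w k) <= s / 2 * L.
  by rewrite ler_wpM2l // divr_ge0 // ltW.
have h2 : s / 2 * L <= eps ^+ 2 / 2.
  rewrite /s (_ : _ * L = eps ^+ 2 / 2 * (L / (L + 1))); last by field; apply: lt0r_neq0; lra.
  by rewrite ler_piMr ?divr_ge0 ?sqr_ge0 // ler_pdivrMr ?mul1r //; lra.
have h3 : (1 + 2 / s) * ip (M k) (w k) (w k) <= eps ^+ 2 / 2.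
  apply: le_trans (ler_wpM2l (ltW s1) ipd) _.
  by rewrite /d le_eqVlt; apply/orP; left; apply/eqP; field; rewrite !gt_eqF //; lra.
by move: h3; rewrite mulrDl mul1r; lra.
Qed.

Lemma gridindex_natr m i : (i < m)%N -> gridindex m (i%:R / m%:R : R) = i.
Proof.
move=> im; have mr : 0 < m%:R :> R by rewrite ltr0n (leq_ltn_trans _ im).
have f0 : Num.floor (i%:R / m%:R : R) = 0.
  by apply/floor_def; rewrite mulr0z add0r mulr1z divr_ge0 //= ltr_pdivrMr // mul1r ltr_nat.
by rewrite /gridindex f0 mulr0z subr0 mulrC divfK ?gt_eqF // natrK.
Qed.

Lemma finite_near (P : nat -> nat -> Prop) J :
  (forall j, U [set k | P j k]) -> U [set k | forall j, (j < J)%N -> P j k].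
Proof.
move=> H; elim: J => [|J IH]; first by apply: filterS filterT => k _ j.
apply: filterS2 IH (H J) => k /= h1 h2 j; rewrite ltnS leq_eqVlt => /orP[/eqP->//|].
exact: h1.
Qed.

(** Pointwise convergence at the finitely many points [j / J], together with a common Lipschitz
    constant, gives uniform smallness on the grid. *)
Lemma limit0_ip_cvg0 (w : nat -> nat -> R) (L : R) : 0 <= L ->
  U [set k | grid_periodic (M k) (w k) /\ forall j, (M k)%:R * `|dif (w k) j| <= L] ->
  (forall x : R, (fun k => w k (gridindex (M k) x)) @ U --> (0 : R)) ->
  (fun k => ip (M k) (w k) (w k)) @ U --> (0 : R).
Proof.
move=> L0 Hw w0; apply/cvgrPdist_le => eps eps0.
(* With [s <= 1] and [s <= eps], values at most [s] have squares at most [eps]. One third of [s] is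
   spent at the net points, two thirds on the Lipschitz error. *)
pose s := Num.min 1 eps; have s0 : 0 < s by rewrite lt_min ltr01.
pose d := s / (3 * (L + 1)).
have d0 : 0 < d by rewrite divr_gt0 // mulr_gt0 //; lra.
pose J := (Num.truncn d^-1).+1.
have Jd : J%:R^-1 <= d.
  rewrite invf_ple ?posrE ?ltr0n // ltW //.
  by have /andP[] := truncn_itv (ltW (etrans (invr_gt0 _) d0) : 0 <= d^-1).
have Jr : 0 < J%:R :> R by rewrite ltr0n.
have s3 : 0 < s / 3 by rewrite divr_gt0.
have near j : U [set k | `|w k (gridindex (M k) (j%:R / J%:R : R))| <= s / 3].
  have /cvgrPdist_le /(_ _ s3) := w0 (j%:R / J%:R).
  by apply: filterS => k /=; rewrite sub0r normrN.
have Hd : U [set k | (0 < M k)%N /\ (M k)%:R^-1 <= d].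
  by apply: filterS2 (ML 0) (cvgr_le _ invM_cvg0 _ d0) => k /=.
apply: filterS3 Hw (finite_near J near) Hd => k /= [pw dw] Hj [m0 md].
have mr : 0 < (M k)%:R :> R by rewrite ltr0n.
rewrite sub0r normrN ger0_norm ?ip_ge0 //.
have wi i : (i < M k)%N -> `|w k i| <= s.
  move=> im; pose j := (i * J %/ M k)%N.
  have jJ : (j < J)%N by rewrite ltn_divLR // mulnC ltn_mul2l.
  have h1 : (j * M k <= i * J)%N := leq_divM _ _.
  have h2 : (i * J < j.+1 * M k)%N by rewrite -ltn_divLR.
  have x1 : j%:R / J%:R <= i%:R / (M k)%:R :> R.
    by rewrite ler_pdivrMr // mulrAC ler_pdivlMr // -!natrM ler_nat.
  have x2 : i%:R / (M k)%:R - j%:R / J%:R <= J%:R^-1 :> R.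
    rewrite lerBlDr -[X in X + _]mul1r -mulrDl addrC natr1.
    by rewrite ler_pdivrMr // mulrAC ler_pdivlMr // -!natrM ler_nat ltnW.
  have [H Hs] := gridstepsP (M k) x1.
  have := H _ pw; rewrite gridindex_natr // => wE.
  have lip : `|w k i - w k (gridindex (M k) (j%:R / J%:R : R))| <=
      L * ((gridsteps (M k) (j%:R / J%:R) (i%:R / (M k)%:R : R))%:R / (M k)%:R).
    by rewrite -wE; exact: grid_lipschitz m0 dw.
  have st : (gridsteps (M k) (j%:R / J%:R) (i%:R / (M k)%:R : R))%:R / (M k)%:R <= 2 * d.
    rewrite ler_pdivrMr //.
    have : (M k)%:R * (i%:R / (M k)%:R - j%:R / J%:R) <= d * (M k)%:R.
      by rewrite mulrC ler_wpM2r // (le_trans x2).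
    have : 1 <= d * (M k)%:R by rewrite -ler_pdivrMr // mul1r.
    by move: Hs; rewrite ler_norml => /andP[_]; lra.
  have lip2 : L * ((gridsteps (M k) (j%:R / J%:R) (i%:R / (M k)%:R : R))%:R / (M k)%:R) <= 2 * (s / 3).
    apply: le_trans (ler_wpM2l L0 st) _.
    have L1 : L + 1 != 0 by apply: lt0r_neq0; lra.
    have -> : L * (2 * d) = 2 * (s / 3) * (L / (L + 1)) by rewrite /d; field.
    rewrite ler_piMr //; first by rewrite mulr_ge0 // ltW.
    by rewrite ler_pdivrMr ?mul1r //; lra.
  have := Hj j jJ; move: lip; rewrite !ler_norml => /andP[? ?] /andP[? ?].
  by apply/andP; split; lra.
have s1 : s <= 1 by rewrite ge_min lexx.
have se : s <= eps by rewrite ge_min lexx orbT.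
rewrite ipE; apply: (@le_trans _ _ ((M k)%:R^-1 * \sum_(i < M k) s)).
  rewrite ler_wpM2l ?invr_ge0 //; apply: ler_sum => i _.
  rewrite -real_normK ?num_real // expr2.
  by apply: le_trans (ler_piMl (normr_ge0 _) (le_trans (wi i (ltn_ord i)) s1)) _; apply: wi.
by rewrite sumr_const card_ord -[s *+ _]mulr_natl mulKf // gt_eqF.
Qed.

Lemma limit_sum J (f : nat -> nat -> R) (l : nat -> R) :
  (forall j, f j @ U --> l j) ->
  (fun k => \sum_(j < J) f j k) @ U --> \sum_(j < J) l j.
Proof.
move=> H; elim: J => [|J IH].
  rewrite big_ord0; under eq_fun do rewrite big_ord0; exact: cst_cvg.
rewrite big_ord_recr; under eq_fun do rewrite big_ord_recr.
exact: limitD.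
Qed.

(** If the limit combination vanishes, the norm of the discrete combination tends to 0; by
    orthonormality that norm is the sum of the squared coefficients on every grid large enough. *)
Lemma limit_eigenfunctions_free J (c : nat -> R) :
  (forall x : R, \sum_(j < J) c j * limit_eigenfunction j x = 0) ->
  forall j, (j < J)%N -> c j = 0.
Proof.
move=> H.
pose w k := lincomb J c (e k).
pose L := \sum_(j < J) `|c j| * limit_bound j.
have L0 : 0 <= L by apply: sumr_ge0 => j _; rewrite mulr_ge0 // limit_bound_ge0.
have ip0 : (fun k => ip (M k) (w k) (w k)) @ U --> (0 : R).
  apply: (limit0_ip_cvg0 L0).
    apply: filterS (ML J) => k /= JM; have [pe _ _ _] := es k; split.
      by apply: grid_periodic_lincomb => j jJ; apply: pe; apply: ltn_trans JM.
    move=> i; rewrite /w /dif /lincomb -sumrB.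
    rewrite -[X in X * _]ger0_norm // -normrM mulr_sumr.
    apply: le_trans (ler_norm_sum _ _ _) _; apply: ler_sum => j _.
    rewrite -mulrBr mulrCA normrM ler_wpM2l // normrM ger0_norm //.
    by apply: discrete_dif_le; apply: ltn_trans JM.
  move=> x; rewrite -[X in _ --> X](H x).
  exact: (@limit_sum J (fun j k => c j * e k j (gridindex (M k) x))
    (fun j => c j * limit_eigenfunction j x)
    (fun j => limitM (cst_cvg (c j)) (limit_eigenfunctionP j x))).
have s0 : \sum_(j < J) c j ^+ 2 = 0.
  apply: (limit_eq0 (cst_cvg _) ip0); apply: filterS (ML J) => k /= JM.
  rewrite ger0_norm; last by apply: sumr_ge0 => j _; rewrite sqr_ge0.
  by rewrite (ip_eigenspan (es k)) // ltnW.
move=> j jJ; apply/eqP; rewrite -sqrf_eq0; apply/eqP.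
have h := psumr_eq0P (fun (i : 'I_J) (_ : true) => sqr_ge0 (c i)) s0.
exact: (h (Ordinal jJ) isT).
Qed.


(** Growth uniform in the grid, which keeps all modes of large index away from a fixed [mu]. *)
Lemma discrete_eigenvalue_ge k n : (n < M k)%N -> n%:R - 3 * K <= D k n.
Proof.
move=> nM; have m0 := M_gt0 nM.
have := weyl_free (Meven k) nM (aK k) (bK k) (es k).
have := free_eigenvalue_ge R m0 (Meven k) nM.
have : n%:R <= 4 * (uphalf n)%:R ^+ 2 :> R by rewrite -natrX -natrM ler_nat; clear; nia.
by rewrite ler_norml => ? ? /andP[? ?]; lra.
Qed.

Lemma kin_le_of_dif m w (L : R) : (0 < m)%N -> (forall j, m%:R * `|dif w j| <= L) ->
  kin m w w <= L ^+ 2.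
Proof.
move=> m0 H; have mr : 0 < m%:R :> R by rewrite ltr0n.
have L0 : 0 <= L by apply: le_trans (H 0%N); rewrite mulr_ge0.
rewrite kinE -(ler_pM2l mr) mulrA -expr2 mulr_sumr.
apply: (@le_trans _ _ (\sum_(i < m) L ^+ 2)); last first.
  by rewrite sumr_const card_ord mulr_natl.
apply: ler_sum => i _.
rewrite -exprMn -real_normK ?num_real // normrM ger0_norm // ler_sqr ?nnegrE //.
Qed.

(** * Expansion of a Hill eigenfunction in limit eigenfunctions *)

Section Expansion.
Variables (mu : R) (y : R -> R).
Hypothesis Ey : periodic_eigenspace (q_minus al be) mu y.

Let smp k (i : nat) : R := y (i%:R / (M k)%:R).

Let q_periodic x : q_minus al be (x + 1) = q_minus al be x.
Proof.
have E : 2 * (x + 1) = 2 * x + 1 + 1 by ring.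
by rewrite /q_minus E !pal !pbe.
Qed.

Let y_periodic x : y (x + 1) = y x.
Proof. by have [] := eigenfunction_periodic q_minus_bound q_periodic Ey x. Qed.

Let smp_periodic k : (0 < M k)%N -> grid_periodic (M k) (smp k).
Proof.
move=> m0 i; rewrite /smp natrD mulrDl divff ?y_periodic //.
by rewrite pnatr_eq0 -lt0n.
Qed.

(** Consistency of the discretization: [y''] is Lipschitz by the equation, so the second difference
    is accurate to [O(1 / M k)]. The remaining error comes from moving [y] and [al] to the central
    node. *)
Lemma sample_bounds : exists B1 B2 C : R,
  [/\ forall x, `|y x| <= B1, forall s t, `|y s - y t| <= B2 * `|s - t| &
  forall k, (0 < M k)%N -> forall i,
    `|grid_op (M k) (gs (M k) al) (gs (M k) be) (smp k) i - mu * smp k i.+1| <= C / (M k)%:R].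
Proof.
have [d1 d2] := eigenspace_derive Ey.
have pp x : derive1 y (x + 1) = derive1 y x.
  by have [] := eigenfunction_periodic q_minus_bound q_periodic Ey x.
have [B1 yB] := periodic_continuous_bounded (is_derive_continuous d1) y_periodic.
have [B2 pB] := periodic_continuous_bounded (is_derive_continuous d2) pp.
have yL s t : `|y s - y t| <= B2 * `|s - t| := lipschitz_of_derive s t d1 pB.
have B10 : 0 <= B1 by apply: le_trans (yB 0).
have B20 : 0 <= B2 by apply: le_trans (pB 0).
pose L3 := 6 * K * B1 + (3 * K + `|mu|) * B2.
pose r x := (q_minus al be x - mu) * y x.
have rL s t : `|r s - r t| <= L3 * `|s - t|.
  rewrite (_ : _ - _ = (q_minus al be s - q_minus al be t) * y s +
    (q_minus al be t - mu) * (y s - y t)); last by rewrite /r; ring.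
  apply: le_trans (ler_normD _ _) _; rewrite !normrM.
  have -> : L3 * `|s - t| = 6 * K * `|s - t| * B1 + (3 * K + `|mu|) * (B2 * `|s - t|).
    by rewrite /L3; ring.
  rewrite lerD // ler_pM ?q_minus_lipschitz //.
  by apply: le_trans (ler_normB _ _) _; rewrite lerD2r q_minus_bound.
exists B1, B2, (2 * L3 + 2 * K * B2 + 2 * K * B1); split=> // k m0 i.
have mr : 0 < (M k)%:R :> R by rewrite ltr0n.
set h : R := (M k)%:R^-1; set x : R := i.+1%:R / (M k)%:R.
have h0 : 0 < h by rewrite invr_gt0.
have xp : i.+2%:R / (M k)%:R = x + h.
  by rewrite /x -[i.+2%:R]natr1 mulrDl mul1r.
have xm : i%:R / (M k)%:R = x - h.
  by rewrite /x -[i.+1%:R]natr1 mulrDl mul1r addrK.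
rewrite /grid_op /smp /gs -[2 * i.+1%:R / _]mulrA -[2 * i%:R / _]mulrA xp xm -/x.
have sd := second_difference_le x h d1 d2 rL; rewrite -/(r x) (ger0_norm (ltW h0)) in sd.
have e1 : `|(M k)%:R ^+ 2 * (y (x + h) + y (x - h) - 2 * y x) - r x| <= 2 * L3 * h.
  rewrite (_ : _ - _ = (M k)%:R ^+ 2 * (y (x + h) + y (x - h) - 2 * y x - h ^+ 2 * r x)).
    rewrite normrM ger0_norm ?sqr_ge0 //.
    apply: le_trans (ler_wpM2l (sqr_ge0 _) sd) _.
    rewrite le_eqVlt; apply/orP; left; apply/eqP; rewrite /h; field.
    by rewrite gt_eqF.
  by rewrite /h; field; rewrite gt_eqF.
have ny s : `|y (x + s) - y x| <= B2 * `|s|.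
  by have := yL (x + s) x; rewrite (_ : x + s - x = s) //; ring.
have e2 : `|al (2 * x) * (y (x + h) - y x)| <= K * (B2 * h).
  rewrite normrM ler_pM ?(alK.1) //.
  by have := ny h; rewrite (ger0_norm (ltW h0)).
have e3 : `|al (2 * (x - h)) * (y (x - h) - y x)| <= K * (B2 * h).
  rewrite normrM ler_pM ?(alK.1) //.
  by have := ny (- h); rewrite normrN (ger0_norm (ltW h0)).
have e4 : `|(al (2 * (x - h)) - al (2 * x)) * y x| <= K * (2 * h) * B1.
  rewrite normrM ler_pM //.
  apply: le_trans (alK.2 _ _) _; rewrite ler_wpM2l //.
  have -> : 2 * (x - h) - 2 * x = - (2 * h) by ring.
  have h20 : 0 <= 2 * h by rewrite mulr_ge0 // ltW.
  by rewrite normrN ger0_norm.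
rewrite -/h.
have -> : (2 * L3 + 2 * K * B2 + 2 * K * B1) * h = 2 * L3 * h + K * (B2 * h) + K * (B2 * h) +
   K * (2 * h) * B1 by ring.
set T := (X in `|X|).
have -> : T = - ((M k)%:R ^+ 2 * (y (x + h) + y (x - h) - 2 * y x) - r x) -
   al (2 * x) * (y (x + h) - y x) - al (2 * (x - h)) * (y (x - h) - y x) -
   (al (2 * (x - h)) - al (2 * x)) * y x.
  by rewrite /T /r /q_minus; ring.
move: e1 e2 e3 e4; rewrite !ler_norml => /andP[? ?] /andP[? ?] /andP[? ?] /andP[? ?].
by apply/andP; split; lra.
Qed.

(** The residual of the samples has coefficients [(D k n - mu) * sg k n] and norm [O(1 / M k)].
    Hence the limit coefficient vanishes unless the limit eigenvalue is [mu], and for [n >= J],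
    where [D k n - mu >= 1], the residual dominates the tail of the samples. *)
Lemma eigenfunction_expansion J : mu + 1 + 3 * K <= J%:R ->
  exists c : nat -> R, (forall j, limit_eigenvalue j != mu -> c j = 0) /\
    forall x, y x = \sum_(j < J) c j * limit_eigenfunction j x.
Proof.
move=> muJ; have [B1 [B2 [C [yB yL res]]]] := sample_bounds.
have B10 : 0 <= B1 by apply: le_trans (yB 0).
have B20 : 0 <= B2 by have := yL 1 0; rewrite subr0 normr1 mulr1; apply: le_trans.
pose sg k n := ip (M k) (smp k) (e k n).
pose rho k i := grid_op (M k) (gs (M k) al) (gs (M k) be) (smp k) i - mu * smp k i.+1.
(* Since [grid_op] at [i] belongs to node [i + 1], the residual is moved back by one node. *)
pose rr k i := rho k (i + (M k).-1)%N.
have rrP k : (0 < M k)%N -> grid_periodic (M k) (rr k) /\ forall i, rr k i.+1 = rho k i.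
  move=> m0; have pa := gs_periodic (Meven k) m0 pal; have pb := gs_periodic (Meven k) m0 pbe.
  have pr : grid_periodic (M k) (rho k).
    by move=> i; rewrite /rho (grid_op_periodic pa pb (smp_periodic m0)) -addSn smp_periodic.
  split=> i; first by rewrite /rr addnAC pr.
  by rewrite /rr addSnnS prednK // pr.
have rrE k n : (n < M k)%N -> ip (M k) (rr k) (e k n) = (D k n - mu) * sg k n.
  move=> nM; have m0 := M_gt0 nM; have [pe _ ee _] := es k.
  have pa := gs_periodic (Meven k) m0 pal; have pb := gs_periodic (Meven k) m0 pbe.
  have [prr rrS] := rrP k m0; have ps := smp_periodic m0.
  rewrite mulrBl /sg ipC (ipC _ (smp k)) -(ee n nM _ ps) enC en_grid_op //; last exact: pe.
  rewrite /ip -(@sum_grid_shift _ (M k) (fun i => e k n i * rr k i)); last first.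
    by move=> i; rewrite pe // prr.
  rewrite -(@sum_grid_shift _ (M k) (fun i => e k n i * smp k i)); last first.
    by move=> i; rewrite pe // ps.
  rewrite [mu * _]mulrCA -mulrBr [mu * _]mulr_sumr -sumrB; congr (_ * _); apply: eq_bigr => i _.
  by rewrite rrS /rho; ring.
have C0 k : (0 < M k)%N -> 0 <= C / (M k)%:R.
  by move=> m0; apply: le_trans (res k m0 0%N).
have rr2 k : (0 < M k)%N -> ip (M k) (rr k) (rr k) <= (C / (M k)%:R) ^+ 2.
  move=> m0; have [prr rrS] := rrP k m0; have mr : 0 < (M k)%:R :> R by rewrite ltr0n.
  rewrite ipE -(@sum_grid_shift _ (M k) (fun i => rr k i ^+ 2)); last by move=> i; rewrite prr.
  rewrite ler_pdivrMl //.
  rewrite [leRHS](_ : _ = \sum_(i < M k) (C / (M k)%:R) ^+ 2); last first.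
    by rewrite sumr_const card_ord mulr_natl.
  apply: ler_sum => i _; rewrite rrS -real_normK ?num_real // ler_sqr ?nnegrE ?C0 //.
  exact: res.
have parseval k u : (0 < M k)%N -> grid_periodic (M k) u ->
    ip (M k) u u = \sum_(j < M k) ip (M k) u (e k j) ^+ 2.
  move=> m0 pu; rewrite (ip_parseval m0 (es k)) //; apply: eq_bigr => j _.
  by rewrite (ipC _ (e k j)) expr2.
have term k u n : (n < M k)%N -> grid_periodic (M k) u ->
    ip (M k) u (e k n) ^+ 2 <= ip (M k) u u.
  move=> nM pu; rewrite (parseval k u (M_gt0 nM) pu) (bigD1 (Ordinal nM)) //= lerDl.
  by apply: sumr_ge0 => j _; rewrite sqr_ge0.
have sgB k n : (n < M k)%N -> `|sg k n| <= B1.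
  move=> nM; have m0 := M_gt0 nM; have mr : 0 < (M k)%:R :> R by rewrite ltr0n.
  rewrite -ler_sqr ?nnegrE // real_normK ?num_real //.
  apply: le_trans (term k _ n nM (smp_periodic m0)) _.
  rewrite ipE ler_pdivrMl //.
  rewrite [leRHS](_ : _ = \sum_(i < M k) B1 ^+ 2); last by rewrite sumr_const card_ord mulr_natl.
  by apply: ler_sum => i _; rewrite -real_normK ?num_real // ler_sqr ?nnegrE // yB.
pose c n := lim ((fun k => sg k n) @ U).
have cP n : (fun k => sg k n) @ U --> c n.
  by apply: (bounded_cvg_lim (B := B1)); apply: filterS (ML n) => k /= /sgB.
have CM0 : (fun k => C / (M k)%:R) @ U --> (0 : R).
  by rewrite -[X in _ --> X](mulr0 C); exact: limitM (cst_cvg _) invM_cvg0.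
exists c; split=> [n nmu|x].
  have h : (limit_eigenvalue n - mu) * c n = 0.
    apply: (limit_eq0 (limitM (limitB (limit_eigenvalueP n) (cst_cvg mu)) (cP n)) CM0).
    apply: filterS (ML n) => k /= nM; have m0 := M_gt0 nM.
    rewrite -rrE // -ler_sqr ?nnegrE ?C0 // real_normK ?num_real //.
    have [prr _] := rrP k m0.
    exact: le_trans (term k _ n nM prr) (rr2 k m0).
  by move/eqP: h; rewrite mulf_eq0 subr_eq0 (negbTE nmu) => /eqP.
pose w k i := smp k i - lincomb J c (e k) i.
pose L := B2 + \sum_(j < J) `|c j| * limit_bound j.
have wP : U [set k | grid_periodic (M k) (w k) /\ kin (M k) (w k) (w k) <= L ^+ 2].
  apply: filterS (ML J) => k /= JM; have m0 := M_gt0 JM; have [pe _ _ _] := es k.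
  have mr : 0 < (M k)%:R :> R by rewrite ltr0n.
  have pl : grid_periodic (M k) (lincomb J c (e k)).
    by apply: grid_periodic_lincomb => j jJ; apply: pe; apply: ltn_trans JM.
  split; first by move=> i; rewrite /w smp_periodic // pl.
  apply: kin_le_of_dif => // i.
  rewrite -[X in X * _]ger0_norm // -normrM.
  rewrite (_ : _ * _ = (M k)%:R * (smp k i.+1 - smp k i) -
    \sum_(j < J) c j * ((M k)%:R * dif (e k j) i)); last first.
    rewrite (eq_bigr (fun j : 'I_J => (M k)%:R * (c j * e k j i.+1 - c j * e k j i))).
      by rewrite -mulr_sumr sumrB /dif /w /lincomb; ring.
    by move=> j _; rewrite /dif; ring.
  apply: le_trans (ler_normB _ _) _; apply: lerD.
    rewrite normrM ger0_norm // mulrC -ler_pdivlMr //; apply: le_trans (yL _ _) _.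
    rewrite -mulrBl -[i.+1%:R]natr1 (_ : i%:R + 1 - i%:R = 1) ?mul1r; last by ring.
    by rewrite ger0_norm ?invr_ge0.
  apply: le_trans (ler_norm_sum _ _ _) _; apply: ler_sum => j _.
  rewrite normrM ler_wpM2l // normrM ger0_norm //.
  by apply: discrete_dif_le; apply: ltn_trans JM.
have w0 : (fun k => ip (M k) (w k) (w k)) @ U --> (0 : R).
  (* Parseval bound for the norm of [w k]: errors of the first [J] coefficients, then the residual
     for the tail. *)
  pose g k := \sum_(j < J) (sg k j - c j) * (sg k j - c j) + C / (M k)%:R * (C / (M k)%:R).
  have g0 : g @ U --> (0 : R).
    have hj j : (fun k => (sg k j - c j) * (sg k j - c j)) @ U --> (0 : R).
      have d0 : (fun k => sg k j - c j) @ U --> (0 : R).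
        by rewrite -[X in _ --> X](subrr (c j)); exact: limitB (cP j) (cst_cvg _).
      by rewrite -[X in _ --> X](mulr0 0); exact: limitM.
    have hs := @limit_sum J (fun j k => (sg k j - c j) * (sg k j - c j)) (fun=> 0) hj.
    have -> : 0 = \sum_(j < J) 0 + 0 * 0 :> R by rewrite big1 // mulr0 addr0.
    exact: limitD hs (limitM CM0 CM0).
  apply/cvgrPdist_le => eps eps0.
  apply: filterS3 (ML J) wP (cvgr_le _ g0 _ eps0) => k /= JM [pw _] ge.
  have m0 := M_gt0 JM; have [pe oe _ mono] := es k.
  rewrite sub0r normrN ger0_norm ?ip_ge0 //; apply: le_trans ge.
  have JM' := ltnW JM.
  have wE (j : 'I_(M k)) : ip (M k) (w k) (e k j) = sg k j - (if (j < J)%N then c j else 0).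
    have -> : ip (M k) (w k) (e k j) = sg k j - ip (M k) (lincomb J c (e k)) (e k j).
      rewrite /sg /ip -mulrBr -sumrB; congr (_ * _); apply: eq_bigr => i _.
      by rewrite /w mulrBl.
    congr (_ - _); rewrite ip_lincombl; case: ifP => jJ.
      rewrite (bigD1 (Ordinal jJ)) //= big1 ?addr0; first by rewrite oe // eqxx mulr1.
      move=> l lj; rewrite oe //; last by apply: leq_trans (ltn_ord l) JM'.
      by rewrite (_ : (l == j :> nat) = false) ?mulr0 //; apply: negbTE; rewrite -(inj_eq val_inj) in lj.
    apply: big1 => l _; rewrite oe //; last by apply: leq_trans (ltn_ord l) JM'.
    by rewrite (_ : (l == j :> nat) = false) ?mulr0 //; apply/eqP => lj; rewrite -lj ltn_ord in jJ.
  rewrite parseval // (bigID (fun j : 'I_(M k) => (j < J)%N)) /=; apply: lerD.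
    rewrite le_eqVlt; apply/orP; left; apply/eqP.
    rewrite -(big_mkord (fun j => (j < J)%N) (fun j => ip (M k) (w k) (e k j) ^+ 2)).
    rewrite -(big_mkord xpredT (fun j => (sg k j - c j) * (sg k j - c j))).
    rewrite (big_nat_widen _ _ _ _ _ JM') big_nat_cond [RHS]big_nat_cond.
    apply: eq_bigr => j /andP[/andP[_ jM] jJ].
    by have := wE (Ordinal jM); rewrite /= jJ => ->; rewrite expr2.
  rewrite -expr2; apply: le_trans (rr2 k m0).
  have [prr _] := rrP k m0.
  rewrite (parseval k _ m0 prr) [leRHS](bigID (fun j : 'I_(M k) => (j < J)%N)) /=.
  rewrite -[leLHS]add0r; apply: lerD; first by apply: sumr_ge0 => j _; rewrite sqr_ge0.
  apply: ler_sum => j; rewrite -leqNgt => Jj.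
  rewrite wE ltnNge Jj /= subr0 rrE // [leRHS]exprMn ler_peMl ?sqr_ge0 //.
  have : J%:R <= j%:R :> R by rewrite ler_nat.
  have := discrete_eigenvalue_ge (ltn_ord j) => h1 h2.
  by rewrite expr_ge1 //; lra.
have wx0 := ip_cvg0_limit0 x (sqr_ge0 L) wP w0.
have smpx : (fun k => smp k (gridindex (M k) x)) @ U --> y x.
  have B2M : (fun k => B2 / (M k)%:R) @ U --> (0 : R).
    by rewrite -[X in _ --> X](mulr0 B2); exact: limitM (cst_cvg _) invM_cvg0.
  apply/cvgrPdist_le => eps eps0.
  apply: filterS2 (ML 0) (cvgr_le _ B2M _ eps0) => k /= m0.
  by apply: le_trans; rewrite distrC; exact: gridindex_close.
have sx := @limit_sum J (fun j k => c j * e k j (gridindex (M k) x))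
    (fun j => c j * limit_eigenfunction j x)
    (fun j => limitM (cst_cvg (c j)) (limit_eigenfunctionP j x)).
apply/eqP; rewrite -subr_eq0; apply/eqP.
have nwx0 : (fun k => `|w k (gridindex (M k) x)|) @ U --> (0 : R).
  by rewrite -[X in _ --> X](@normr0 R R); exact: cvg_norm wx0.
apply: (limit_eq0 (limitB smpx sx) nwx0).
by apply: filterS filterT => k _ /=.
Qed.

End Expansion.

Lemma zero_in_eigenspace (q : R -> R) mu : periodic_eigenspace q mu (fun=> 0).
Proof.
have d0 : (fun=> 0 : R)^`() = (fun=> 0) :> (R -> R).
  by apply/funext => x; rewrite derive1_cst.
split => //.
- by move=> x; rewrite d0; exact: derivable_cst.
by move=> x; rewrite /= d0 d0; ring.
Qed.

Lemma limit_eigenvalue_count mu k J :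
  has_dim (periodic_eigenspace (q_minus al be) mu) k -> mu + 1 + 3 * K <= J%:R ->
  count (fun n => limit_eigenvalue n == mu) (iota 0 J) = k.
Proof.
move=> dimk muJ.
apply: (eigenspace_count (y := limit_eigenfunction) dimk (zero_in_eigenspace _ _)).
- by move=> n /eqP <-; exact: limit_eigenfunction_in.
- by move=> c c0 j jJ; exact: (limit_eigenfunctions_free c0).
by move=> f Ef; exact: eigenfunction_expansion.
Qed.

Lemma limit_eigenvalue_monotone : nondecreasing_seq limit_eigenvalue.
Proof.
move=> i j ij; apply: (le_limit (limit_eigenvalueP i) (limit_eigenvalueP j)).
by apply: filterS (ML j) => k /= jM; have [_ _ _ mono] := es k; exact: mono.
Qed.

Theorem hill_eigenvalue_limit (lam : nat -> R) n :
  periodic_eigenvalues (q_minus al be) lam -> lam n = limit_eigenvalue n.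
Proof.
move=> [mono mult]; apply: monotone_eq_of_count => //; first exact: limit_eigenvalue_monotone.
move=> mu; have [k [dimk ck]] := mult mu.
have [J0 HJ0] : exists J0, forall J, (J0 <= J)%N -> count (fun n => lam n == mu) (iota 0 J) = k.
  apply: card_eq_count; rewrite (_ : [set n | lam n == mu] = [set n | lam n = mu]) //.
  by apply/seteqP; split => i /= /eqP.
pose J1 := (Num.truncn `|mu + 1 + 3 * K|).+1.
exists (maxn J0 J1) => J; rewrite geq_max => /andP[h0 h1].
rewrite HJ0 // (limit_eigenvalue_count dimk) //.
apply: le_trans (ler_norm _) _; apply: (@le_trans _ _ J1%:R); last by rewrite ler_nat.
by have /andP[_ /ltW] := truncn_itv (normr_ge0 (mu + 1 + 3 * K)).
Qed.

End HillLimit.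

(** * Uniform properties of the potentials and the sign symmetry of the matrix *)

Section Potentials.
Variable R : realType.
Implicit Types (f al be : R -> R).

(** The estimates see a potential only through this one constant, which is what makes them uniform
    on bounded sets. *)
Definition admissible (K : R) f :=
  [/\ bounded_lipschitz K f, forall x, f (x + 1) = f x &
   forall N, (0 < N)%N -> `|N%:R^-1 * \sum_(i < N) f (i%:R / N%:R)| <= K / N%:R].

Lemma admissible_opp K f : admissible K f -> admissible K (fun x => - f x).
Proof.
move=> [[fK fL] pf mf]; split.
- split=> [x|x y]; first by rewrite normrN.
  by rewrite -opprD normrN fL.
- by move=> x; rewrite pf.
by move=> N N0; rewrite sumrN mulrN normrN mf.
Qed.

(** On each cell the mean value theorem for a primitive yields a point [c] at which [f] has the
    exact cell average. These averages sum to zero, and each sample differs from its average by at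
    most [K / N]. *)
Lemma riemann_sum_mean_zero f (K : R) N : continuous f ->
  (forall x y, `|f x - f y| <= K * `|x - y|) ->
  \int[lebesgue_measure]_(x in `[0, 1]) f x = 0 -> (0 < N)%N ->
  `|N%:R^-1 * \sum_(i < N) f (i%:R / N%:R)| <= K / N%:R.
Proof.
move=> cf fL f0 N0; have Nr : 0 < N%:R :> R by rewrite ltr0n.
have fi (a b : R) : lebesgue_measure.-integrable `[a, b] (EFin \o f).
  apply: continuous_compact_integrable; first exact: segment_compact.
  exact: continuous_subspaceT.
(* The primitive starts at [- 1] so that it is differentiable in a neighbourhood of the whole
   interval from 0 to 1. *)
pose G (x : R) := (\int[lebesgue_measure]_(t in `[(- 1 : R), x]) f t)%R.
have Gd (x : R) : x \in `]-1, 2[%R -> is_derive x 1 G (f x).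
  rewrite in_itv /= => /andP[x1 x2].
  have [|dG GE] := continuous_FTC1 x2 (fi (-1) 2) _ (cf x).
    by rewrite /= lte_fin.
  by rewrite -GE derive1E; apply: derivableP.
have G01 : G 1 - G 0 = 0.
  rewrite /G Rintegral_itvB ?bnd_simp ?Rintegral_itv_obnd_cbnd //; try lra.
  by apply: integrableS (fi 0 1) => //; exact: subset_itv_oc_cc.
have step (i : 'I_N) : exists c, `|f (i%:R / N%:R) - f c| <= K / N%:R /\
    G (i.+1%:R / N%:R) - G (i%:R / N%:R) = f c / N%:R.
  have le1 : i%:R / N%:R <= i.+1%:R / N%:R :> R by rewrite ler_pM2r ?invr_gt0 // ler_nat.
  have i0 : 0 <= i%:R / N%:R :> R by rewrite divr_ge0.
  have i1 : i.+1%:R / N%:R <= 1 :> R by rewrite ler_pdivrMr // mul1r ler_nat.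
  have inI (t : R) : t \in `[i%:R / N%:R, i.+1%:R / N%:R]%R -> t \in `]-1, 2[%R.
    by rewrite !in_itv /= => /andP[? ?]; apply/andP; split; lra.
  have [|c] := @MVT_segment R G f _ _ le1 (fun t h => Gd t (inI t (subset_itv_oo_cc h))).
    apply: derivable_within_continuous => t /inI ti.
    by have h := Gd t ti; exact: ex_derive.
  have d : i.+1%:R / N%:R - i%:R / N%:R = N%:R^-1 :> R.
    by rewrite -[i.+1%:R]natr1; field; rewrite gt_eqF.
  rewrite d in_itv /= => /andP[c1 c2] E; exists c; split=> //.
  have K0 : 0 <= K by have := fL 1 0; rewrite subr0 normr1 mulr1; apply: le_trans.
  apply: le_trans (fL _ _) _; rewrite ler_wpM2l // distrC ger0_norm ?subr_ge0 //.
  by move: c2 d; lra.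
have [c cP] := choice step.
have tel : \sum_(i < N) (f (c i) / N%:R) = 0.
  rewrite -(eq_bigr _ (fun i _ => (cP i).2)).
  rewrite -(big_mkord xpredT (fun i => G (i.+1%:R / N%:R) - G (i%:R / N%:R))).
  rewrite telescope_sumr // mul0r divff ?gt_eqF //; exact: G01.
have -> : N%:R^-1 * \sum_(i < N) f (i%:R / N%:R) =
    N%:R^-1 * \sum_(i < N) f (i%:R / N%:R) - \sum_(i < N) (f (c i) / N%:R).
  by rewrite tel subr0.
rewrite mulr_sumr -sumrB.
apply: le_trans (ler_norm_sum _ _ _) _.
apply: (@le_trans _ _ (\sum_(i < N) K / N%:R / N%:R)).
  apply: ler_sum => i _; rewrite mulrC -mulrBl normrM.
  by rewrite [X in _ * X]ger0_norm ?invr_ge0 // ler_wpM2r ?invr_ge0 // (cP i).1.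
by rewrite sumr_const card_ord -[leLHS]mulr_natr divfK // gt_eqF.
Qed.

Lemma C2_0_admissible f (K : R) : C2_0 f -> C2_norm f <= K -> admissible K f.
Proof.
move=> [pf df ddf cddf f0] fK.
have fd (x : R) : is_derive x 1 f (derive1 f x) by rewrite derive1E; apply: derivableP.
have fdd (x : R) : is_derive x 1 (derive1 f) (derive1 (derive1 f) x).
  by rewrite [derive1 (derive1 f) x]derive1E; apply: derivableP.
have cf := is_derive_continuous fd; have cdf := is_derive_continuous fdd.
have pder (g : R -> R) (x : R) : (forall x : R, is_derive x 1 g (derive1 g x)) ->
    (forall x, g (x + 1) = g x) -> derive1 g (x + 1) = derive1 g x.
  move=> gd pg; have h := is_derive_shift (gd (x + 1)).
  have E : (fun t => g (t + 1)) = g by apply/funext.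
  by rewrite E in h; rewrite [RHS]derive1E derive_val.
have pdf x : derive1 f (x + 1) = derive1 f x by exact: pder.
have pddf x : derive1 (derive1 f) (x + 1) = derive1 (derive1 f) x by exact: pder.
have sup_ub (g : R -> R) : continuous g -> (forall x, g (x + 1) = g x) ->
    forall x, `|g x| <= sup_norm g.
  move=> cg pg x; have [B gB] := periodic_continuous_bounded cg pg.
  by apply: ub_le_sup; [exists B => _ [t _ <-] | exists x].
have b0 := sup_ub f cf pf; have b1 := sup_ub _ cdf pdf; have b2 := sup_ub (f^`(2))%classic cddf pddf.
have n0 := le_trans (normr_ge0 _) (b0 0); have n1 := le_trans (normr_ge0 _) (b1 0).
have n2 := le_trans (normr_ge0 _) (b2 0).
have fL x y : `|f x - f y| <= K * `|x - y|.
  apply: lipschitz_of_derive fd _ => t.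
  by apply: le_trans (b1 t) _; apply: le_trans fK; rewrite /C2_norm; lra.
split => //; last by move=> N N0; exact: riemann_sum_mean_zero.
split => // x; apply: le_trans (b0 x) _; apply: le_trans fK; rewrite /C2_norm; lra.
Qed.

(** The [2 N] samples run twice through the grid of mesh [1 / N]. *)
Lemma mean_gs_le f (K F : R) N : admissible K f -> 0 < F -> F <= N%:R -> (0 < N)%N ->
  `|(2 * N)%:R^-1 * \sum_(i < 2 * N) gs (2 * N) f i| <= K / F.
Proof.
move=> [[fK _] pf mf] F0 FN N0; have Nr : 0 < N%:R :> R by rewrite ltr0n.
have K0 : 0 <= K by apply: le_trans (fK 0).
apply: (@le_trans _ _ (K / N%:R)); last by rewrite ler_wpM2l // lef_pV2.
apply: le_trans (mf N N0); rewrite le_eqVlt; apply/orP; left; apply/eqP; congr `|_|.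
have gE i : gs (2 * N) f i = f (i%:R / N%:R).
  by rewrite /gs natrM; congr f; field; rewrite gt_eqF.
rewrite (eq_bigr _ (fun (i : 'I_(2 * N)) _ => gE i)).
have -> : \sum_(i < 2 * N) f (i%:R / N%:R) = 2 * \sum_(i < N) f (i%:R / N%:R).
  rewrite mul2n -addnn big_split_ord /= [2 * _]mulr_natl mulr2n; congr (_ + _).
  by apply: eq_bigr => i _; rewrite natrD mulrDl divff ?gt_eqF // addrC pf.
by rewrite natrM; field; rewrite gt_eqF.
Qed.

(** Conjugation by alternating signs fixes the diagonal and negates the neighbour entries and the
    corners, as [2 N - 1] is odd; a global sign then leaves only the diagonal negated. *)
Lemma Qmx_opp_eigenvalues al be N s : (2 <= N)%N ->
  mx_eigenvalues (Qmx al be N) s ->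
  mx_eigenvalues (Qmx al (fun x => - be x) N) (rev [seq - x | x <- s]).
Proof.
move=> N2 [ss cs].
have [szs [P [PP PA]]] := symmetric_orthodiagonalization (Qmx_sym al be N2) cs.
split.
  rewrite rev_sorted sorted_map; apply: sub_sorted ss => x y /=; rewrite lerN2 //.
pose Sg : 'M[R]_(2 * N) := diag_mx (\row_i (-1) ^+ i).
have SS : Sg *m Sg = 1%:M.
  rewrite mulmx_diag; apply/matrixP => i j; rewrite !mxE -expr2 sqrr_sign.
  by case: eqP.
have ST : Sg^T = Sg by rewrite tr_diag_mx.
have QE : Qmx al (fun x => - be x) N = - (Sg *m Qmx al be N *m Sg).
  apply/matrixP => i j; rewrite mxE mul_mx_diag mxE mul_diag_mx !mxE.
  have il := ltn_ord i; have jl := ltn_ord j.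
  have sg : (-1) ^+ i * (-1) ^+ j = (-1) ^+ (i + j) :> R by rewrite exprD.
  set q := (X in - ((-1) ^+ i * X * (-1) ^+ j)).
  rewrite (_ : _ * q * _ = (-1) ^+ (i + j) * q); last by rewrite -sg; ring.
  rewrite -signr_odd /q.
  case: (eqVneq (i : nat) j) => [->|ij].
    by rewrite oddD addbb expr0 mul1r /coef_b mulrN.
  case: (eqVneq (j : nat) i.+1) => [->|ji].
    by rewrite (_ : odd (i + i.+1)) ?expr1 ?mulN1r ?opprK //; lia.
  case: (eqVneq (i : nat) j.+1) => [->|ij'].
    by rewrite (_ : odd (j.+1 + j)) ?expr1 ?mulN1r ?opprK //; lia.
  case: ifP => h; last by rewrite mulr0 oppr0.
  by rewrite (_ : odd (i + j)) ?expr1 ?mulN1r ?opprK //; lia.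
have WW : (P *m Sg) *m (P *m Sg)^T = 1%:M.
  by rewrite trmx_mul ST mulmxA -(mulmxA P) SS mulmx1.
rewrite -(char_poly_orthogonal (Qmx al (fun x => - be x) N) WW).
have -> : P *m Sg *m Qmx al (fun x => - be x) N *m (P *m Sg)^T =
    diag_mx (\row_i (- s`_i)).
  rewrite QE mulmxN mulNmx trmx_mul ST !mulmxA -(mulmxA P Sg Sg) SS mulmx1.
  rewrite -(mulmxA _ Sg Sg) SS mulmx1 PA -mulmxA PP mulmx1 -linearN /=.
  by congr diag_mx; apply/rowP => i; rewrite !mxE.
rewrite char_poly_trig; last by apply: diag_mx_is_trig.
rewrite (perm_big [seq - x | x <- s]) /=; last by rewrite perm_rev.
rewrite big_map (big_nth 0) szs big_mkord; apply: eq_bigr => i _.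
by rewrite !mxE eqxx.
Qed.

End Potentials.

(** * Edge and bulk estimates and their assembly *)

Section Asymptotics.
Variable R : realType.
Implicit Types (al be : R -> R).

(** The bound of [grid_refinement] does not depend on [k], so it survives the limit over the grids
    with [m * k.+1] points, where the fine eigenvalue becomes [lam n]. *)
Lemma limit_error (al be : R -> R) (K F : R) m D e (lam : nat -> R) n :
  bounded_lipschitz K al -> bounded_lipschitz K be ->
  (forall x, al (x + 1) = al x) -> (forall x, be (x + 1) = be x) ->
  ~~ odd m -> (3 < m)%N -> (n < m)%N ->
  1 <= F -> F ^+ 2 <= m%:R -> (uphalf n)%:R <= F -> 2 * (64 + 6 * K) <= m%:R ->
  eigensystem m (gs m al) (gs m be) D e ->
  periodic_eigenvalues (q_minus al be) lam ->
  `|D n - lam n| <= refinement_const K * (F ^+ 2 / m%:R).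
Proof.
move=> alK beK pal pbe me m3 nm F1 Fm nF mK es0 hlam.
pose M k := (m * k.+1)%N.
have Dex k : exists D' : nat -> R, exists e,
    eigensystem (M k) (gs (M k) al) (gs (M k) be) D' e.
  have k2 : (2 <= m./2 * k.+1)%N by lia.
  have [s sP] := Qmx_eigenvalues_exist al be k2.
  have [_ [e' esP]] := Qmx_eigensystem k2 pal pbe sP.
  have ME : (2 * (m./2 * k.+1) = M k)%N by rewrite mulnA mul2n /M; congr (_ * _)%N; lia.
  by rewrite ME in esP; exists (fun n => (M k)%:R ^+ 2 * (s`_n + 2)), e'.
have [D' D'P] := choice Dex; have [e' es'] := choice D'P.
have [U [UU Uoo]] := ultraFilterLemma (@eventually_filter).
have ML j : U [set k | (j < M k)%N].
  apply: Uoo; exists j => // k /= jk.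
  by apply: leq_trans (leq_pmull k.+1 (ltn_trans (ltn0Sn 2) m3)); rewrite ltnS.
have Me k : ~~ odd (M k) by rewrite oddM (negbTE me).
rewrite (hill_eigenvalue_limit alK beK pal pbe UU ML Me es' n hlam).
have cD : D' k n @[k --> U] --> limit_eigenvalue U D' n.
  exact: (limit_eigenvalueP alK beK UU ML Me es').
have cB : D n - D' k n @[k --> U] --> D n - limit_eigenvalue U D' n.
  by apply: (@limitB R U UU (fun=> D n)) => //; exact: cst_cvg.
have cC : (fun=> refinement_const K * (F ^+ 2 / m%:R)) @ U -->
    refinement_const K * (F ^+ 2 / m%:R) by exact: cst_cvg.
apply: (norm_le_limit UU cB cC).
apply: filterE => k /=; rewrite distrC.
exact: (grid_refinement alK beK (ltn0Sn k) me nm F1 Fm nF mK es0 (es' k)).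
Qed.

Lemma left_edge (al be : R -> R) (K F : R) N s (lam : nat -> R) n :
  bounded_lipschitz K al -> bounded_lipschitz K be ->
  (forall x, al (x + 1) = al x) -> (forall x, be (x + 1) = be x) ->
  (3 <= N)%N -> (n < 2 * N)%N ->
  1 <= F -> F ^+ 2 <= N%:R -> (uphalf n)%:R <= F -> 64 + 6 * K <= N%:R ->
  mx_eigenvalues (Qmx al be N) s ->
  periodic_eigenvalues (q_minus al be) lam ->
  `|s`_n - (- 2 + (4 * N%:R ^+ 2)^-1 * lam n)| <=
    refinement_const K * (F ^+ 2 / N%:R ^+ 3).
Proof.
move=> alK beK pal pbe N3 nN F1 FN nF NK hs hlam.
have K0 : 0 <= K by apply: le_trans (alK.1 0).
have Nr : 0 < N%:R :> R by rewrite ltr0n (ltn_trans _ N3).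
have [_ [e es]] := Qmx_eigensystem (ltnW N3) pal pbe hs.
have E2 : (2 * N)%:R = 2 * N%:R :> R by rewrite natrM.
have := limit_error (F := F) alK beK pal pbe _ _ nN F1 _ nF _ es hlam.
rewrite oddM /= E2 => /(_ isT) H.
have {H} := H (_ : (3 < 2 * N)%N) _ _; rewrite (_ : (3 < 2 * N)%N = true); last by lia.
move=> /(_ isT) H.
have {}H : `|(2 * N%:R) ^+ 2 * (s`_n + 2) - lam n| <= refinement_const K * (F ^+ 2 / (2 * N%:R)).
  by apply: H; lra.
have N4 : 0 < 4 * N%:R ^+ 2 :> R by rewrite mulr_gt0 // exprn_gt0.
rewrite (_ : _ - _ = (4 * N%:R ^+ 2)^-1 * ((2 * N%:R) ^+ 2 * (s`_n + 2) - lam n)); last first.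
  by field; rewrite gt_eqF.
rewrite normrM ger0_norm ?invr_ge0 ?(ltW N4) // ler_pdivrMl //.
apply: le_trans H _.
have R0 : 0 <= refinement_const K.
  by rewrite /refinement_const addr_ge0 ?mulr_ge0 ?sqr_ge0 //; lra.
rewrite (_ : 4 * N%:R ^+ 2 * _ = refinement_const K * (8 * (F ^+ 2 / (2 * N%:R)))); last first.
  by field; rewrite gt_eqF.
rewrite ler_wpM2l // ler_peMl ?divr_ge0 ?sqr_ge0 ?mulr_ge0 //; lra.
Qed.

(** The left edge for [- be]: [q_plus al be] is [q_minus] of the negated [be], and the spectrum is
    reversed. *)
Lemma right_edge (al be : R -> R) (K F : R) N s (lam : nat -> R) n :
  bounded_lipschitz K al -> bounded_lipschitz K be ->
  (forall x, al (x + 1) = al x) -> (forall x, be (x + 1) = be x) ->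
  (3 <= N)%N -> (n < 2 * N)%N ->
  1 <= F -> F ^+ 2 <= N%:R -> (uphalf n)%:R <= F -> 64 + 6 * K <= N%:R ->
  mx_eigenvalues (Qmx al be N) s ->
  periodic_eigenvalues (q_plus al be) lam ->
  `|s`_(2 * N - 1 - n) - (2 - (4 * N%:R ^+ 2)^-1 * lam n)| <=
    refinement_const K * (F ^+ 2 / N%:R ^+ 3).
Proof.
move=> alK beK pal pbe N3 nN F1 FN nF NK hs hlam.
have bK : bounded_lipschitz K (fun x => - be x).
  by split=> [x|x y]; rewrite ?normrN ?beK.1 // -opprD normrN; apply: beK.2.
have pb x : - be (x + 1) = - be x by rewrite pbe.
have [szs _] := Qmx_eigensystem (ltnW N3) pal pbe hs.
have qE : q_plus al be = q_minus al (fun x => - be x) by [].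
rewrite qE in hlam.
have := left_edge alK bK pal pb N3 nN F1 FN nF NK
  (Qmx_opp_eigenvalues (ltnW N3) hs) hlam.
rewrite nth_rev size_map szs // (nth_map 0) ?szs; last by clear -nN; lia.
rewrite subnS -subn1 subnAC -normrN; congr (`|_| <= _); ring.
Qed.

(** For [m = 2 N] the free eigenvalue divided by [m^2], minus 2, is [- 2 cos(l pi / N)] by the
    double angle formula. *)
Lemma bulk_upper (al be : R -> R) (K F : R) N l s :
  admissible K al -> admissible K be -> 1 <= K -> 1 <= F -> 3 * K <= F -> F <= N%:R ->
  (2 <= N)%N -> (Num.truncn F < l)%N -> (l < N - Num.truncn F)%N ->
  mx_eigenvalues (Qmx al be N) s ->
  s`_(2 * l) <= - 2 * cos (l%:R * pi / N%:R) + (9 * K + 6 * K ^+ 2) / (4 * N%:R ^+ 2 * F).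
Proof.
move=> aK bK K1 F1 KF FN N2 fl lf hs.
have N0 : (0 < N)%N by rewrite ltnW.
have Nr : 0 < N%:R :> R by rewrite ltr0n.
have F0 : 0 < F by lra.
have [alK pal _] := aK; have [beK pbe _] := bK.
have [_ [e es]] := Qmx_eigensystem N2 pal pbe hs.
have fF : F < (Num.truncn F).+1%:R by have /andP[] := truncn_itv (ltW F0).
have f1 : (1 <= Num.truncn F)%N by rewrite -ltnS -(ltr_nat R); lra.
have ma := mean_gs_le aK F0 FN N0; have mb := mean_gs_le bK F0 FN N0.
have me : ~~ odd (2 * N) by rewrite oddM.
have l0 : (0 < l)%N by apply: leq_ltn_trans fl.
have lN : (l.*2 < 2 * N)%N by clear -lf; lia.
have g1 : F <= (l.*2 - 1)%:R.
  by apply: le_trans (ltW fF) _; rewrite ler_nat; clear -fl f1; lia.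
have g2 : F <= (2 * N - l.*2)%:R.
  by apply: le_trans (ltW fF) _; rewrite ler_nat; clear -lf f1; lia.
have := bulk_eigenvalue_le alK beK pal pbe K1 KF me l0 lN g1 g2 ma mb es.
rewrite /free_eigenvalue uphalf_double => H.
have cosE : cos (l%:R * pi / N%:R) = 1 - 2 * sin (halfangle R (2 * N) l) ^+ 2.
  have -> : l%:R * pi / N%:R = halfangle R (2 * N) l *+ 2.
    by rewrite /halfangle natrM mulr2n; field; rewrite gt_eqF.
  by rewrite cos_mulr2n cos2sin2 mulr2n; ring.
rewrite cosE; set sn := sin _ in H *.
have N4 : 0 < 4 * N%:R ^+ 2 :> R by rewrite mulr_gt0 // exprn_gt0.
rewrite -(ler_pM2l N4).
have -> : 4 * N%:R ^+ 2 * (- 2 * (1 - 2 * sn ^+ 2) + (9 * K + 6 * K ^+ 2) / (4 * N%:R ^+ 2 * F)) =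
   4 * (2 * N%:R) ^+ 2 * sn ^+ 2 + (9 * K + 6 * K ^+ 2) / F - 2 * (4 * N%:R ^+ 2).
  by field; rewrite !gt_eqF.
have h4 : (2 * N%:R) ^+ 2 * (s`_(l.*2) + 2) = 4 * N%:R ^+ 2 * s`_(l.*2) + 2 * (4 * N%:R ^+ 2) by ring.
by move: H; rewrite natrM h4 mul2n; lra.
Qed.

(** The upper bound at frequency [N - l] of the reversed spectrum is a lower bound at index
    [2 l - 1], since [2 N - 1 - 2 (N - l) = 2 l - 1]. Monotonicity places both eigenvalues of the
    pair between the two bounds. *)
Lemma bulk_bound (al be : R -> R) (K F : R) N l n s :
  admissible K al -> admissible K be -> 1 <= K -> 1 <= F -> 3 * K <= F -> F <= N%:R ->
  (2 <= N)%N -> (Num.truncn F < l)%N -> (l < N - Num.truncn F)%N ->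
  n = (2 * l)%N \/ n = (2 * l - 1)%N ->
  mx_eigenvalues (Qmx al be N) s ->
  `|s`_n - (- 2 * cos (l%:R * pi / N%:R))| <= (9 * K + 6 * K ^+ 2) / (N%:R ^+ 2 * F).
Proof.
move=> aK bK K1 F1 KF FN N2 fl lf nl hs.
have Nr : 0 < N%:R :> R by rewrite ltr0n ltnW.
have F0 : 0 < F by lra.
have [alK pal _] := aK; have [beK pbe _] := bK.
have [szs _] := Qmx_eigensystem N2 pal pbe hs.
have lN : (l < N)%N by clear -lf; lia.
have l0 : (0 < l)%N by apply: leq_ltn_trans fl.
have up := bulk_upper aK bK K1 F1 KF FN N2 fl lf hs.
have hs' := Qmx_opp_eigenvalues N2 hs.
have fl' : (Num.truncn F < N - l)%N by clear -lf; lia.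
have lf' : (N - l < N - Num.truncn F)%N by clear -fl lN; lia.
have low := bulk_upper aK (admissible_opp bK) K1 F1 KF FN N2 fl' lf' hs'.
rewrite nth_rev size_map szs in low; last by clear -l0 lN; lia.
rewrite (nth_map 0) ?szs in low; last by clear -l0 lN; lia.
rewrite (_ : 2 * N - (2 * (N - l)).+1 = 2 * l - 1)%N in low; last by clear -l0 lN; lia.
have cosR : cos ((N - l)%:R * pi / N%:R) = - cos (l%:R * pi / N%:R) :> R.
  rewrite (natrB _ (ltnW lN)) (_ : _ / _ = - (l%:R * pi / N%:R) + pi); last by field; rewrite gt_eqF.
  by rewrite cosDpi cosN.
rewrite cosR in low.
have mono : s`_(2 * l - 1) <= s`_(2 * l).
  by apply: (sorted_leq_nth le_trans le_refl 0 hs.1); rewrite ?inE ?szs; clear -l0 lN; lia.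
set c := cos _ in up low *; set E := _ / (4 * _ * _) in up low.
have EC : E <= (9 * K + 6 * K ^+ 2) / (N%:R ^+ 2 * F).
  have N2F : 0 < N%:R ^+ 2 * F by rewrite mulr_gt0 // exprn_gt0.
  have C0 : 0 <= 9 * K + 6 * K ^+ 2 by rewrite addr_ge0 ?mulr_ge0 ?sqr_ge0 //; lra.
  rewrite /E ler_wpM2l // lef_pV2 ?posrE // -?mulrA ?mulr_gt0 //.
  by rewrite ler_peMl ?(ltW N2F) //; lra.
by case: nl => ->; rewrite ler_norml; apply/andP; split; lra.
Qed.

End Asymptotics.

Unset Implicit Arguments.
Set Strict Implicit.

Theorem theorem2p1 (R : realType) (F : nat -> R) (eta : R)
  (F_ge1 : forall N : nat, (0 < N)%N -> 1 <= F N)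
  (F_incr : forall m n : nat, (0 < m)%N -> (m <= n)%N -> F m <= F n)
  (F_lim : F n @[n --> \oo] --> +oo)
  (eta_gt0 : 0 < eta) (eta_lt : eta < 1 / 2)
  (F_le : forall N : nat, (0 < N)%N -> F N <= N%:R `^ eta)
  (S : set ((R -> R) * (R -> R))) (S_bounded : C2_0_bounded S) :
  exists (C : R) (N1 : nat), forall N : nat, (3 <= N)%N -> (N1 <= N)%N ->
  forall alpha beta : R -> R, S (alpha, beta) ->
  forall (lamN : seq R) (lam_minus lam_plus : nat -> R),
  mx_eigenvalues (Qmx alpha beta N) lamN ->
  periodic_eigenvalues (q_minus alpha beta) lam_minus ->
  periodic_eigenvalues (q_plus alpha beta) lam_plus ->
  [/\ forall n : nat, (n <= 2 * Num.truncn (F N))%N ->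
        `|lamN`_n - (- 2 + (4 * N%:R ^+ 2)^-1 * lam_minus n)|
          <= C * (F N ^+ 2 / N%:R ^+ 3),
      forall n : nat, (n <= 2 * Num.truncn (F N))%N ->
        `|lamN`_(2 * N - 1 - n) - (2 - (4 * N%:R ^+ 2)^-1 * lam_plus n)|
          <= C * (F N ^+ 2 / N%:R ^+ 3) &
      forall l n : nat, (Num.truncn (F N) < l)%N ->
        (l < N - Num.truncn (F N))%N -> n = (2 * l)%N \/ n = (2 * l - 1)%N ->
        `|lamN`_n - (- 2 * cos (l%:R * pi / N%:R))|
          <= C / (N%:R ^+ 2 * F N)].
Proof.
have [SC [M0 SM]] := S_bounded.
(* Adding 1 provides [1 <= K], as the bulk estimate requires. *)
pose K : R := 1 + `|M0|.
have K1 : 1 <= K by rewrite lerDl.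
have MK : M0 <= K by apply: le_trans (ler_norm _) _; rewrite lerDr.
have [n0 _ n0P] : \forall n \near \oo, 3 * K <= F n by move/cvgryPge: F_lim; apply.
pose A : R := refinement_const K; pose B : R := 9 * K + 6 * K ^+ 2.
have A0 : 0 <= A by rewrite /A /refinement_const addr_ge0 ?mulr_ge0 ?sqr_ge0 //; lra.
have B0 : 0 <= B by rewrite /B addr_ge0 ?mulr_ge0 ?sqr_ge0 //; lra.
(* [A] serves the edges and [B] the bulk. The threshold ensures [3 K <= F N] and [64 + 6 K <= N]. *)
exists (A + B), (maxn n0 (Num.truncn (64 + 6 * K)).+1) => N N3.
rewrite geq_max => /andP[n0N KN] al be Sab s lm lp hs hm hp.
have [/= Ca Cb] := SC _ Sab; have [/= Ma Mb] := SM _ Sab.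
have aK := C2_0_admissible Ca (le_trans Ma MK).
have bK := C2_0_admissible Cb (le_trans Mb MK).
have [alK pal _] := aK; have [beK pbe _] := bK.
have N0 : (0 < N)%N by rewrite (ltn_trans _ N3).
have Nr : 1 <= N%:R :> R by rewrite ler1n.
have F1 := F_ge1 N N0.
have F0 : 0 <= F N by rewrite (le_trans ler01).
have KF : 3 * K <= F N by apply: n0P.
(* This is where [eta < 1/2] enters. *)
have FN : F N ^+ 2 <= N%:R.
  apply: (@le_trans _ _ ((N%:R `^ eta) ^+ 2)).
    by rewrite ler_pXn2r ?nnegrE ?powR_ge0 ?F_le.
  rewrite -powR_mulrn ?powR_ge0 // -powRrM //.
  by apply: ler1_powR => //; move: eta_lt; clear; lra.
have FN1 : F N <= N%:R by apply: le_trans FN; rewrite expr2 ler_peMl.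
have NK : 64 + 6 * K <= N%:R.
  have K0 : 0 <= 64 + 6 * K by move: K1; clear; lra.
  have /andP[_ /ltW h] := truncn_itv K0.
  by apply: le_trans h _; rewrite ler_nat.
have [fF Ff] := andP (truncn_itv F0).
(* The edge indices stay inside the list of eigenvalues: [F N >= N] would give [N^2 <= N],
   impossible for [N >= 3]. *)
have nN n : (n <= 2 * Num.truncn (F N))%N -> (n < 2 * N)%N.
  have : (Num.truncn (F N) < N)%N.
    have N3r : 3 <= N%:R :> R by rewrite (ler_nat R 3).
    rewrite -(ltr_nat R) (le_lt_trans fF) // ltNge; apply/negP => NF.
    have : N%:R * N%:R <= F N ^+ 2 by rewrite expr2 ler_pM ?ler0n.
    have : 3 * N%:R <= N%:R * N%:R :> R by rewrite ler_wpM2r.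
    by move: FN N3r; clear; lra.
  by clear; lia.
have nF n : (n <= 2 * Num.truncn (F N))%N -> (uphalf n)%:R <= F N.
  move=> nf; apply: le_trans fF; rewrite ler_nat.
  by rewrite leq_uphalf_double -mul2n.
have E0 : 0 <= F N ^+ 2 / N%:R ^+ 3 by rewrite divr_ge0 ?sqr_ge0 ?exprn_ge0.
split=> [n nf|n nf|l n fl lf nl].
- apply: le_trans (left_edge alK beK pal pbe N3 (nN n nf) F1 FN (nF n nf) NK hs hm) _.
  by rewrite ler_wpM2r // lerDl.
- apply: le_trans (right_edge alK beK pal pbe N3 (nN n nf) F1 FN (nF n nf) NK hs hp) _.
  by rewrite ler_wpM2r // lerDl.
apply: le_trans (bulk_bound aK bK K1 F1 KF FN1 (ltnW N3) fl lf nl hs) _.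
by rewrite ler_wpM2r ?lerDr // invr_ge0 mulr_ge0 ?sqr_ge0.
Qed.
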